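(* Let $a$ be weakly degenerate at $x_0\in[0,1]$. Then the operator $A_1:D(A_1)\subset L^2(0,1)\to L^2(0,1)$, $A_1u:=(au'')''$, is self-adjoint and non negative on $L^2(0,1)$ with dense domain. Hence $-A_1$ generates a contractive analytic semigroup of angle $\frac{\pi}{2}$ on $L^2(0,1)$.
   Context: Function spaces are real (for the analytic semigroup statement, pass to the complexification). A function $a:[0,1]\to[0,\infty)$ is weakly degenerate at $x_0\in[0,1]$ if $a(x_0)=0$, $a>0$ on $[0,1]\setminus\{x_0\}$, $a\in\mathcal C[0,1]\cap\mathcal C^1([0,1]\setminus\{x_0\})$ and $\frac1a\in L^1(0,1)$. $H^2_a(0,1):=\{u\in H^1(0,1): u' \text{ is absolutely continuous in }[0,1],\ \sqrt a\,u''\in L^2(0,1)\}$ and $\mathcal Z(0,1):=\{u\in H^2_a(0,1): au''\in H^2(0,1)\}$. The domain of $A_1$ is: - if $x_0\in(0,1)$: $D(A_1):=\{u\in\mathcal Z(0,1): u''(0)=u''(1)=u'''(0)=u'''(1)=0\}$; - if $x_0=0$: $D(A_1):=\{u\in\mathcal Z(0,1): u''(1)=u'''(1)=0,\ (au'')(0)=(au'')'(0)=0\}$; - if $x_0=1$: $D(A_1):=\{u\in\mathcal Z(0,1): u''(0)=u'''(0)=0,\ (au'')(1)=(au'')'(1)=0\}$. The pointwise values make sense: for $u\in\mathcal Z(0,1)$, $au''$ and $(au'')'$ have continuous representatives on $[0,1]$, and, away from $x_0$, $u''=(au'')/a$ is of class $\mathcal C^1$. *)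

(* Defs.v *)
From HB Require Import structures.
From mathcomp Require Import all_boot all_order all_algebra.
From mathcomp Require Import all_classical all_reals all_analysis.
From mathcomp Require Import measurable_realfun complex ring lra.

Set Implicit Arguments.
Unset Strict Implicit.
Unset Printing Implicit Defensive.

Import Order.TTheory GRing.Theory Num.Theory.
Import numFieldNormedType.Exports.

Local Open Scope classical_set_scope.
Local Open Scope ring_scope.
Local Open Scope complex_scope.
Local Open Scope quotient_scope.

(** * The real Hilbert space [L2 mu] *)

Section L2null.
Context d (T : measurableType d) (R : realType).
Variable mu : {measure set T -> \bar R}.

Definition L2null : {pred LfunType mu (lee1n 2)} :=
  fun f => `[< f = cst 0 %[ae mu] >].

Lemma L2null_zmod_closed : zmod_closed L2null.
Proof.
split=> [|f g]; first by apply/asboolP; apply: aeW.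
move=> /asboolP f0 /asboolP g0; apply/asboolP.
apply: filterS2 f0 g0 => x /= fx gx _.
by rewrite [LHS](_ : _ = f x - g x)// fx// gx//= subr0.
Qed.

HB.instance Definition _ :=
  GRing.isZmodClosed.Build (LfunType mu (lee1n 2)) L2null L2null_zmod_closed.

Definition L2 : Type := Quotient.quot L2null.
HB.instance Definition _ := GRing.Zmodule.on L2.
HB.instance Definition _ := EqQuotient.on L2.

End L2null.

Section L2module.
Context d (T : measurableType d) (R : realType).
Variable mu : {measure set T -> \bar R}.
Notation Lf := (LfunType mu (lee1n 2)).
Notation H := (L2 mu).
Implicit Types (u v w : H) (f g : Lf).

Lemma L2_eqP f g : reflect (f = g %[ae mu]) (\pi_H f == \pi_H g).
Proof.
rewrite -Quotient.idealrBE; apply: (iffP (asboolP _)); apply: filterS => x /=.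
  by move=> /(_ I) /eqP; rewrite [X in X == _](_ : _ = f x - g x)// subr_eq0 => /eqP.
by move=> /(_ I) fg _; rewrite [LHS](_ : _ = f x - g x)// fg subrr.
Qed.

Lemma repr_pi_ae f : (repr (\pi_H f) : Lf) = f %[ae mu].
Proof. by apply/L2_eqP; rewrite reprK. Qed.

Lemma piD f g : \pi_H (f + g) = \pi_H f + \pi_H g.
Proof. exact: Quotient.pi_add. Qed.

Definition L2scale (c : R) u : H := \pi_H (c *: (repr u : Lf)).

Lemma piZ c f : \pi_H (c *: f) = L2scale c (\pi_H f).
Proof.
apply/eqP/L2_eqP; have := repr_pi_ae f.
apply: filterS => x /= /(_ I) h _.
by rewrite [LHS](_ : _ = c * f x)// [RHS](_ : _ = c * (repr (\pi_H f) : Lf) x)// h.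
Qed.

Lemma L2scaleA b c u : L2scale b (L2scale c u) = L2scale (b * c) u.
Proof. by rewrite -[u]reprK -(piZ c) -(piZ b) -(piZ (b * c)) scalerA. Qed.

Lemma L2scale1 : left_id 1 L2scale.
Proof. by move=> u; rewrite -[u]reprK -piZ scale1r. Qed.

Lemma L2scaleDr : right_distributive L2scale +%R.
Proof.
move=> c u v; rewrite -[u]reprK -[v]reprK -piD.
by rewrite -(piZ c (_ + _)) -(piZ c (repr u)) -(piZ c (repr v)) scalerDr piD.
Qed.

Lemma L2scaleDl u : {morph L2scale^~ u : b c / b + c}.
Proof. by move=> b c; rewrite -[u]reprK -(piZ (b + c)) -(piZ b) -(piZ c) scalerDl piD. Qed.

HB.instance Definition _ := GRing.Zmodule_isLmodule.Build R H
  L2scaleA L2scale1 L2scaleDr L2scaleDl.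

Definition L2fun u : T -> R := (repr u : Lf).

Definition ip u v : R := \int[mu]_x (L2fun u x * L2fun v x).

Lemma ip_intg u v :
  mu.-integrable setT (EFin \o (fun x => L2fun u x * L2fun v x)).
Proof. by apply/Lfun1_integrable; apply: Lfun2_mul_Lfun1; exact: LfunP. Qed.

Lemma ipC u v : ip u v = ip v u.
Proof. by apply: eq_Rintegral => x _; rewrite mulrC. Qed.

Lemma L2funD u v : L2fun (u + v) = (fun x => L2fun u x + L2fun v x) %[ae mu].
Proof.
have e : u + v = \pi_H (repr u + repr v : Lf) by rewrite piD !reprK.
apply: filterS (repr_pi_ae (repr u + repr v)) => x /(_ I) h _.
by rewrite /L2fun e h.
Qed.

Lemma L2funZ c u : L2fun (c *: u) = (fun x => c * L2fun u x) %[ae mu].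
Proof.
by apply: filterS (repr_pi_ae (c *: (repr u : Lf))) => x /(_ I) h _; exact: h.
Qed.

Lemma measurable_L2fun u : measurable_fun setT (L2fun u).
Proof. exact: measurable_funP. Qed.

Let ae_eq_Rint (f g : T -> R) :
  measurable_fun setT f -> measurable_fun setT g ->
  f = g %[ae mu] -> \int[mu]_x f x = \int[mu]_x g x.
Proof.
move=> mf mg fg; congr fine; apply: ae_eq_integral => //.
- exact/measurable_EFinP.
- exact/measurable_EFinP.
- by apply: filterS fg => x /= h _; rewrite h.
Qed.

Lemma ipDl u v w : ip (u + v) w = ip u w + ip v w.
Proof.
rewrite /ip -RintegralD//; [|exact: ip_intg..].
apply: ae_eq_Rint.
- by apply: measurable_funM; exact: measurable_L2fun.
- by apply: measurable_funD; apply: measurable_funM; exact: measurable_L2fun.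
- by apply: filterS (L2funD u v) => x /= h _; rewrite h// mulrDl.
Qed.

Lemma ipZl c u w : ip (c *: u) w = c * ip u w.
Proof.
rewrite /ip -RintegralZl//; [|exact: ip_intg..].
apply: ae_eq_Rint.
- by apply: measurable_funM; exact: measurable_L2fun.
- by apply: measurable_funM => //; apply: measurable_funM; exact: measurable_L2fun.
- by apply: filterS (L2funZ c u) => x /= h _; rewrite h// mulrA.
Qed.

Lemma ip_ge0 u : 0 <= ip u u.
Proof. by apply: Rintegral_ge0 => x _; rewrite -expr2 sqr_ge0. Qed.

Lemma ip_eq0 u : ip u u = 0 -> u = 0.
Proof.
move=> uu0.
have mf := measurable_L2fun u.
have : (\int[mu]_x `|(L2fun u x * L2fun u x)%:E| = 0)%E.
  transitivity (\int[mu]_x (L2fun u x * L2fun u x)%:E)%E.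
    by apply: eq_integral => x _; rewrite gee0_abs// lee_fin -expr2 sqr_ge0.
  rewrite -[LHS]fineK; last exact: integrable_fin_num (ip_intg u u).
  by congr (_%:E).
have mg : measurable_fun setT (fun x => (L2fun u x * L2fun u x)%:E).
  by apply/measurable_EFinP; apply: measurable_funM.
move=> /(ae_eq_integral_abs mu measurableT mg) uae0.
apply/eqP; rewrite -[u]reprK -[0]reprK; apply/L2_eqP.
have := repr_pi_ae 0.
have <- : 0 = \pi_H (0 : Lf).
  by have := piD 0 0; rewrite addr0 -[LHS]addr0 => /addrI.
apply: filterS2 uae0 => x /= /(_ I) h + _ => /(_ I) ->.
by case: h => /eqP; rewrite mulf_eq0 orbb => /eqP.
Qed.

End L2module.

Section sqrt_norm.
Context (R : realType) (V : lmodType R) (b : V -> V -> R).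
Hypothesis bC : forall x y, b x y = b y x.
Hypothesis bD : forall x y z, b (x + y) z = b x z + b y z.
Hypothesis bZ : forall c x z, b (c *: x) z = c * b x z.
Hypothesis b_ge0 : forall x, 0 <= b x x.
Hypothesis b_eq0 : forall x, b x x = 0 -> x = 0.

Lemma form_CS x y : b x y ^+ 2 <= b x x * b y y.
Proof.
have bDr u v w : b u (v + w) = b u v + b u w by rewrite bC bD !(bC _ u).
have bZr c u v : b u (c *: v) = c * b u v by rewrite bC bZ bC.
have [/b_eq0 -> | y0] := eqVneq (b y y) 0.
  by rewrite -(scale0r 0) !bZr !mul0r mulr0 expr0n.
have {}y0 : 0 < b y y by rewrite lt_def y0 b_ge0.
have := b_ge0 (b y y *: x + (- b x y) *: y).
rewrite !(bD, bDr, bZ, bZr) (bC y x) => h.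
rewrite -subr_ge0 -(pmulr_rge0 _ y0).
by apply: le_trans h _; rewrite le_eqVlt; apply/orP; left; apply/eqP; ring.
Qed.

Lemma form_normD x y :
  Num.sqrt (b (x + y) (x + y)) <= Num.sqrt (b x x) + Num.sqrt (b y y).
Proof.
have bDr u v w : b u (v + w) = b u v + b u w by rewrite bC bD !(bC _ u).
rewrite -(ler_pXn2r (n := 2)) ?nnegrE ?addr_ge0 ?sqrtr_ge0//.
rewrite sqr_sqrtr// sqrrD !sqr_sqrtr// !(bD, bDr) (bC y x).
have : b x y <= Num.sqrt (b x x) * Num.sqrt (b y y).
  rewrite -sqrtrM//; apply: le_trans (ler_norm _) _.
  by rewrite -sqrtr_sqr ler_wsqrtr// form_CS.
by rewrite mulr2n; lra.
Qed.

Lemma form_normZ c x : Num.sqrt (b (c *: x) (c *: x)) = `|c| * Num.sqrt (b x x).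
Proof. by rewrite bZ bC bZ mulrA -expr2 sqrtrM ?sqr_ge0// sqrtr_sqr. Qed.

Lemma form_norm_eq0 x : Num.sqrt (b x x) = 0 -> x = 0.
Proof.
move=> /eqP; rewrite sqrtr_eq0 => h; apply: b_eq0; apply/eqP.
by rewrite eq_le h b_ge0.
Qed.

End sqrt_norm.

Section L2normed.
Context d (T : measurableType d) (R : realType).
Variable mu : {measure set T -> \bar R}.

Definition L2norm (u : L2 mu) : R := Num.sqrt (ip u u).

HB.instance Definition _ := Lmodule_isNormed.Build R (L2 mu)
  (form_normD (@ipC _ _ _ mu) (@ipDl _ _ _ mu) (@ipZl _ _ _ mu)
     (@ip_ge0 _ _ _ mu) (@ip_eq0 _ _ _ mu))
  (form_normZ (@ipC _ _ _ mu) (@ipZl _ _ _ mu))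
  (form_norm_eq0 (@ip_ge0 _ _ _ mu) (@ip_eq0 _ _ _ mu)).

End L2normed.

(** * The complexification of [L2 mu]: the pair [(u, v)] stands for [u + iv] *)

Section L2C.
Context d (T : measurableType d) (R : realType).
Variable mu : {measure set T -> \bar R}.

Definition L2C : Type := (L2 mu * L2 mu)%type.
HB.instance Definition _ := GRing.Zmodule.on L2C.
Implicit Types x y : L2C.

Definition L2Cscale (z : R[i]) x : L2C :=
  let: a +i* b := z in (a *: x.1 - b *: x.2, a *: x.2 + b *: x.1).

Lemma L2CscaleA z w x : L2Cscale z (L2Cscale w x) = L2Cscale (z * w) x.
Proof.
case: z w x => [a b] [a' b'] [u v]; rewrite /L2Cscale /=; congr pair.
  rewrite scalerBr scalerDr !scalerA scalerBl scalerDl !opprD.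
  by rewrite [X in _ + X]addrC addrACA.
rewrite scalerBr scalerDr !scalerA scalerBl scalerDl.
by rewrite [X in _ + X]addrC addrACA.
Qed.

Lemma L2Cscale1 : left_id 1 L2Cscale.
Proof.
by case=> u v; rewrite /L2Cscale /= !scale1r !scale0r subr0 addr0.
Qed.

Lemma L2CscaleDr : right_distributive L2Cscale +%R.
Proof.
move=> [a b] [u v] [u' v']; rewrite /L2Cscale /=; congr pair => /=.
  by rewrite !scalerDr opprD addrACA.
by rewrite !scalerDr addrACA.
Qed.

Lemma L2CscaleDl x : {morph L2Cscale^~ x : z w / z + w}.
Proof.
case: x => u v [a b] [a' b']; rewrite /L2Cscale /=; congr pair => /=.
  by rewrite !scalerDl opprD addrACA.
by rewrite !scalerDl addrACA.
Qed.

HB.instance Definition _ := GRing.Zmodule_isLmodule.Build R[i] L2C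
  L2CscaleA L2Cscale1 L2CscaleDr L2CscaleDl.

Definition L2C_rip (x y : L2 mu * L2 mu) : R := ip x.1 y.1 + ip x.2 y.2.

Let ripC x y : L2C_rip x y = L2C_rip y x.
Proof. by rewrite /L2C_rip !(ipC x.1, ipC x.2). Qed.

Let ripD x y z : L2C_rip (x + y) z = L2C_rip x z + L2C_rip y z.
Proof. by rewrite /L2C_rip /= !ipDl addrACA. Qed.

Let ripZ (c : R) x z : L2C_rip (c *: x) z = c * L2C_rip x z.
Proof. by rewrite /L2C_rip /= !ipZl mulrDr. Qed.

Let rip_ge0 x : 0 <= L2C_rip x x.
Proof. by rewrite addr_ge0 ?ip_ge0. Qed.

Let rip_eq0 x : L2C_rip x x = 0 -> x = 0.
Proof.
case: x => u v; rewrite /L2C_rip /= => /eqP.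
by rewrite paddr_eq0 ?ip_ge0// => /andP[/eqP/ip_eq0 -> /eqP/ip_eq0 ->].
Qed.

Definition L2Cnorm x : R[i] := (Num.sqrt (ip x.1 x.1 + ip x.2 x.2))%:C.

Lemma L2C_normD x y : L2Cnorm (x + y) <= L2Cnorm x + L2Cnorm y.
Proof.
rewrite /L2Cnorm -rmorphD/= lecR.
exact: (form_normD ripC ripD ripZ rip_ge0 rip_eq0).
Qed.

Lemma L2C_normZ (z : R[i]) x : L2Cnorm (z *: x) = `|z| * L2Cnorm x.
Proof.
case: z x => a b [u v]; rewrite normc_def /L2Cnorm -rmorphM/= -sqrtrM.
  congr (Num.sqrt _)%:C.
  have ipDr (f g h : L2 mu) : ip f (g + h) = ip f g + ip f h.
    by rewrite ipC ipDl !(ipC _ f).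
  have ipZr c (f g : L2 mu) : ip f (c *: g) = c * ip f g.
    by rewrite ipC ipZl ipC.
  rewrite -scaleNr !(ipDl, ipDr, ipZl, ipZr) (ipC v u); ring.
by rewrite addr_ge0 ?sqr_ge0.
Qed.

Lemma L2C_norm_eq0 x : L2Cnorm x = 0 -> x = 0.
Proof. by move=> /complexI/(form_norm_eq0 rip_ge0 rip_eq0). Qed.

HB.instance Definition _ := Lmodule_isNormed.Build R[i] L2C
  L2C_normD L2C_normZ L2C_norm_eq0.

End L2C.

(** * Unbounded operators, represented by their graphs *)

Definition domain (X : Type) (A : set (X * X)) : set X :=
  [set x | exists y, A (x, y)].

Definition linear_operator (K : pzRingType) (X : lmodType K)
    (A : set (X * X)) :=
  [/\ forall x y z, A (x, y) -> A (x, z) -> y = z,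
      A (0, 0) &
      forall (c : K) x y x' y', A (x, y) -> A (x', y') ->
        A (c *: x + x', c *: y + y')].

Definition opp_operator (X : zmodType) (A : set (X * X)) : set (X * X) :=
  [set p | A (p.1, - p.2)].

Section L2operators.
Context d (T : measurableType d) (R : realType).
Variable mu : {measure set T -> \bar R}.
Implicit Types A : set (L2 mu * L2 mu).

Definition adjoint A : set (L2 mu * L2 mu) :=
  [set p | forall q, A q -> ip q.2 p.1 = ip q.1 p.2].

Definition selfadjoint A := dense (domain A) /\ A = adjoint A.

Definition nonnegative_operator A := forall p, A p -> 0 <= ip p.2 p.1.

Definition complexify A : set (L2C mu * L2C mu) :=
  [set p | A (p.1.1, p.2.1) /\ A (p.1.2, p.2.2)].

End L2operators.

(** * Analytic semigroups *)

Section semigroups.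
Context (R : realType) (X : normedModType R[i]).
Implicit Types (T : R[i] -> {linear X -> X}) (S : set R[i]).

Definition sector (delta : R) : set R[i] :=
  [set z | exists r theta : R, [/\ 0 < r, `|theta| < delta &
     z = (r * cos theta) +i* (r * sin theta)]].

(* Complex differentiability for the operator norm, with derivative [D]. *)
Definition operator_analytic S T := forall z, S z ->
  exists2 D : {linear X -> X}, continuous D &
    forall e : R, 0 < e -> \forall h \near (0 : R[i]^o)^', forall x : X,
      `|h^-1 *: (T (z + h) x - T z x) - D x| <= e%:C * `|x|.

Definition analytic_semigroup (delta : R) T :=
  [/\ forall z, sector delta z -> continuous (T z),
      forall x, T 0 x = x,
      forall z w, sector delta z -> sector delta w ->
        forall x, T (z + w) x = T z (T w x),
      operator_analytic (sector delta) T &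
      forall delta', 0 < delta' < delta -> forall x,
        T z x @[z --> within (sector delta') (nbhs (0 : R[i]^o))] --> x].

Definition contractive_on S T := forall z, S z -> forall x, `|T z x| <= `|x|.

Definition generator T : set (X * X) :=
  [set p | (t%:C)^-1 *: (T t%:C p.1 - p.1) @[t --> (0 : R)^'+] --> p.2].

(* The values of [T] outside the sector and 0 are irrelevant. *)
Definition generates_contractive_analytic_semigroup (delta : R)
    (B : set (X * X)) :=
  exists T, [/\ analytic_semigroup delta T, contractive_on (sector delta) T &
               B = generator T].

End semigroups.

(** * The degenerate fourth order operator *)

Section operator.
Context {R : realType}.
Notation leb := (@lebesgue_measure R).
Notation I := (`]0, 1[%classic : set R).
Notation I01 := (`[0, 1]%classic : set R).
Implicit Types (a u f g phi W : R -> R) (x p : R).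

(* [f'] is the derivative of [f] on [D], one-sided at the endpoints of [D]. *)
Definition C1_on (D : set R) f f' :=
  {within D, continuous f'} /\
  forall x, D x -> (f y - f x) / (y - x) @[y --> within D x^'] --> f' x.

Definition weakly_degenerate a (x0 : R) :=
  [/\ a x0 = 0,
      forall x, I01 x -> x != x0 -> 0 < a x,
      {within I01, continuous a},
      exists a', C1_on (I01 `\ x0) a a' &
      leb.-integrable I (fun x => (a x)^-1%:E)].

Definition in_L2 f :=
  measurable_fun I f /\ (\int[leb]_(x in I) (f x ^+ 2)%:E < +oo)%E.

(* The space C^1_c(0, 1), each function being extended by 0. *)
Definition test_function phi :=
  [/\ forall x, derivable phi x 1, continuous (derive1 phi) &
      exists c d : R, [/\ 0 < c, d < 1 & forall x, phi x != 0 -> c <= x <= d]].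

Definition weak_derivative u g :=
  [/\ leb.-integrable I (EFin \o u), leb.-integrable I (EFin \o g) &
      forall phi, test_function phi ->
        \int[leb]_(x in I) (u x * derive1 phi x) =
        - \int[leb]_(x in I) (g x * phi x)].

Definition weak_derivative2 u g :=
  exists2 u1, weak_derivative u u1 & weak_derivative u1 g.

Definition H1 u := in_L2 u /\ exists2 g, in_L2 g & weak_derivative u g.

Definition H2 u := H1 u /\ exists2 g, H1 g & weak_derivative u g.

Definition absolutely_continuous f := forall e : R, 0 < e ->
  exists2 d : R, 0 < d & forall (n : nat) (s t : 'I_n -> R),
    (forall i, [/\ 0 <= s i, s i <= t i & t i <= 1]) ->
    (forall i j, i != j -> t i <= s j \/ t j <= s i) ->
    \sum_(i < n) (t i - s i) < d ->
    \sum_(i < n) `|f (t i) - f (s i)| < e.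

Definition H2a a u :=
  [/\ H1 u,
      exists2 u1, weak_derivative u u1 & absolutely_continuous u1 &
      exists2 u2, weak_derivative2 u u2 & in_L2 (fun x => Num.sqrt (a x) * u2 x)].

Definition Z a u :=
  H2a a u /\ exists2 u2, weak_derivative2 u u2 & H2 (a \* u2).

(* u''(p) = u'''(p) = 0, for the C^1 representative of u'' away from [x0]. *)
Definition natural_bc (x0 : R) u p :=
  exists u2 u3, [/\ weak_derivative2 u u2, C1_on (I01 `\ x0) u2 u3,
                   u2 p = 0 & u3 p = 0].

(* (a u'')(p) = (a u'')'(p) = 0, for the continuous representatives. *)
Definition degenerate_bc a u p :=
  exists W W1,
    [/\ exists2 u2, weak_derivative2 u u2 & a \* u2 = W %[ae leb in I],
        weak_derivative W W1,
        {within I01, continuous W} /\ {within I01, continuous W1},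
        W p = 0 & W1 p = 0].

Definition D_A1 a (x0 : R) u := Z a u /\
  if x0 == 0 then natural_bc x0 u 1 /\ degenerate_bc a u 0
  else if x0 == 1 then natural_bc x0 u 0 /\ degenerate_bc a u 1
  else natural_bc x0 u 0 /\ natural_bc x0 u 1.

Definition leb01 : {measure set (measurableTypeR R) -> \bar R} :=
  mrestr leb (measurable_itv `]0, 1[).

Definition L2_01 := L2 leb01.

Definition fun01 (u : L2_01) : R -> R := L2fun (mu := leb01) u.

(* The graph of A_1 u := (a u'')''. *)
Definition A1 a (x0 : R) : set (L2_01 * L2_01) :=
  [set p : L2_01 * L2_01 | D_A1 a x0 (fun01 p.1) /\
     exists2 u2, weak_derivative2 (fun01 p.1) u2 &
       weak_derivative2 (a \* u2) (fun01 p.2)].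

End operator.

(* Main.v *)
(** Integrating twice from 0, where the boundary conditions make [W = a u''] and
    [W'] vanish, [A_1 u = y] means that [y] is orthogonal to the affine functions
    (this expresses that [W] and [W'] vanish at 1 too) and that
    [u'' = a^-1 * iint y], i.e. [u = iint (a^-1 * iint y)] up to an affine
    function.  With [P] the orthogonal projection on the affine functions and
    [K] the map [y |-> iint (a^-1 * iint y)] sandwiched between two copies of
    [1 - P], the graph of [A_1] is [{(u, y) | u - P u = K y, P y = 0}], where [K] is symmetric,
    nonnegative and bounded because [a^-1] is integrable, and [ker K] is the
    range of [P].  Self-adjointness and nonnegativity are then algebra, and
    density holds because [(1 - K / c)^n y] tends to 0 when [P y = 0].
    The semigroup is [P + exp (- z / K) (1 - P)], defined through the continuous
    functional calculus of [G = K / c], [0 <= G <= 1]: Bernstein polynomials give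
    the positivity of the polynomial calculus, hence its sup-norm bound, hence
    its extension to [C[0, 1]]; and [s |-> exp (- z / (c s))], extended by 0, is
    continuous on [0, 1] when [Re z > 0], with the first order Taylor estimate
    in [z] that yields analyticity. *)

From HB Require Import structures.
Require Import Defs.
From mathcomp Require Import all_boot all_order all_algebra.
From mathcomp Require Import all_classical all_reals all_analysis.
From mathcomp Require Import measurable_realfun complex ring lra.

Set Implicit Arguments.
Unset Strict Implicit.
Unset Printing Implicit Defensive.

Import Order.TTheory GRing.Theory Num.Theory.
Import numFieldNormedType.Exports.

Local Open Scope classical_set_scope.
Local Open Scope ring_scope.

(** * Bernstein polynomials *)

Section bernstein.
Context {R : realType}.
Implicit Types (f g : R -> R) (p q : {poly R}) (n : nat) (s t x e c d M C : R).

(** Since [a^-1] is only integrable, [u'' = a^-1 * W] is controlled in L1 and not in L2. All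
    computations on the interval therefore go through one primitive operator [V] on L1: a weak
    derivative is a primitive up to a constant almost everywhere, and integration by parts is Fubini
    on a triangle. The position of [x0] matters only at the boundary: away from [x0], the vanishing
    of u'' and u''' forces [W] and [W'] to vanish, which is the degenerate condition itself, so the
    three cases give the same four equations. The operator is unbounded with the affine functions as
    kernel; its bounded pseudo-inverse lets a calculus on a compact interval replace a spectral
    theorem. There the point 0 stands both for infinite frequency, where the exponential is flat,
    and for the affine functions, where the semigroup must be the identity; [P] separates the two.
    As the Hilbert space is real, exp(- z w) is split into two real functions that differ by a phase
    pi / 2 and act on pairs. *)

Definition bernstein n f : {poly R} :=
  \sum_(k < n.+1) (f (k%:R / n%:R) * ('C(n, k))%:R) *:
    ('X^k * (1 - 'X) ^+ (n - k)).

Lemma bernsteinD n f g :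
  bernstein n (fun s => f s + g s) = bernstein n f + bernstein n g.
Proof.
by rewrite -big_split; apply: eq_bigr => k _; rewrite mulrDl scalerDl.
Qed.

Lemma bernsteinZ n c f : bernstein n (fun s => c * f s) = c *: bernstein n f.
Proof. by rewrite scaler_sumr; apply: eq_bigr => k _; rewrite scalerA mulrA. Qed.

Lemma bernstein_cst n c : bernstein n (fun=> c) = c%:P.
Proof.
transitivity (c%:P * ((1 - 'X) + 'X) ^+ n).
  rewrite exprDn mulr_sumr; apply: eq_bigr => k _.
  by rewrite -scalerA scaler_nat mulrC mul_polyC mulrC.
by rewrite subrK expr1n mulr1.
Qed.

(** The logarithmic derivative is k / X - (n - k) / (1 - X); the factor X (1 - X) clears the
    denominators. *)
Lemma deriv_bernstein_basis n k : (k <= n)%N ->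
  'X * (1 - 'X) * ('X^k * (1 - 'X) ^+ (n - k))^`() =
  (k%:R%:P - n%:R%:P * 'X) * ('X^k * (1 - 'X) ^+ (n - k)) :> {poly R}.
Proof.
move=> kn; have e m : m%:R%:P = m%:R :> {poly R} by rewrite rmorph_nat.
have -> : n%:R%:P = k%:R + (n - k)%:R :> {poly R} by rewrite e -natrD subnKC.
rewrite e; move: (n - k)%N => m.
have dX : 'X * ('X^k)^`() = k%:R * 'X^k :> {poly R}.
  rewrite derivXn; case: k {kn} => [|k]; first by rewrite mulr0n mulr0 mul0r.
  by rewrite /= mulrnAr -exprS mulr_natl.
have d1X : (1 - 'X) * ((1 - 'X) ^+ m)^`() = - (m%:R * (1 - 'X) ^+ m) :> {poly R}.
  rewrite deriv_exp derivB derivX -polyC1 derivC sub0r polyC1.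
  case: m => [|m]; first by rewrite mulr0n mulr0 mul0r oppr0.
  by rewrite mulN1r mulrnAr mulrN mulNrn -exprS mulr_natl.
rewrite derivM.
transitivity ((1 - 'X) * ((1 - 'X) ^+ m) * ('X * ('X^k)^`()) + 'X * 'X^k * ((1 - 'X) * ((1 - 'X) ^+ m)^`()) : {poly R}).
  ring.
by rewrite dX d1X; ring.
Qed.

(** Sampling [s * f s] multiplies the k-th term by k / n, and [deriv_bernstein_basis] expresses that
    factor by a derivative. Iterating gives every moment without binomial sums. *)
Lemma bernstein_mulX n f : (0 < n)%N ->
  bernstein n (fun s => s * f s) = 'X * bernstein n f +
    n%:R^-1 *: ('X * (1 - 'X) * (bernstein n f)^`()).
Proof.
move=> n0; have n0' : n%:R != 0 :> R by rewrite pnatr_eq0 -lt0n.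
rewrite /bernstein raddf_sum !mulr_sumr scaler_sumr -big_split /=.
apply: eq_bigr => k _; rewrite derivZ -!scalerAr deriv_bernstein_basis; last first.
  by rewrite -ltnS.
set B := _ * _ ^+ _; set c := f _ * _.
rewrite (_ : _ * f _ * _ = k%:R / n%:R * c); last by rewrite mulrA.
rewrite -!mul_polyC !polyCM.
have : (n%:R^-1)%:P * n%:R%:P = 1 :> {poly R} by rewrite -polyCM mulVf.
move: (n%:R%:P) (n%:R^-1)%:P (k%:R%:P) (c%:P) => N M K C nn.
ring: nn.
Qed.

Lemma bernstein_node n k : (k <= n)%N -> 0 <= (k%:R / n%:R : R) <= 1.
Proof.
(* For [n = 0] the only node is 0 / 0, which is 0. *)
case: n => [|n] kn; first by rewrite invr0 mulr0 lexx ler01.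
by rewrite divr_ge0//= ler_pdivrMr ?ltr0n// mul1r ler_nat.
Qed.

Lemma horner_bernstein_ge0 n f : (forall s : R, 0 <= s <= 1 -> 0 <= f s) ->
  forall s : R, 0 <= s <= 1 -> 0 <= (bernstein n f).[s].
Proof.
move=> f0 s /andP[s0 s1]; rewrite horner_sum sumr_ge0// => k _.
rewrite !hornerE !mulr_ge0 ?exprn_ge0 ?subr_ge0//.
by apply/f0/bernstein_node; rewrite -ltnS.
Qed.

(** The image of X^j is a polynomial in 1 / n with coefficients independent of [n]. A linear form on
    polynomials therefore passes to the limit although no continuity is assumed of it. *)
Lemma bernstein_expansion (j : nat) : exists (N : nat) (Q : nat -> {poly R}),
  [/\ Q 0%N = 'X^j, forall i, (N < i)%N -> Q i = 0 &
   forall n, (0 < n)%N -> bernstein n (fun x => x ^+ j) =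
     \sum_(i < N.+1) n%:R^-1 ^+ i *: Q i].
Proof.
elim: j => [|j [N [Q [Q0 QN IH]]]].
  exists 0%N, (fun i => if i is 0%N then 1 else 0); split => [//|[]//|n n0].
  rewrite big_ord1 expr0 scale1r.
  by rewrite (_ : (fun _ => _) = fun=> 1) ?bernstein_cst//.
pose D p : {poly R} := 'X * (1 - 'X) * p^`().
exists N.+1, (fun i => 'X * Q i + if i is i'.+1 then D (Q i') else 0).
split => [|i|n n0].
- by rewrite Q0 -exprS addr0.
- case: i => // i Ni; rewrite !QN ?mulr0 ?add0r ?/D ?deriv0 ?mulr0//.
  exact: ltnW.
rewrite (_ : (fun _ => _) = fun x => x * x ^+ j); last first.
  by apply/funext => x; rewrite exprS.
rewrite bernstein_mulX// IH//.
under [RHS]eq_bigr do rewrite scalerDr.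
rewrite [RHS]big_split /=; congr (_ + _).
  rewrite [RHS]big_ord_recr /= QN// mulr0 scaler0 addr0 mulr_sumr.
  by apply: eq_bigr => i _; rewrite -scalerAr.
rewrite [RHS]big_ord_recl scaler0 add0r raddf_sum mulr_sumr scaler_sumr.
by apply: eq_bigr => i _; rewrite /= derivZ -scalerAr scalerA exprS.
Qed.

(* Bernstein: a polynomial nonnegative on [0, 1] is a limit of nonnegative
   combinations of the [X^k (1 - X)^m]. *)
Lemma bernstein_positivity (l : {poly R} -> R) :
  (forall p q, l (p + q) = l p + l q) -> (forall c p, l (c *: p) = c * l p) ->
  (forall k m, 0 <= l ('X^k * (1 - 'X) ^+ m)) ->
  forall p, (forall s : R, 0 <= s <= 1 -> 0 <= p.[s]) -> 0 <= l p.
Proof.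
move=> lD lZ l_ge0 p p0.
have l0 : l 0 = 0 by rewrite -(scale0r 0) lZ mul0r.
have lsum := big_morph l lD l0.
have cvgX j : l (bernstein n.+1 (fun x => x ^+ j)) @[n --> \oo] --> l 'X^j.
  have [N [Q [<- _ QE]]] := bernstein_expansion j.
  (* Applied to the expansion, the form is an ordinary real polynomial evaluated at 1 / n.+1. *)
  pose P : {poly R} := \poly_(i < N.+1) l (Q i).
  have -> : l (Q 0%N) = P.[0] by rewrite horner_coef0 coef_poly.
  rewrite [X in X @ _ --> _](_ : _ = (fun n => P.[n.+1%:R^-1])); last first.
    apply/funext => n; rewrite QE// lsum horner_poly.
    by apply: eq_bigr => i _; rewrite lZ mulrC.
  by apply: (cvg_comp harmonic (horner P) cvg_harmonic); exact: continuous_horner.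
have cvgp : l (bernstein n.+1 (horner p)) @[n --> \oo] --> l p.
  rewrite [X in l X](_ : p = \sum_(i < size p) p`_i *: 'X^i); last first.
    by rewrite -poly_def coefK.
  rewrite lsum.
  rewrite [X in X @ _ --> _](_ : _ = (fun n => \sum_(i < size p)
     p`_i * l (bernstein n.+1 (fun x => x ^+ i)))); last first.
    apply/funext => n; rewrite (_ : horner p = fun x => \sum_(i < size p) p`_i * x ^+ i).
      elim: (size p) => [|m IH].
        rewrite big_ord0 (_ : (fun _ => _) = fun=> 0).
          by rewrite bernstein_cst l0.
        by apply/funext => x; rewrite big_ord0.
      rewrite big_ord_recr /= -IH -lZ -bernsteinZ -lD -bernsteinD.
      by congr (l (bernstein _ _)); apply/funext => x; rewrite big_ord_recr.
    by apply/funext => x; rewrite horner_coef.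
  elim: (size p) => [|m IH].
    by under eq_fun do rewrite big_ord0; rewrite big_ord0; exact: cvg_cst.
  under eq_fun do rewrite big_ord_recr; rewrite big_ord_recr /=.
  by apply: cvgD => //; rewrite lZ; apply: cvgMr; exact: cvgX.
apply: (cvgr_to_ge cvgp); apply: nearW => n.
rewrite lsum sumr_ge0// => k _; rewrite lZ !mulr_ge0//.
by apply/p0/bernstein_node; rewrite -ltnS.
Qed.

(** * Variance of Bernstein polynomials and the Weierstrass theorem *)

Lemma bernstein_variance n x : (0 < n)%N ->
  (bernstein n (fun s => (s - x) ^+ 2)).[x] = x * (1 - x) / n%:R.
Proof.
move=> n0; have n0' : n%:R != 0 :> R by rewrite pnatr_eq0 -lt0n.
(* Written as iterated products by [s], so that [bernstein_mulX] computes the moments of orders 1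
   and 2. *)
rewrite (_ : (fun _ => _) = fun s => (s * (s * 1) + (- 2 * x) * (s * 1)) + x ^+ 2).
  rewrite bernsteinD bernstein_cst bernsteinD bernsteinZ !bernstein_mulX//.
  rewrite bernstein_cst !poly.derivE !hornerE /=; by field.
by apply/funext => s; ring.
Qed.

(** Uniform continuity in the form that the variance can absorb: nearby points are covered by [e],
    and at distance at least [d] the quadratic term dominates the oscillation 2 M. *)
Lemma continuous_quadratic_modulus f : {within `[0, 1], continuous f} ->
  forall e, 0 < e -> exists2 C, 0 < C & forall s t, 0 <= s <= 1 -> 0 <= t <= 1 ->
    `|f s - f t| <= e + C * (s - t) ^+ 2.
Proof.
move=> cf e e0.
have cp := @segment_compact R 0 1.
have bnd : exists2 M, 0 <= M & forall s, 0 <= s <= 1 -> `|f s| <= M.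
  have /compact_bounded [M [_ MM]] := continuous_compact cf cp.
  exists (`|M| + 1) => [|s s01]; first by rewrite addr_ge0.
  apply: (MM (`|M| + 1)); first by rewrite (le_lt_trans (ler_norm _))// ltrDl.
  by exists s => //=; rewrite in_itv.
have [M M0 fM] := bnd.
have unif : \forall d \near (0 : R)^'+, forall t, `[0, 1]%classic t ->
    forall s, 0 <= s <= 1 -> 0 <= t <= 1 -> `|s - t| < d -> `|f s - f t| <= e.
  apply: (iffLR (compact_near_coveringP _) cp) => x x01.
  have e2 : 0 < e / 2 by rewrite divr_gt0.
  have /subspace_continuousP/(_ x x01)/cvgrPdist_lt/(_ _ e2) := cf.
  rewrite near_withinE => -[/= r r0 fr].
  exists (ball x (r / 2), [set d | d < r / 2]) => /=.
    split; first by apply: nbhsx_ballx; rewrite divr_gt0.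
    by apply: nbhs_right_lt; rewrite divr_gt0.
  move=> [t d] /= [xt dr] s s01 t01 st.
  have ft := fr t; have fs := fr s.
  rewrite (_ : f s - f t = (f x - f t) - (f x - f s)); last by ring.
  rewrite (le_trans (ler_normB _ _))// (splitr e) lerD// ltW//.
    apply: ft; last by rewrite /= in_itv.
    by apply: lt_le_trans xt _; lra.
  apply: fs; last by rewrite /= in_itv.
  rewrite /= (_ : x - s = (x - t) - (s - t)); last by ring.
  by rewrite (le_lt_trans (ler_normB _ _))// (splitr r) ltrD// (lt_trans st).
near (0 : R)^'+ => d.
have d0 : 0 < d by near: d; exact: nbhs_right_gt.
have du s t : 0 <= s <= 1 -> 0 <= t <= 1 -> `|s - t| < d -> `|f s - f t| <= e.
  move=> s01 t01; have t01' : `[0, 1]%classic t by rewrite /= in_itv.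
  move: t t01' s s01 t01; near: d; exact: unif.
exists (2 * M / d ^+ 2 + 1) => [|s t s01 t01].
  by rewrite ltr_pwDr// divr_ge0 ?mulr_ge0// exprn_ge0 ?ltW.
have [std|dst] := ltP `|s - t| d.
  apply: (@le_trans _ _ e); last by rewrite lerDl mulr_ge0 ?sqr_ge0// addr_ge0// divr_ge0 ?mulr_ge0// exprn_ge0 ?ltW.
  exact: du.
have := fM _ s01; have := fM _ t01; have := ler_normB (f s) (f t).
have : d ^+ 2 <= (s - t) ^+ 2 by rewrite -[leRHS]real_normK ?num_real// ler_pXn2r ?nnegrE// ltW.
have d2 : 0 < d ^+ 2 by rewrite exprn_gt0.
move=> h; have : 2 * M <= 2 * M / d ^+ 2 * (s - t) ^+ 2.
  by rewrite mulrAC ler_pdivlMr// ler_wpM2l// mulr_ge0.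
have := sqr_ge0 (s - t); rewrite mulrDl mul1r; lra.
Unshelve. all: by end_near. Qed.

Lemma weierstrass f : {within `[0, 1], continuous f} -> forall e, 0 < e ->
  exists p, forall s, 0 <= s <= 1 -> `|f s - p.[s]| <= e.
Proof.
move=> cf e e0.
have [C C0 fC] := continuous_quadratic_modulus cf (divr_gt0 e0 (ltr0Sn R 1)).
(* Chosen so that [C / n], which bounds the variance term, is at most [e / 2]. *)
pose n := (Num.truncn (2 * C / e)).+1.
have n0 : (0 < n)%N by [].
have Cn : C / n%:R <= e / 2.
  rewrite ler_pdivrMr ?ltr0n// mulrC -ler_pdivrMr ?divr_gt0// invf_div mulrA.
  by rewrite (mulrC C) ltW// /n truncnS_gt.
exists (bernstein n f) => s s01.
have var : (bernstein n (fun t => (t - s) ^+ 2)).[s] <= n%:R^-1.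
  rewrite bernstein_variance// ler_piMl ?invr_ge0//.
  by move: s01 => /andP[s0 s1]; nra.
(* One-sided estimate, from positivity of the Bernstein operator on [h]; it is used for [f] and for
   [- f]. *)
have key (g : R -> R) : (forall t, 0 <= t <= 1 -> g t - g s <= e / 2 + C * (t - s) ^+ 2) ->
    (bernstein n g).[s] - g s <= e.
  move=> gC; pose h t := (e / 2 + g s + C * (t - s) ^+ 2) + (- 1) * g t.
  have h0 t : 0 <= t <= 1 -> 0 <= h t by move=> /gC; rewrite /h; lra.
  have := horner_bernstein_ge0 n h0 s01.
  rewrite /h bernsteinD bernsteinZ bernsteinD bernstein_cst bernsteinZ !hornerE.
  have := ler_wpM2l (ltW C0) var; lra.
rewrite ler_norml; apply/andP; split.
  have := key f _; rewrite -lerNl opprB; apply => t t01.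
  by have /ler_normlP[] := fC _ _ t01 s01; lra.
have := key (fun t => - 1 * f t) _; rewrite bernsteinZ !hornerE.
rewrite (_ : -1 * _ - _ = f s - (bernstein n f).[s]); last by ring.
by apply => t t01; have /ler_normlP[] := fC _ _ t01 s01; lra.
Qed.

End bernstein.

(** * Continuous functional calculus of a symmetric operator between 0 and 1 *)

Section functional_calculus.
Context {R : realType} {H : normedModType R} (b : H -> H -> R) (G : {linear H -> H}).
Implicit Types (x y z : H) (p q : {poly R}) (f g : R -> R) (e c M s : R).

Hypothesis bC : forall x y, b x y = b y x.
Hypothesis bD : forall x y z, b (x + y) z = b x z + b y z.
Hypothesis bZ : forall c x z, b (c *: x) z = c * b x z.
Hypothesis b_norm : forall x, b x x = `|x| ^+ 2.

Hypothesis G_sym : forall x y, b (G x) y = b x (G y).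
Hypothesis G_ge0 : forall x, 0 <= b (G x) x.
Hypothesis G_le1 : forall x, b (G x) x <= b x x.

Lemma form_le_norm x y : `|b x y| <= `|x| * `|y|.
Proof.
have b0 u : 0 <= b u u by rewrite b_norm sqr_ge0.
have b00 u : b u u = 0 -> u = 0.
  by rewrite b_norm => /eqP; rewrite sqrf_eq0 normr_eq0 => /eqP.
rewrite -(ler_pXn2r (n := 2)) ?nnegrE ?mulr_ge0//.
rewrite real_normK ?num_real// exprMn -!b_norm.
exact: (form_CS bC bD bZ b0 b00).
Qed.

Definition pcalc p x := \sum_(i < size p) p`_i *: iter i G x.

Lemma pcalc_widen n p x : (size p <= n)%N ->
  pcalc p x = \sum_(i < n) p`_i *: iter i G x.
Proof.
move=> pn; rewrite /pcalc (big_ord_widen _ (fun i => p`_i *: iter i G x) pn).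
rewrite big_mkcond; apply: eq_bigr => i _; case: ltnP => // pi.
by rewrite nth_default// scale0r.
Qed.

Lemma pcalcD p q x : pcalc (p + q) x = pcalc p x + pcalc q x.
Proof.
pose n := maxn (size p) (size q).
rewrite !(@pcalc_widen n) ?leq_maxl ?leq_maxr ?size_polyD// -big_split.
by apply: eq_bigr => i _; rewrite coefD scalerDl.
Qed.

Lemma pcalcZ c p x : pcalc (c *: p) x = c *: pcalc p x.
Proof.
rewrite !(@pcalc_widen (size p)) ?size_scale_leq// scaler_sumr.
by apply: eq_bigr => i _; rewrite coefZ scalerA.
Qed.

Lemma pcalcC c x : pcalc c%:P x = c *: x.
Proof. by rewrite (@pcalc_widen 1) ?size_polyC ?leq_b1// big_ord1 coefC. Qed.

Lemma pcalc1 x : pcalc 1 x = x.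
Proof. by rewrite -polyC1 pcalcC scale1r. Qed.

Lemma pcalcB p q x : pcalc (p - q) x = pcalc p x - pcalc q x.
Proof. by rewrite pcalcD -(scaleN1r q) pcalcZ scaleN1r. Qed.

Lemma pcalcXr p x : pcalc (p * 'X) x = pcalc p (G x).
Proof.
rewrite (@pcalc_widen (size p).+1); last first.
  by have [->|p0] := eqVneq p 0; [rewrite mul0r size_poly0|rewrite size_mulX].
rewrite big_ord_recl coefMX scale0r add0r.
by apply: eq_bigr => i _; rewrite coefMX iterSr.
Qed.

Lemma pcalcG p x : pcalc p (G x) = G (pcalc p x).
Proof.
by rewrite /pcalc raddf_sum; apply: eq_bigr => i _; rewrite /= linearZ -iterSr.
Qed.

Lemma pcalcX x : pcalc 'X x = G x.
Proof. by rewrite -['X]mul1r pcalcXr pcalc1. Qed.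

Lemma pcalc_lin p c x y : pcalc p (c *: x + y) = c *: pcalc p x + pcalc p y.
Proof.
rewrite scaler_sumr -big_split; apply: eq_bigr => i _ /=.
have -> : iter i G (c *: x + y) = c *: iter i G x + iter i G y.
  by elim: (nat_of_ord i) => //= k ->; rewrite linearP.
by rewrite scalerDr !scalerA mulrC.
Qed.

Lemma pcalcM p q x : pcalc (p * q) x = pcalc p (pcalc q x).
Proof.
elim/poly_ind: p q x => [|p c IH] q x.
  by rewrite mul0r -polyC0 !pcalcC !scale0r.
rewrite mulrDl -mulrA !pcalcD IH (mulrC 'X q) mul_polyC pcalcZ.
by rewrite !pcalcXr !pcalcG pcalcC.
Qed.

Lemma form_sumr n (F : 'I_n -> H) x : b x (\sum_i F i) = \sum_i b x (F i).
Proof.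
rewrite (big_morph (b x) (id1 := 0) (op1 := +%R))// => [u v|].
  by rewrite bC bD !(bC x).
by rewrite bC -(scale0r 0) bZ mul0r.
Qed.

Lemma pcalc_sym p x y : b (pcalc p x) y = b x (pcalc p y).
Proof.
rewrite bC !form_sumr; apply: eq_bigr => i _; rewrite bC (bC x) !bZ (bC _ x).
congr (_ * _); elim: (nat_of_ord i) x y => // k IH x y.
by rewrite iterSr IH /= G_sym.
Qed.

Lemma pcalc_sqr p q x : b (pcalc (p * q * p) x) x = b (pcalc q (pcalc p x)) (pcalc p x).
Proof. by rewrite -mulrA !pcalcM pcalc_sym. Qed.

(** Even powers are absorbed into a conjugation by symmetry, which leaves the four parities 1, X, 1
    - X and X (1 - X). The last is the sum of the conjugate of X by 1 - X and of 1 - X by X. *)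
Lemma pcalc_basis_ge0 k m x : 0 <= b (pcalc ('X^k * (1 - 'X) ^+ m) x) x.
Proof.
have b0 u : 0 <= b u u by rewrite b_norm sqr_ge0.
have c0 u : 0 <= b (pcalc 1 u) u by rewrite pcalc1.
have cX u : 0 <= b (pcalc 'X u) u by rewrite pcalcX.
have c1X u : 0 <= b (pcalc (1 - 'X) u) u.
  by rewrite pcalcB pcalcX pcalc1 -scaleN1r bD bZ mulN1r subr_ge0.
have cX1X u : 0 <= b (pcalc ('X * (1 - 'X)) u) u.
  rewrite (_ : 'X * _ = (1 - 'X) * 'X * (1 - 'X) + 'X * (1 - 'X) * 'X); last by ring.
  by rewrite pcalcD bD !pcalc_sqr addr_ge0.
pose p : {poly R} := 'X^(k./2) * (1 - 'X) ^+ m./2.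
rewrite (_ : _ * _ = p * ('X ^+ odd k * (1 - 'X) ^+ odd m) * p).
  rewrite pcalc_sqr; case: odd; case: odd; rewrite ?expr1 ?expr0 ?mul1r ?mulr1//.
rewrite -{1}(odd_double_half k) -{1}(odd_double_half m) -!addnn /p !exprD.
by ring.
Qed.

Lemma pcalc_ge0 p x : (forall s, 0 <= s <= 1 -> 0 <= p.[s]) -> 0 <= b (pcalc p x) x.
Proof.
apply: (@bernstein_positivity _ (fun p => b (pcalc p x) x)) => [q r|c q|k m].
- by rewrite pcalcD bD.
- by rewrite pcalcZ bZ.
- exact: pcalc_basis_ge0.
Qed.

(** Positivity of M^2 - p^2 on [0, 1], transported to [G], is the squared inequality. *)
Lemma pcalc_norm p M x : (forall s, 0 <= s <= 1 -> `|p.[s]| <= M) ->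
  `|pcalc p x| <= M * `|x|.
Proof.
move=> pM; have M0 : 0 <= M by apply: le_trans (pM 0 _); rewrite ?lexx ?ler01.
rewrite -(ler_pXn2r (n := 2)) ?nnegrE ?mulr_ge0// exprMn -!b_norm.
rewrite -subr_ge0 [X in _ - X](_ : _ = b (pcalc (p * p) x) x); last first.
  by rewrite pcalcM pcalc_sym bC.
rewrite -bZ -pcalcC -mulN1r -bZ -pcalcZ -bD -pcalcD.
apply: pcalc_ge0 => s /pM ps; rewrite !hornerE /=.
have : `|p.[s]| ^+ 2 <= M ^+ 2 by rewrite ler_pXn2r ?nnegrE.
by rewrite real_normK ?num_real//; lra.
Qed.

(** * Extension of the calculus from polynomials to continuous functions *)

Hypothesis H_complete : forall u : nat -> H,
  (forall e, 0 < e -> exists N, forall m n, (N <= m)%N -> (N <= n)%N ->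
     `|u m - u n| <= e) -> cvgn u.

Definition cont01 f := {within `[0, 1], continuous f}.

Definition papprox f (n : nat) : {poly R} :=
  xget 0 [set p | forall s, 0 <= s <= 1 -> `|f s - p.[s]| <= n.+1%:R^-1].

Definition fcalc f x : H := lim (pcalc (papprox f n) x @[n --> \oo]).

Lemma papproxP f n s : cont01 f -> 0 <= s <= 1 -> `|f s - (papprox f n).[s]| <= n.+1%:R^-1.
Proof.
move=> cf; move: s; rewrite /papprox; case: xgetP => // /(_ _) h.
have [|p hp] := weierstrass cf (e := n.+1%:R^-1); first by rewrite invr_gt0.
by have := h p hp.
Qed.

Lemma fcalc_cvg f (cf : cont01 f) x : pcalc (papprox f n) x @[n --> \oo] --> fcalc f x.
Proof.
apply: H_complete => e e0.
have [N _ hN] : \forall n \near \oo, @harmonic R n * `|x| <= e / 2.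
  have : @harmonic R n * `|x| @[n --> \oo] --> 0 * `|x|.
    by apply: cvgMl; exact: cvg_harmonic.
  by rewrite mul0r => /cvgr_le; apply; rewrite divr_gt0.
exists N => m n /hN /= hm /hN /= hn.
rewrite -pcalcB.
apply: (@le_trans _ _ ((m.+1%:R^-1 + n.+1%:R^-1) * `|x|)).
  apply: pcalc_norm => s s01; rewrite !hornerE.
  have := papproxP m cf s01; have := papproxP n cf s01.
  rewrite (_ : (papprox f m).[s] - _ = (f s - (papprox f n).[s]) - (f s - (papprox f m).[s])); last by ring.
  by move=> h1 h2; rewrite (le_trans (ler_normB _ _))// addrC lerD.
by rewrite mulrDl (splitr e) lerD.
Qed.

Arguments fcalc_cvg {f} cf x.

Lemma cvg_congr (T : topologicalType) (u v : nat -> T) (l : T) : u =1 v ->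
  v n @[n --> \oo] --> l -> u n @[n --> \oo] --> l.
Proof. by move=> /funext ->. Qed.

Lemma cvg_sub_le (u : nat -> H) (l : H) (v : nat -> R) :
  v n @[n --> \oo] --> 0 -> (forall n, `|u n - l| <= v n) -> u n @[n --> \oo] --> l.
Proof.
move=> v0 uv; apply/subr_cvg0/norm_cvg0P.
apply: (squeeze_cvgr _ (@cvg_cst _ (0 : R) _ _ _) v0).
by apply: nearW => n; rewrite normr_ge0 uv.
Qed.

(** The limit does not depend on the approximants, so the algebraic rules below can be checked on
    sums, multiples and products of approximants. *)
Lemma fcalc_cvg_approx f (q : nat -> {poly R}) (v : nat -> R) x : cont01 f ->
  v n @[n --> \oo] --> 0 ->
  (forall n s, 0 <= s <= 1 -> `|f s - (q n).[s]| <= v n) ->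
  pcalc (q n) x @[n --> \oo] --> fcalc f x.
Proof.
move=> cf v0 fq; have fc := fcalc_cvg cf x.
pose w n := (v n + harmonic n) * `|x|.
have w0 : w n @[n --> \oo] --> 0.
  rewrite -[X in _ --> X](mul0r `|x|) -[X in X * _](addr0 0).
  by apply: cvgMl; apply: cvgD => //; exact: cvg_harmonic.
have d0 : pcalc (q n) x - pcalc (papprox f n) x @[n --> \oo] --> (0 : H).
  apply: (cvg_sub_le w0) => n; rewrite subr0 -pcalcB.
  apply: pcalc_norm => s s01; rewrite !hornerE.
  rewrite (_ : (q n).[s] - _ = (f s - (papprox f n).[s]) - (f s - (q n).[s])); last by ring.
  by rewrite (le_trans (ler_normB _ _))// addrC lerD ?fq ?papproxP.
rewrite -[l in _ --> l]add0r.
by apply: cvg_congr (cvgD d0 fc) => n /=; rewrite subrK.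
Qed.

Lemma fcalc_poly p x : fcalc (horner p) x = pcalc p x.
Proof.
apply: (cvg_unique (@norm_hausdorff _ _) _ (@cvg_cst _ _ _ \oo _)).
apply: (@fcalc_cvg_approx _ (fun=> p) (fun=> 0)); last 2 first.
- exact: cvg_cst.
- by move=> _ s _; rewrite subrr normr0.
by apply: continuous_subspaceT; exact: continuous_horner.
Qed.

Lemma fcalc_lin f c x y : cont01 f ->
  fcalc f (c *: x + y) = c *: fcalc f x + fcalc f y.
Proof.
move=> cf; apply: (cvg_unique (@norm_hausdorff _ _) (fcalc_cvg cf _)).
apply: (cvg_congr (fun n => pcalc_lin (papprox f n) c x y)).
by apply: cvgD; [apply: cvgZr|]; exact: fcalc_cvg.
Qed.

Lemma fcalcD f g x : cont01 f -> cont01 g ->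
  fcalc (fun s => f s + g s) x = fcalc f x + fcalc g x.
Proof.
move=> cf cg; apply: (cvg_unique (@norm_hausdorff _ _)) (cvgD (fcalc_cvg cf x) (fcalc_cvg cg x)).
apply: (cvg_congr (v := fun n => pcalc (papprox f n + papprox g n) x)) => [n|].
  by rewrite pcalcD.
apply: (@fcalc_cvg_approx _ _ (fun n => harmonic n + harmonic n)).
- by move=> s; apply: cvgD; [exact: cf|exact: cg].
- by rewrite -[X in _ --> X]addr0; apply: cvgD; exact: cvg_harmonic.
- move=> n s s01; rewrite hornerD opprD addrACA.
  by rewrite (le_trans (ler_normD _ _))// lerD ?papproxP.
Qed.

Lemma fcalcZ f c x : cont01 f -> fcalc (fun s => c * f s) x = c *: fcalc f x.
Proof.
move=> cf; apply: (cvg_unique (@norm_hausdorff _ _)) (cvgZr (k := c) (fcalc_cvg cf x)).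
apply: (cvg_congr (v := fun n => pcalc (c *: papprox f n) x)) => [n|].
  by rewrite pcalcZ.
apply: (@fcalc_cvg_approx _ _ (fun n => `|c| * harmonic n)).
- by move=> s; apply: cvgMr; exact: cf.
- by rewrite -[X in _ --> X](mulr0 `|c|); apply: cvgMr; exact: cvg_harmonic.
- by move=> n s s01; rewrite hornerZ -mulrBr normrM ler_wpM2l ?papproxP.
Qed.

Lemma fcalc_norm f M x : cont01 f -> (forall s, 0 <= s <= 1 -> `|f s| <= M) ->
  `|fcalc f x| <= M * `|x|.
Proof.
move=> cf fM; have fc : `|pcalc (papprox f n) x| @[n --> \oo] --> `|fcalc f x|.
  by apply: cvg_norm; exact: fcalc_cvg.
have Mc : (M + harmonic n) * `|x| @[n --> \oo] --> M * `|x|.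
  have -> : M * `|x| = (M + 0) * `|x| by rewrite addr0.
  by apply: cvgMl; apply: cvgD; [exact: cvg_cst|exact: cvg_harmonic].
apply: (ler_cvg_to fc Mc); apply: nearW => n.
apply: pcalc_norm => s s01.
rewrite (_ : _.[s] = f s - (f s - (papprox f n).[s])); last by ring.
by rewrite (le_trans (ler_normB _ _))// lerD ?fM ?papproxP.
Qed.

Lemma fcalcB f g x : cont01 f -> cont01 g ->
  fcalc (fun s => f s - g s) x = fcalc f x - fcalc g x.
Proof.
move=> cf cg; rewrite -scaleN1r -fcalcZ// -fcalcD//.
  by congr fcalc; apply/funext => s; rewrite mulN1r.
by move=> s; apply: cvgMr; exact: cg.
Qed.

Lemma fcalc_sym f x y : cont01 f -> b (fcalc f x) y = b x (fcalc f y).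
Proof.
move=> cf.
have bc (u : nat -> H) l v : u n @[n --> \oo] --> l -> b (u n) v @[n --> \oo] --> b l v.
  move=> ul; apply/subr_cvg0/norm_cvg0P.
  have l0 : `|u n - l| * `|v| @[n --> \oo] --> (0 : R).
    rewrite -[X in _ --> X](mul0r `|v|); apply: cvgMl.
    by apply/norm_cvg0P/subr_cvg0.
  apply: (squeeze_cvgr _ (@cvg_cst _ (0 : R) _ _ _) l0); apply: nearW => n.
  by rewrite normr_ge0 -mulN1r -bZ -bD scaleN1r form_le_norm.
apply: (cvg_unique (@Rhausdorff _) (bc _ _ y (fcalc_cvg cf x))).
apply: (cvg_congr (v := fun n => b (pcalc (papprox f n) y) x)) => [n|].
  by rewrite pcalc_sym bC.
by rewrite bC; apply: bc; exact: fcalc_cvg.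
Qed.

Lemma cont01M f g : cont01 f -> cont01 g -> cont01 (fun s => f s * g s).
Proof. by move=> cf cg s; apply: cvgM; [exact: cf|exact: cg]. Qed.

Lemma cont01_bounded f : cont01 f -> exists2 M, 0 <= M & forall s, 0 <= s <= 1 -> `|f s| <= M.
Proof.
move=> cf; have [N [_ NM]] := compact_bounded (continuous_compact cf (@segment_compact R 0 1)).
exists (`|N| + 1) => [|s s01]; first by rewrite addr_ge0.
apply: (NM (`|N| + 1)); first by rewrite (le_lt_trans (ler_norm _))// ltrDl.
by exists s => //=; rewrite in_itv.
Qed.

(** One limit at a time: with a polynomial in place of [g], [pcalcM] applies to the approximants of
    [f]; then the approximants of [g] converge. *)
Lemma fcalcM f g x : cont01 f -> cont01 g ->
  fcalc (fun s => f s * g s) x = fcalc f (fcalc g x).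
Proof.
move=> cf cg; have cfg := cont01M cf cg.
have [M M0 fM] := cont01_bounded cf.
have hp p : cont01 (horner p).
  by apply: continuous_subspaceT; exact: continuous_horner.
have step p : fcalc (fun s => f s * p.[s]) x = fcalc f (pcalc p x).
  apply: (cvg_unique (@norm_hausdorff _ _)) (fcalc_cvg cf (pcalc p x)).
  apply: (cvg_congr (fun n => esym (pcalcM (papprox f n) p x))).
  have [C C0 pC] := cont01_bounded (hp p).
  apply: (@fcalc_cvg_approx _ _ (fun n => harmonic n * C)).
  - exact: cont01M.
  - by rewrite -[X in _ --> X](mul0r C); apply: cvgMl; exact: cvg_harmonic.
  - by move=> n s s01; rewrite hornerM -mulrBl normrM ler_pM ?pC ?papproxP.
have L : pcalc (papprox g n) x @[n --> \oo] --> fcalc g x by exact: fcalc_cvg.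
have L1 : fcalc f (pcalc (papprox g n) x) @[n --> \oo] --> fcalc f (fcalc g x).
  apply: (@cvg_sub_le _ _ (fun n => M * `|pcalc (papprox g n) x - fcalc g x|)).
    rewrite -[X in _ --> X](mulr0 M); apply: cvgMr.
    by apply/norm_cvg0P/subr_cvg0.
  move=> n; rewrite -scaleN1r addrC -fcalc_lin// scaleN1r addrC.
  exact: fcalc_norm.
apply: (cvg_unique (@norm_hausdorff _ _)) L1.
apply: (cvg_congr (fun n => esym (step (papprox g n)))).
apply: (@cvg_sub_le _ _ (fun n => M * harmonic n * `|x|)).
  rewrite -[X in _ --> X](mul0r `|x|) -[X in X * _](mulr0 M).
  by apply: cvgMl; apply: cvgMr; exact: cvg_harmonic.
move=> n; have cp := hp (papprox g n).
rewrite -fcalcB ?cont01M//; last exact: cont01M.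
apply: fcalc_norm => [s|s s01].
  by apply: cvgB; [exact: (cont01M cf cp)|exact: cfg].
by rewrite -mulrBr normrM ler_pM ?fM// distrC papproxP.
Qed.

(** On the kernel of [G] only the constant coefficient of a polynomial survives. *)
Lemma fcalc_ker f x : cont01 f -> G x = 0 -> fcalc f x = f 0 *: x.
Proof.
move=> cf Gx0.
have pE p : pcalc p x = p.[0] *: x.
  elim/poly_ind: p => [|p c IH]; first by rewrite horner0 -polyC0 pcalcC.
  rewrite pcalcD pcalcXr pcalcC Gx0 hornerMXaddC mulr0 add0r.
  suff -> : pcalc p 0 = 0 by rewrite add0r.
  by rewrite /pcalc big1// => i _; rewrite iter_fix ?scaler0 ?linear0.
apply: (cvg_unique (@norm_hausdorff _ _) (fcalc_cvg cf x)).
apply: (cvg_congr (fun n => pE (papprox f n))).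
apply: cvgZl; apply/cvgrPdist_le => e e0.
near=> n; apply: (@le_trans _ _ (harmonic n)).
  by apply: papproxP; rewrite // lexx ler01.
by near: n; exact: (cvgr_le _ cvg_harmonic).
Unshelve. all: by end_near. Qed.

End functional_calculus.

(** * Exponentially damped waves *)

Section damped_wave.
Context {R : realType}.
Implicit Types (phi t tau w c s x M al be th : R).

(** The n-th power of x / n <= exp (x / n). *)
Lemma expRN_poly n x : (0 < n)%N -> 0 <= x -> x ^+ n * expR (- x) <= n%:R ^+ n.
Proof.
move=> n0 x0; have n0' : 0 < n%:R :> R by rewrite ltr0n.
have -> : expR (- x) = expR (- (x / n%:R)) ^+ n.
  by rewrite -expRM_natl mulrN mulrCA mulfV ?mulr1// gt_eqF.
rewrite -exprMn; apply: lerXn2r.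
- by rewrite nnegrE mulr_ge0 ?expR_ge0.
- by rewrite nnegrE ltW.
rewrite expRN ler_pdivrMr ?expR_gt0// mulrC -ler_pdivrMr//.
by apply: le_trans (expR_ge1Dx _); rewrite lerDr.
Qed.

(** For [phi = 0] and [phi = pi / 2] these are the real and imaginary parts of exp(- (t + i tau) w),
    as cos (x + pi / 2) = - sin x. With a phase instead of two functions, the derivative in [tau]
    and the change of sign are shifts of [phi]. *)
Definition wave phi t tau w : R := expR (- (t * w)) * cos (tau * w + phi).

Lemma wave_norm phi t tau w : `|wave phi t tau w| <= expR (- (t * w)).
Proof.
rewrite normrM ger0_norm ?expR_ge0// ler_piMr ?expR_ge0// ler_norml.
by rewrite cos_geN1 cos_le1.
Qed.

Lemma wave0 phi w : wave phi 0 0 w = cos phi.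
Proof. by rewrite /wave !mul0r oppr0 expR0 mul1r add0r. Qed.

Lemma wave_pi phi t tau w : wave (phi + pi) t tau w = - wave phi t tau w.
Proof. by rewrite /wave addrA cosDpi mulrN. Qed.

Lemma waveM phi psi t tau t' tau' w :
  wave (phi + psi) (t + t') (tau + tau') w =
  wave phi t tau w * wave psi t' tau' w
  - wave (phi + pi / 2) t tau w * wave (psi + pi / 2) t' tau' w.
Proof.
rewrite /wave mulrDl opprD expRD mulrDl addrACA cosD !addrA !cosDpihalf.
ring.
Qed.

Lemma wave_sqr t tau w :
  wave 0 t tau w ^+ 2 + wave (pi / 2) t tau w ^+ 2 = expR (- (t * w)) ^+ 2.
Proof.
rewrite /wave addr0 cosDpihalf mulrN sqrrN !exprMn -mulrDr cos2Dsin2 mulr1.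
by [].
Qed.

Lemma is_derive_wave phi t tau w al be th :
  is_derive th 1 (fun th => wave phi (t + th * al) (tau + th * be) w)
    (- (al * w) * wave phi (t + th * al) (tau + th * be) w +
     be * w * wave (phi + pi / 2) (t + th * al) (tau + th * be) w).
Proof.
rewrite /wave addrA cosDpihalf.
apply: is_derive_eq.
by rewrite /GRing.scale /=; ring.
Qed.

Lemma mean_value_01 (g dg : R -> R) M :
  (forall th, is_derive th 1 g (dg th)) ->
  (forall th, 0 <= th <= 1 -> `|dg th| <= M) ->
  forall th, 0 <= th <= 1 -> `|g th - g 0| <= M.
Proof.
move=> gd gM th /andP[th0 th1].
have [|y] := @MVT_segment _ g dg 0 th th0 (fun x _ => gd x).
  apply: continuous_subspaceT => x.
  by apply: differentiable_continuous; apply/derivable1_diffP; exact: (ex_derive (is_derive := gd x)).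
rewrite in_itv /= => /andP[y0 y1] ->; rewrite normrM subr0 (ger0_norm th0).
have h := gM y; rewrite y0 (le_trans y1)// in h.
by rewrite (le_trans _ (h isT))// ler_piMr.
Qed.

(** Mean value inequality along the segment from (0, 0) to (t, tau). The growth in [w] is
    compensated on the range of [G], where a factor [s] is available. *)
Lemma wave_lipschitz phi t tau w : 0 <= t -> 0 < w ->
  `|wave phi t tau w - cos phi| <= w * (t + `|tau|).
Proof.
move=> t0 w0.
pose g th := wave phi (0 + th * t) (0 + th * tau) w.
have := @mean_value_01 g _ (w * (t + `|tau|)) (is_derive_wave phi 0 0 w t tau) _ 1.
rewrite /g !add0r !mul1r !mul0r wave0; apply; last by rewrite ler01 lexx.
move=> th /andP[th0 th1].
have e1 psi : `|wave psi (0 + th * t) (0 + th * tau) w| <= 1.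
  by apply: le_trans (wave_norm _ _ _ _) _; rewrite -expR0 ler_expR oppr_le0 add0r !mulr_ge0// ltW.
rewrite (le_trans (ler_normD _ _))// mulrDr lerD//.
  rewrite normrM normrN (ger0_norm (x := t * w)) ?mulr_ge0 ?(ltW w0)// mulrC.
  by rewrite (mulrC w) ler_piMl// mulr_ge0// ltW.
rewrite normrM (normrM tau) (gtr0_norm w0) (mulrC w) ler_piMr//.
by rewrite mulr_ge0// ltW.
Qed.

(** The bound has to be uniform in [w], whereas second derivatives grow like w^2. The condition
    [|al| <= t / 2] leaves a damping exp(- t w / 2) along the segment, and (t w / 2)^2 exp(- t w /
    2) <= 4 yields the constant 16 / t^2. *)
Lemma wave_taylor phi t tau w al be : 0 < t -> 0 < w -> `|al| <= t / 2 ->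
  `|wave phi (t + al) (tau + be) w - wave phi t tau w
    - (- (al * w) * wave phi t tau w + be * w * wave (phi + pi / 2) t tau w)|
  <= (`|al| + `|be|) ^+ 2 * (16 / t ^+ 2).
Proof.
move=> t0 w0 alt.
pose g psi th := wave psi (t + th * al) (tau + th * be) w.
pose dg psi th := - (al * w) * g psi th + be * w * g (psi + pi / 2) th.
have gd psi th : is_derive th 1 (g psi) (dg psi th) by exact: is_derive_wave.
pose ddg th := - (al * w) * dg phi th + be * w * dg (phi + pi / 2) th.
have dgd th : is_derive th 1 (dg phi) (ddg th).
  rewrite /dg; apply: is_derive_eq.
  by rewrite /GRing.scale /= /ddg; ring.
set M := _ * (16 / _).
have gE psi th : 0 <= th <= 1 -> `|g psi th| <= expR (- (t / 2 * w)).
  move=> /andP[th0 th1]; apply: le_trans (wave_norm _ _ _ _) _.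
  rewrite ler_expR lerN2 ler_pM2r//.
  have : - (th * al) <= t / 2.
    apply: le_trans alt; apply: le_trans (ler_norm _) _.
    by rewrite normrN normrM (ger0_norm th0) ler_piMl.
  by lra.
have M2 : w ^+ 2 * expR (- (t / 2 * w)) <= 16 / t ^+ 2.
  have tw0 : 0 <= t / 2 * w by rewrite ltW// mulr_gt0// divr_gt0.
  have h : (t / 2) ^+ 2 * (w ^+ 2 * expR (- (t / 2 * w))) <= 2 ^+ 2.
    by rewrite mulrA -exprMn; exact: expRN_poly.
  rewrite ler_pdivlMr ?exprn_gt0//.
  move: (w ^+ 2 * _) h => X.
  by rewrite (_ : (t / 2) ^+ 2 * X = X * t ^+ 2 / 4); [lra|field].
have dgE psi th : 0 <= th <= 1 -> `|dg psi th| <= (`|al| + `|be|) * w * expR (- (t / 2 * w)).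
  move=> th01; rewrite (le_trans (ler_normD _ _))//.
  rewrite [leRHS](_ : _ = `|al| * w * expR (- (t / 2 * w)) +
    `|be| * w * expR (- (t / 2 * w))); last by ring.
  rewrite (normrM (- (al * w))) (normrM (be * w)) normrN (normrM al) (normrM be) (gtr0_norm w0).
  by apply: lerD; (apply: ler_wpM2l; [rewrite mulr_ge0// ltW|exact: gE]).
have ddgE th : 0 <= th <= 1 -> `|ddg th| <= M.
  move=> th01; rewrite (le_trans (ler_normD _ _))//.
  apply: (@le_trans _ _ ((`|al| + `|be|) ^+ 2 * (w ^+ 2 * expR (- (t / 2 * w))))).
    rewrite [leRHS](_ : _ = (`|al| * w) * ((`|al| + `|be|) * w * expR (- (t / 2 * w))) +
      (`|be| * w) * ((`|al| + `|be|) * w * expR (- (t / 2 * w)))); last by ring.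
    rewrite (normrM (- (al * w))) (normrM (be * w)) normrN (normrM al) (normrM be) (gtr0_norm w0).
    by apply: lerD; (apply: ler_wpM2l; [rewrite mulr_ge0// ltW|exact: dgE]).
  by rewrite ler_wpM2l// exprn_ge0// addr_ge0.
have step := mean_value_01 dgd ddgE.
(* The mean value inequality is applied a second time, to [g phi] minus its tangent at 0. *)
have hd th : is_derive th 1 (fun th => g phi th - th * dg phi 0) (dg phi th - dg phi 0).
  by apply: is_derive_eq; rewrite /GRing.scale /=; ring.
have := @mean_value_01 _ _ M hd step 1.
rewrite lexx ler01 => /(_ isT).
rewrite /dg /g !mul1r !mul0r !addr0 subr0.
by rewrite -addrA -opprD [X in _ - X]addrC opprD addrA.
Qed.

(** Change of spectral variable: [w] is an eigenvalue of the unbounded operator and s = 1 / (c w)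
    the matching eigenvalue of [G], with s = 0 as the point at infinity. *)
Definition at_inv c (h : R -> R) s : R := if s == 0 then 0 else h (c * s)^-1.

(** The decay of [h] gives |h (1 / (c s))| <= M c s, whence continuity at 0. *)
Lemma cont01_at_inv c (h : R -> R) M : 0 < c ->
  (forall w, 0 < w -> {for w, continuous h}) ->
  (forall w, 0 < w -> `|h w| <= M / w) -> cont01 (at_inv c h).
Proof.
move=> c0 hc hM; apply/subspace_continuousP => x.
rewrite /= in_itv /= => /andP[x0 _]; rewrite /from_subspace.
have M0 : 0 <= M.
  by have := hM 1 ltr01; rewrite divr1; apply: le_trans.
have [->|xn0] := eqVneq x 0.
  rewrite [X in _ --> X]/at_inv eqxx.
  apply/cvgrPdist_le => e e0; rewrite near_withinE.
  have r0 : 0 < e / (M * c + 1) by rewrite divr_gt0// ltr_pwDr// mulr_ge0// ltW.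
  near=> y; rewrite /= in_itv /= => /andP[y0 _]; rewrite sub0r normrN /at_inv.
  have [_|yn0] := eqVneq y 0; first by rewrite normr0 ltW.
  have {yn0}y0 : 0 < y by rewrite lt_neqAle eq_sym yn0.
  rewrite (le_trans (hM _ _)) ?invr_gt0 ?mulr_gt0// invrK.
  have : `|y| <= e / (M * c + 1).
    by near: y; apply: (@nbhs0_le _ R); exact: r0.
  rewrite (gtr0_norm y0) ler_pdivlMr; last by rewrite ltr_pwDr// mulr_ge0// ltW.
  by lra.
apply: cvg_within_filter.
have x0' : 0 < x by rewrite lt_neqAle eq_sym xn0.
apply: (@cvg_trans _ ((fun s => h (c * s)^-1) y @[y --> x])).
  apply: near_eq_cvg; near=> y; rewrite /at_inv ifF// gt_eqF//.
  by near: y; exact: lt_nbhsr.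
rewrite /at_inv (negbTE xn0).
apply: (@cvg_comp _ _ _ (fun s => (c * s)^-1) h _ (nbhs ((c * x)^-1))); last first.
  by apply: hc; rewrite invr_gt0 mulr_gt0.
by apply: cvgV; [rewrite mulf_neq0// gt_eqF|apply: cvgMr; exact: cvg_id].
Unshelve. all: by end_near. Qed.

Lemma continuous_wave phi t tau w : {for w, continuous (wave phi t tau)}.
Proof.
apply: cvgM.
  apply: (@cvg_comp _ _ _ (fun w => - (t * w)) expR _ (nbhs (- (t * w)))).
    by apply: cvgN; apply: cvgMr; exact: cvg_id.
  exact: continuous_expR.
apply: (@cvg_comp _ _ _ (fun w => tau * w + phi) cos _ (nbhs (tau * w + phi))).
  by apply: cvgD; [apply: cvgMr; exact: cvg_id|exact: cvg_cst].
exact: continuous_cos.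
Qed.

Lemma cont01_wave c phi t tau : 0 < c -> 0 < t -> cont01 (at_inv c (wave phi t tau)).
Proof.
move=> c0 t0; apply: (@cont01_at_inv _ _ t^-1) => // w w0.
  exact: continuous_wave.
rewrite (le_trans (wave_norm _ _ _ _))// -invfM.
have := expRN_poly (isT : 0 < 1)%N (ltW (mulr_gt0 t0 w0)).
by rewrite !expr1 mulrC -ler_pdivlMr ?mulr_gt0// div1r.
Qed.

Lemma cont01_wave' c phi t tau : 0 < c -> 0 < t ->
  cont01 (at_inv c (fun w => w * wave phi t tau w)).
Proof.
move=> c0 t0; apply: (@cont01_at_inv _ _ (4 / t ^+ 2)) => // w w0.
  by apply: cvgM; [exact: cvg_id|exact: continuous_wave].
rewrite normrM (gtr0_norm w0) ler_pdivlMr//.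
apply: (@le_trans _ _ (w ^+ 2 * expR (- (t * w)))).
  by rewrite mulrAC -expr2 ler_wpM2l ?wave_norm// exprn_ge0 ?ltW.
have h : t ^+ 2 * (w ^+ 2 * expR (- (t * w))) <= 2 ^+ 2.
  by rewrite mulrA -exprMn; apply: expRN_poly => //; rewrite ltW// mulr_gt0.
by rewrite ler_pdivlMr ?exprn_gt0// mulrC (le_trans h)// -natrX.
Qed.

End damped_wave.

Local Open Scope complex_scope.

Lemma norm_le_linear_continuous (K : numFieldType) (X : normedModType K)
    (L : {linear X -> X}) (M : K) : 0 <= M ->
  (forall x, `|L x| <= M * `|x|) -> continuous L.
Proof.
move=> M0 LM x; apply/cvgrPdist_le => e e0.
have M1 : 0 < M + 1 by rewrite ltr_wpDl.
have e1 : 0 < e / (M + 1) by rewrite divr_gt0.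
apply/nbhs_normP; exists (e / (M + 1)) => //= y /ltW h.
rewrite -linearB (le_trans (LM _))// (@le_trans _ _ ((M + 1) * `|x - y|))//.
  by rewrite ler_wpM2r// lerDl.
by rewrite mulrC -ler_pdivlMr.
Qed.

(** * Norms and operators on the complexification *)

Section L2_norms.
Context d (T : measurableType d) (R : realType) (mu : {measure set T -> \bar R}).
Notation H := (L2 mu).
Notation HC := (L2C mu).

Lemma L2_normE (u : H) : ip u u = `|u| ^+ 2.
Proof. by rewrite /Num.norm /= /L2norm sqr_sqrtr ?ip_ge0. Qed.

Lemma L2C_normE (x : HC) : `|x| = (Num.sqrt (`|x.1| ^+ 2 + `|x.2| ^+ 2))%:C.
Proof. by rewrite -!L2_normE. Qed.

Lemma ipDr (u v w : H) : ip u (v + w) = ip u v + ip u w.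
Proof. by rewrite ipC ipDl !(ipC u). Qed.

Lemma ipZr c (u v : H) : ip u (c *: v) = c * ip u v.
Proof. by rewrite ipC ipZl ipC. Qed.

Lemma ipBl (u v w : H) : ip (u - v) w = ip u w - ip v w.
Proof. by rewrite ipDl -scaleN1r ipZl mulN1r. Qed.

Lemma ipBr (u v w : H) : ip w (u - v) = ip w u - ip w v.
Proof. by rewrite ipC ipBl !(ipC w). Qed.

Lemma ipNr (u w : H) : ip w (- u) = - ip w u.
Proof. by rewrite -scaleN1r ipZr mulN1r. Qed.

Lemma ip0 (u : H) : ip u 0 = 0.
Proof. by rewrite -(scale0r 0) ipZr mul0r. Qed.

Lemma ip_inj (u v : H) : (forall w, ip w u = ip w v) -> u = v.
Proof.
move=> h; apply/eqP; rewrite -subr_eq0; apply/eqP/ip_eq0.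
by rewrite ipBr h subrr.
Qed.

Lemma ip_le_norm (u v : H) : `|ip u v| <= `|u| * `|v|.
Proof. exact: (form_le_norm (@ipC _ _ _ mu) (@ipDl _ _ _ mu) (@ipZl _ _ _ mu) L2_normE). Qed.

Lemma le_L2C_norm (x y : HC) (M : R) : 0 <= M ->
  `|x.1| ^+ 2 + `|x.2| ^+ 2 <= M ^+ 2 * (`|y.1| ^+ 2 + `|y.2| ^+ 2) ->
  `|x| <= M%:C * `|y|.
Proof.
move=> M0 h; rewrite !L2C_normE -rmorphM /= lecR -(ger0_norm M0) -sqrtr_sqr.
by rewrite -sqrtrM ?sqr_ge0// ler_wsqrtr.
Qed.

Lemma L2C_norm_le (x : HC) : `|x| <= (`|x.1| + `|x.2|)%:C.
Proof.
rewrite L2C_normE lecR -[leRHS]ger0_norm ?addr_ge0// -sqrtr_sqr ler_wsqrtr//.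
by rewrite sqrrD -addrA (addrC (_ *+ _)) addrA lerDl mulrn_wge0// mulr_ge0.
Qed.

Lemma L2C_norm_ge1 (x : HC) : (`|x.1|)%:C <= `|x|.
Proof. by rewrite L2C_normE lecR -[leLHS]ger0_norm// -sqrtr_sqr ler_wsqrtr// lerDl sqr_ge0. Qed.

Lemma L2C_norm_ge2 (x : HC) : (`|x.2|)%:C <= `|x|.
Proof. by rewrite L2C_normE lecR -[leLHS]ger0_norm// -sqrtr_sqr ler_wsqrtr// lerDr sqr_ge0. Qed.

Lemma posC (e : R[i]) : 0 < e -> exists2 r : R, 0 < r & e = r%:C.
Proof.
by case: e => a b; rewrite ltcE /= => /andP[/eqP -> a0]; exists a.
Qed.

Lemma L2C_cvgP {U : Type} (F : set_system U) {FF : Filter F} (f : U -> HC) (l : HC) :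
  f t @[t --> F] --> l <->
  (f t).1 @[t --> F] --> l.1 /\ (f t).2 @[t --> F] --> l.2.
Proof.
split=> [/cvgrPdist_le h|[/cvgrPdist_le h1 /cvgrPdist_le h2]].
  split; apply/cvgrPdist_le => e e0.
    have e0' : 0 < e%:C :> R[i] by rewrite ltcR.
    apply: filterS (h _ e0') => t; rewrite -lecR; apply: le_trans.
    exact: (L2C_norm_ge1 (l - f t)).
  have e0' : 0 < e%:C :> R[i] by rewrite ltcR.
  apply: filterS (h _ e0') => t; rewrite -lecR; apply: le_trans.
  exact: (L2C_norm_ge2 (l - f t)).
apply/cvgrPdist_le => _ /posC[e e0 ->].
have e2 : 0 < e / 2 by rewrite divr_gt0.
apply: filterS2 (h1 _ e2) (h2 _ e2) => t t1 t2.
by rewrite (le_trans (L2C_norm_le _))// lecR (splitr e) lerD.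
Qed.

End L2_norms.

Section complex_operators.
Context d (T : measurableType d) (R : realType) (mu : {measure set T -> \bar R}).
Notation H := (L2 mu).
Notation HC := (L2C mu).

Lemma L2C_scaleE (a b : R) (x : HC) :
  (a +i* b) *: x = (a *: x.1 - b *: x.2, a *: x.2 + b *: x.1) :> HC.
Proof. by []. Qed.

(** The operator f + i g applied to u + i v. *)
Definition complex_op (f g : H -> H) (x : HC) : HC :=
  (f x.1 - g x.2, f x.2 + g x.1).

Lemma complex_op_linear (f g : H -> H) : linear f -> linear g ->
  linear (complex_op f g).
Proof.
move=> lf lg [a b] [u v] [u' v'].
have f0 : f 0 = 0 by have := lf (-1) 0 0; rewrite scaler0 addr0 scaleN1r addNr.
have g0 : g 0 = 0 by have := lg (-1) 0 0; rewrite scaler0 addr0 scaleN1r addNr.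
have fD x y : f (x + y) = f x + f y by have := lf 1 x y; rewrite !scale1r.
have gD x y : g (x + y) = g x + g y by have := lg 1 x y; rewrite !scale1r.
have fZ k x : f (k *: x) = k *: f x by have := lf k x 0; rewrite f0 !addr0.
have gZ k x : g (k *: x) = k *: g x by have := lg k x 0; rewrite g0 !addr0.
rewrite /complex_op !L2C_scaleE /=; congr pair => /=.
  rewrite -!(scaleNr b) !(fD, gD, fZ, gZ).
  (* Pairing with an arbitrary [w] turns an identity of vectors into one of reals, which [ring]
     decides. *)
  by apply: ip_inj => w; rewrite !(ipDr, ipNr, ipZr); ring.
rewrite -!(scaleNr b) !(fD, gD, fZ, gZ).
by apply: ip_inj => w; rewrite !(ipDr, ipNr, ipZr); ring.
Qed.

Lemma complex_op_norm (f g : H -> H) (M : R) (x : HC) : 0 <= M ->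
  (forall y, `|f y| <= M * `|y|) -> (forall y, `|g y| <= M * `|y|) ->
  `|complex_op f g x| <= (4 * M)%:C * `|x|.
Proof.
move=> M0 fM gM; rewrite (le_trans (L2C_norm_le _))//.
have := L2C_norm_ge1 x; have := L2C_norm_ge2 x.
rewrite L2C_normE -rmorphM !lecR; set N := Num.sqrt _ => x2 x1.
have h1 := ler_normB (f x.1) (g x.2); have h2 := ler_normD (f x.2) (g x.1).
have := fM x.1; have := fM x.2; have := gM x.1; have := gM x.2.
have := ler_wpM2l M0 x1; have := ler_wpM2l M0 x2.
by rewrite /complex_op /=; lra.
Qed.

Definition linear_pack (f : HC -> HC) (lf : linear f) : {linear HC -> HC} :=
  HB.pack f (GRing.isLinear.Build R[i] HC HC *:%R f lf).

End complex_operators.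

Local Notation Re := complex.Re.
Local Notation Im := complex.Im.

(** * The operator with graph u - P u = c G y, P y = 0 *)

Section resolvent_operator.
Context d (T : measurableType d) (R : realType) (mu : {measure set T -> \bar R}).
Notation H := (L2 mu).
Notation HC := (L2C mu).
Variables (G P : {linear H -> H}) (c : R).
Implicit Types (u v w x y : H) (f g : R -> R) (e r s t : R).

Hypothesis c_gt0 : 0 < c.
Hypothesis G_sym : forall x y, ip (G x) y = ip x (G y).
Hypothesis G_ge0 : forall x, 0 <= ip (G x) x.
Hypothesis G_le1 : forall x, ip (G x) x <= ip x x.
Hypothesis P_sym : forall x y, ip (P x) y = ip x (P y).
Hypothesis PP : forall x, P (P x) = P x.
Hypothesis GP : forall x, G (P x) = 0.
Hypothesis G_ker : forall x, G x = 0 -> P x = x.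
Hypothesis H_complete : forall u : nat -> H,
  (forall e, 0 < e -> exists N, forall m n, (N <= m)%N -> (N <= n)%N ->
     `|u m - u n| <= e) -> cvgn u.

Lemma PG x : P (G x) = 0.
Proof. by apply: ip_inj => w; rewrite -P_sym -G_sym GP ip0 ipC ip0. Qed.

Lemma P_norm x : `|P x| <= `|x|.
Proof.
have [->|Px0] := eqVneq (P x) 0; first by rewrite normr0.
have Pxp : 0 < `|P x| by rewrite normr_gt0.
rewrite -(ler_pM2l Pxp) -expr2 -L2_normE P_sym PP ipC.
by rewrite (le_trans (ler_norm _))// ip_le_norm.
Qed.

Let bD := @ipDl _ _ _ mu.
Let bZ := @ipZl _ _ _ mu.
Let bC := @ipC _ _ _ mu.

(* [(1 - G)^n y] is Cauchy and its limit is fixed by [1 - G]. *)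
Lemma G_range_dense y e : P y = 0 -> 0 < e -> exists z, `|y - G z| <= e.
Proof.
move=> Py0 e0.
pose E n := pcalc G ((1 - 'X) ^+ n) y.
have ES n : E n.+1 = E n - G (E n).
  by rewrite /E exprS pcalcM pcalcB pcalcX pcalc1.
have E0 : E 0%N = y by rewrite /E expr0 pcalc1.
have EG n : exists z, y - E n = G z.
  elim: n => [|n [z zE]]; first by exists 0; rewrite E0 subrr linear0.
  by exists (z + E n); rewrite linearD -zE ES opprB addrA addrAC.
have PE n : P (E n) = 0.
  by elim: n => [|n IH]; rewrite ?E0// ES linearB /= IH PG subrr.
(* These moments control all distances: |E m - E n|^2 = a (2 m) - 2 a (m + n) + a (2 n), which is
   small because [a] is nonincreasing and bounded below. *)
pose a n := ip (E n) y.
have a_ge0 n : 0 <= a n.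
  apply: (pcalc_ge0 bC bD bZ (@L2_normE _ _ _ mu) G_sym G_ge0 G_le1) => s /andP[s0 s1].
  by rewrite !hornerE exprn_ge0// subr_ge0.
have a_noninc : {homo a : m n / (m <= n)%N >-> n <= m}.
  apply/nonincreasing_seqP => n.
  rewrite -subr_ge0 /a -ipBl ES opprB addrC subrK.
  rewrite (_ : G (E n) = pcalc G ('X * (1 - 'X) ^+ n) y); last first.
    by rewrite pcalcM pcalcX.
  apply: (pcalc_ge0 bC bD bZ (@L2_normE _ _ _ mu) G_sym G_ge0 G_le1) => s /andP[s0 s1].
  by rewrite !hornerE mulr_ge0// exprn_ge0// subr_ge0.
have EE m n : ip (E m) (E n) = a (m + n)%N.
  rewrite /a /E exprD pcalcM.
  by rewrite (pcalc_sym bC bD bZ G_sym) -pcalcM mulrC pcalcM ipC (pcalc_sym bC bD bZ G_sym) ipC.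
have ca := nonincreasing_is_cvgn a_noninc.
have {}ca : cvgn a by apply: ca; exists 0 => _ [n _ <-].
have EC : cvgn E.
  apply: H_complete => r r0.
  have r2 : 0 < r ^+ 2 / 2 by rewrite divr_gt0 ?exprn_gt0.
  have [N _ hN] : \forall n \near \oo, a n <= limn a + r ^+ 2 / 2.
    by apply: (cvgr_le _ ca); rewrite ltrDl.
  have aN n : limn a <= a n by exact: nonincreasing_cvgn_ge.
  exists N => m n Nm Nn.
  rewrite -(ler_pXn2r (n := 2)) ?nnegrE ?(ltW r0)// -L2_normE !(ipBl, ipBr) !EE.
  have := hN (m + m)%N (leq_trans Nm (leq_addr _ _)).
  have := hN (n + n)%N (leq_trans Nn (leq_addr _ _)).
  have := aN (m + n)%N; rewrite (addnC n m) /=; lra.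
pose l := limn E.
have El : E n @[n --> \oo] --> l by exact: EC.
have G1 x : `|G x| <= `|x|.
  have := pcalc_norm bC bD bZ (@L2_normE _ _ _ mu) G_sym G_ge0 G_le1 (p := 'X) (M := 1) x.
  rewrite pcalcX mul1r; apply => s /andP[s0 s1].
  by rewrite hornerX ger0_norm.
have GEl : G (E n) @[n --> \oo] --> G l.
  apply: (@cvg_sub_le _ _ _ _ (fun n => `|E n - l|)) => [|n].
    by apply/norm_cvg0P/subr_cvg0.
  by rewrite -linearB.
have Gl : G l = 0.
  have : E n.+1 @[n --> \oo] --> l - G l.
    by apply: (cvg_congr ES); exact: cvgB.
  have : E n.+1 @[n --> \oo] --> l by rewrite (cvg_shiftS E).
  move=> h1 h2.
  have le : l = l - G l by exact: (cvg_unique (@norm_hausdorff _ _) h1 h2).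
  by apply/oppr_inj/(addrI l); rewrite -le oppr0 addr0.
have PEl : P (E n) @[n --> \oo] --> P l.
  apply: (@cvg_sub_le _ _ _ _ (fun n => `|E n - l|)) => [|n].
    by apply/norm_cvg0P/subr_cvg0.
  by rewrite -linearB P_norm.
have l0 : l = 0.
  rewrite -(G_ker Gl); apply: (cvg_unique (@norm_hausdorff _ _) PEl).
  by apply: (cvg_congr PE); exact: cvg_cst.
rewrite l0 in El; have /cvgrPdist_le /(_ _ e0)[N _ hN] := El.
have [z zE] := EG N; exists z; rewrite -zE opprB addrC subrK.
by have := hN N (leqnn _); rewrite sub0r normrN.
Qed.

(** * Self-adjointness, nonnegativity and dense domain of the graph *)

Definition resolvent_graph : set (H * H) :=
  [set p | p.1 - P p.1 = c *: G p.2 /\ P p.2 = 0].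
Notation A := resolvent_graph.

Lemma resolvent_graph_linear : linear_operator A.
Proof.
split => [x y z [/= xy Py] [/= xz Pz]||k x y x' y' [/= xy Py] [/= xy' Py']].
- apply/eqP; rewrite -subr_eq0; apply/eqP.
  have : c *: G (y - z) = 0 by rewrite linearB scalerBr -xy -xz subrr.
  move/eqP; rewrite scaler_eq0 gt_eqF//= => /eqP/G_ker <-.
  by rewrite linearB /= Py Pz subrr.
- by split; [rewrite /= linear0 subr0 linear0 scaler0|rewrite /= linear0].
- split; rewrite /= !linearP /= ?Py ?Py' ?scaler0 ?addr0//.
  by rewrite -xy -xy' scalerDr addrACA.
Qed.

Lemma resolvent_graph_selfadjoint : A = adjoint A.
Proof.
apply/seteqP; split=> [[x y] [/= xy Py] [x' y'] [/= xy' Py']|[v f] h].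
  have e (p q : H) : P q = 0 -> ip (p - P p) q = ip p q.
    by move=> Pq; rewrite ipBl P_sym Pq ip0 subr0.
  by rewrite /= ipC -(e x y' Py') -(e x' y Py) xy xy' !ipZl G_sym (ipC y).
(* Testing against the kernel elements [(P w, 0)] gives the orthogonality condition. *)
have Pf : P f = 0.
  apply: ip_inj => w; rewrite ip0 -P_sym.
  have := h (P w, 0); rewrite /= ipC ip0 => <-//.
  by split; rewrite /= ?PP ?subrr !linear0 ?scaler0.
split => //=; apply: ip_inj => w.
(* These test pairs exhaust the range of [1 - P], hence determine [v - P v]. *)
have /h /= : A (c *: G (w - P w), w - P w).
  split; last by rewrite /= linearB /= PP subrr.
  by rewrite /= (linearZ_LR P) PG scaler0 subr0.
by rewrite linearB /= GP subr0 ipBl P_sym -ipBr ipZl ipZr G_sym.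
Qed.

Lemma resolvent_graph_nonneg : nonnegative_operator A.
Proof.
move=> [x y] [/= xy Py].
have -> : ip y x = ip y (x - P x) by rewrite ipBr -P_sym Py ipC (ipC 0) ip0 subr0.
by rewrite xy ipZr mulr_ge0 ?(ltW c_gt0)// ipC.
Qed.

Lemma resolvent_graph_dense : dense (domain A).
Proof.
move=> O [x Ox] oO.
have /nbhs_normP[e e0 xO] : nbhs x O by exact: open_nbhs_nbhs.
have e2 : 0 < e / 2 by rewrite divr_gt0.
have PxP : P (x - P x) = 0 by rewrite linearB /= PP subrr.
(* [P x] already lies in the domain; only [x - P x] has to be approximated. *)
have [z hz] := G_range_dense PxP e2.
exists (P x + G z); split.
  apply: xO => /=; rewrite opprD addrA (le_lt_trans hz)//.
  by rewrite ltr_pdivrMr// ltr_pMr// ltr1n.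
exists (c^-1 *: (z - P z)); split => /=.
  rewrite linearD /= PP PG addr0 addrC addKr linearZ /= scalerA mulfV ?gt_eqF//.
  by rewrite scale1r linearB /= GP subr0.
by rewrite linearZ /= linearB /= PP subrr scaler0.
Qed.

(** Meant for p, q = f u, f v and r, s = g u, g v: the cross terms in the norm of (f + i g)(u + i v)
    cancel because [f] and [g] are symmetric and commute. *)
Lemma L2_rotation_norm (p q r s : H) : ip p s = ip q r ->
  ip (p - s) (p - s) + ip (q + r) (q + r) = ip p p + ip r r + (ip q q + ip s s).
Proof.
move=> e; have NL x y : ip (- x) y = - ip x y by rewrite ipC ipNr ipC.
by rewrite !(ipDl, ipDr, ipNr, NL) (ipC s p) (ipC r q) e; ring.
Qed.

(* Locked, because unification would otherwise unfold the limits it hides. *)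
Fact phi_key : unit. Proof. by []. Qed.
Definition phi : (R -> R) -> H -> H := locked_with phi_key
  (fun f x => if `[< cont01 f >] then fcalc G f x else 0).

Lemma phi_unlock f x : phi f x = if `[< cont01 f >] then fcalc G f x else 0.
Proof. by rewrite /phi unlock. Qed.

Let bn := @L2_normE _ _ _ mu.

Lemma phiE f x : cont01 f -> phi f x = fcalc G f x.
Proof. by move=> /asboolP cf; rewrite phi_unlock cf. Qed.

Lemma phi_linear f : linear (phi f).
Proof.
move=> a x y; rewrite !phi_unlock; case: asboolP => [cf|_].
  exact: (fcalc_lin bC bD bZ bn G_sym G_ge0 G_le1 H_complete).
by rewrite scaler0 addr0.
Qed.

Lemma phi_norm f M x : cont01 f -> (forall s, 0 <= s <= 1 -> `|f s| <= M) ->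
  `|phi f x| <= M * `|x|.
Proof.
move=> cf fM; rewrite phiE//.
exact: (fcalc_norm bC bD bZ bn G_sym G_ge0 G_le1 H_complete).
Qed.

Lemma phiD f g x : cont01 f -> cont01 g ->
  phi (fun s => f s + g s) x = phi f x + phi g x.
Proof.
move=> cf cg; rewrite !phiE//; last by move=> s; apply: cvgD; [exact: cf|exact: cg].
exact: (fcalcD bC bD bZ bn G_sym G_ge0 G_le1 H_complete).
Qed.

Lemma cont01Z f (k : R) : cont01 f -> cont01 (fun s => k * f s).
Proof. by move=> cf s; apply: cvgMr; exact: cf. Qed.

Lemma cont01D f g : cont01 f -> cont01 g -> cont01 (fun s => f s + g s).
Proof. by move=> cf cg s; apply: cvgD; [exact: cf|exact: cg]. Qed.

Lemma cont01B f g : cont01 f -> cont01 g -> cont01 (fun s => f s - g s).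
Proof. by move=> cf cg s; apply: cvgB; [exact: cf|exact: cg]. Qed.

Lemma cont01_horner (p : {poly R}) : cont01 (horner p).
Proof. by apply: continuous_subspaceT; exact: continuous_horner. Qed.

Lemma cont01_cst (k : R) : cont01 (fun=> k).
Proof. by move=> s; exact: cvg_cst. Qed.

Lemma phiZ f (k : R) x : cont01 f -> phi (fun s => k * f s) x = k *: phi f x.
Proof.
move=> cf; rewrite !phiE//; last exact: cont01Z.
exact: (fcalcZ bC bD bZ bn G_sym G_ge0 G_le1 H_complete).
Qed.

Lemma phiB f g x : cont01 f -> cont01 g ->
  phi (fun s => f s - g s) x = phi f x - phi g x.
Proof.
move=> cf cg; rewrite !phiE//; last exact: cont01B.
exact: (fcalcB bC bD bZ bn G_sym G_ge0 G_le1 H_complete).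
Qed.

Lemma phiM f g x : cont01 f -> cont01 g ->
  phi (fun s => f s * g s) x = phi f (phi g x).
Proof.
move=> cf cg; rewrite !phiE//; last exact: cont01M.
exact: (fcalcM bC bD bZ bn G_sym G_ge0 G_le1 H_complete).
Qed.

Lemma phi_sym f x y : ip (phi f x) y = ip x (phi f y).
Proof.
rewrite !phi_unlock; case: asboolP => [cf|_]; last by rewrite ipC !ip0.
exact: (fcalc_sym bC bD bZ bn G_sym G_ge0 G_le1 H_complete).
Qed.

Lemma phi_poly (p : {poly R}) x : phi (horner p) x = pcalc G p x.
Proof.
rewrite phiE; last exact: cont01_horner.
exact: (fcalc_poly bC bD bZ bn G_sym G_ge0 G_le1 H_complete).
Qed.

Lemma phi_id x : phi (fun s => s) x = G x.
Proof.
rewrite -(pcalcX G) -phi_poly; congr phi.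
by apply/funext => s; rewrite hornerX.
Qed.

Lemma cont01_id : cont01 (fun s : R => s).
Proof.
rewrite (_ : (fun s => s) = horner 'X); first exact: cont01_horner.
by apply/funext => s; rewrite hornerX.
Qed.

Lemma phi_cst (k : R) x : phi (fun=> k) x = k *: x.
Proof.
rewrite -(pcalcC G) -phi_poly; congr phi.
by apply/funext => s; rewrite hornerC.
Qed.

Lemma phi_comm f x : cont01 f -> G (phi f x) = phi f (G x).
Proof.
move=> cf; rewrite -!phi_id -!phiM//; try exact: cont01_id.
by congr phi; apply/funext => s; rewrite mulrC.
Qed.

Lemma phiP f x : cont01 f -> f 0 = 0 -> phi f (P x) = 0.
Proof.
move=> cf f0; rewrite phiE//.
by rewrite (fcalc_ker bC bD bZ bn G_sym G_ge0 G_le1 H_complete)// f0 scale0r.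
Qed.

Lemma Pphi f x : cont01 f -> f 0 = 0 -> P (phi f x) = 0.
Proof.
by move=> cf f0; apply: ip_inj => w; rewrite -P_sym -phi_sym phiP// ip0 ipC ip0.
Qed.

Lemma phi_sub f x y : phi f (x - y) = phi f x - phi f y.
Proof. by rewrite -scaleN1r addrC phi_linear scaleN1r addrC. Qed.

Lemma phi_add f x y : phi f (x + y) = phi f x + phi f y.
Proof. by have := phi_linear f 1 x y; rewrite !scale1r. Qed.

(** * The semigroup: contractivity, semigroup law, continuity at 0 and analyticity *)

Implicit Types (z h : R[i]) (p : R).

(* [heat p z] is the real or imaginary part of [exp(- z / (c s))], for [p = 0]
   or [p = pi / 2], as a function of the spectral variable [s] of [G]. *)
Definition heat (p : R) (z : R[i]) : R -> R := at_inv c (wave p (Re z) (Im z)).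

Lemma cont01_heat p z : 0 < Re z -> cont01 (heat p z).
Proof. by move=> z0; exact: cont01_wave. Qed.

Lemma heat0 p z : heat p z 0 = 0.
Proof. by rewrite /heat /at_inv eqxx. Qed.

(** [heat] vanishes at s = 0 and so annihilates the kernel of [G], where the exponential must be 1.
    The summand [P] supplies this value, which is real and therefore absent from [semigroup_im]. *)
Definition semigroup_re z x := P x + phi (heat 0 z) x.
Definition semigroup_im z x := phi (heat (pi / 2) z) x.

Lemma semigroup_re_linear z : linear (semigroup_re z).
Proof.
move=> a x y; rewrite /semigroup_re linearP phi_linear /=.
by rewrite scalerDr addrACA.
Qed.

(** The default branch is the identity, the value prescribed at [z = 0]. *)
Definition semigroup z : {linear HC -> HC} :=
  if 0 < Re z then
    linear_pack (complex_op_linear (semigroup_re_linear z)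
      (phi_linear (heat (pi / 2) z)))
  else linear_pack (fun (a : R[i]) (x y : HC) => erefl (a *: x + y)).

Lemma semigroupE z (x : HC) : 0 < Re z ->
  semigroup z x = complex_op (semigroup_re z) (semigroup_im z) x.
Proof. by rewrite /semigroup => ->. Qed.

Lemma heat_le1 z s : 0 < Re z -> 0 <= s ->
  0 <= heat 0 z s ^+ 2 + heat (pi / 2) z s ^+ 2 <= 1.
Proof.
move=> z0 s0; rewrite addr_ge0 ?sqr_ge0//= /heat /at_inv.
have [_|sn0] := eqVneq s 0; first by rewrite expr0n addr0 ler01.
rewrite wave_sqr expr_le1// ?expR_ge0// -expR0 ler_expR oppr_le0.
by rewrite mulr_ge0 ?(ltW z0)// invr_ge0 mulr_ge0// ltW.
Qed.

(** The operator is the identity on the range of [P]. On the orthogonal complement, the squared norm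
    is the quadratic form of the calculus at f^2 + g^2, which is exp(- 2 t / (c s)) <= 1 with t = Re
    z. *)
Lemma semigroup_contractive z (x : HC) : 0 < Re z -> `|semigroup z x| <= `|x|.
Proof.
move=> z0; rewrite semigroupE// -[leRHS]mul1r.
apply: (@le_L2C_norm _ _ _ _ _ _ 1) => //.
rewrite expr1n mul1r /complex_op /semigroup_re /semigroup_im /=.
set f := heat 0 z; set g := heat _ z.
have cf : cont01 f by exact: cont01_heat.
have cg : cont01 g by exact: cont01_heat.
have f0 : f 0 = 0 by exact: heat0.
have g0 : g 0 = 0 by exact: heat0.
have red (k : R -> R) u : cont01 k -> k 0 = 0 -> phi k u = phi k (u - P u).
  by move=> ck k0; rewrite phi_sub phiP// subr0.
have pyth u w : P w = 0 -> `|P u + w| ^+ 2 = `|P u| ^+ 2 + `|w| ^+ 2.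
  move=> Pw; have e : ip (P u) w = 0 by rewrite P_sym Pw ip0.
  by rewrite -!L2_normE !(ipDl, ipDr) (ipC w (P u)) e addr0 add0r.
case: x => u v /=.
have -> : P u + phi f u - phi g v = P u + (phi f u - phi g v) by rewrite addrA.
have -> : P v + phi f v + phi g u = P v + (phi f v + phi g u) by rewrite addrA.
rewrite (pyth u (phi f u - phi g v)); last by rewrite linearB /= !Pphi// subr0.
rewrite (pyth v (phi f v + phi g u)); last by rewrite linearD /= !Pphi// addr0.
have split_norm w : `|w| ^+ 2 = `|P w| ^+ 2 + `|w - P w| ^+ 2.
  rewrite -pyth; first by rewrite addrC subrK.
  by rewrite linearB /= PP subrr.
rewrite (split_norm u) (split_norm v) addrACA [leRHS]addrACA lerD2l.
rewrite (red f u)// (red f v)// (red g u)// (red g v)//; set u' := u - _; set v' := v - _.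
pose m s := f s * f s + g s * g s.
have cm : cont01 m by apply: cont01D; exact: cont01M.
have mE w : ip (phi m w) w = ip (phi f w) (phi f w) + ip (phi g w) (phi g w).
  have -> : phi m w = phi f (phi f w) + phi g (phi g w).
    by rewrite -!phiM// -phiD//; exact: cont01M.
  by rewrite ipDl; congr (_ + _); exact: phi_sym.
have m1 w : ip (phi m w) w <= `|w| ^+ 2.
  rewrite (le_trans (ler_norm _))// (le_trans (ip_le_norm _ _))// expr2.
  rewrite ler_wpM2r// -[leRHS]mul1r; apply: phi_norm => // s /andP[s0 _].
  by have := heat_le1 z0 s0; rewrite !expr2 => /andP[h0 h1]; rewrite ger0_norm.
apply: le_trans (lerD (m1 u') (m1 v')); rewrite (mE u') (mE v').
have e : ip (phi f u') (phi g v') = ip (phi f v') (phi g u').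
  transitivity (ip u' (phi (fun s => f s * g s) v')).
    by rewrite (phiM v' cf cg); exact: phi_sym.
  transitivity (ip (phi (fun s => f s * g s) u') v'); first exact: esym (phi_sym _ _ _).
  transitivity (ip (phi f (phi g u')) v'); first by rewrite (phiM u' cf cg).
  by transitivity (ip (phi g u') (phi f v')); [exact: phi_sym|exact: ipC].
move: (phi f u') (phi f v') (phi g u') (phi g v') e => p q r s e.
by rewrite -!L2_normE (L2_rotation_norm e).
Qed.

Lemma heat_add_re (z z' : R[i]) s : heat 0 (z + z') s =
  heat 0 z s * heat 0 z' s - heat (pi / 2) z s * heat (pi / 2) z' s.
Proof.
rewrite /heat /at_inv; case: ifP => _; first by rewrite !mul0r subrr.
case: z z' => a b [a' b'] /=.
by have := waveM 0 0 a b a' b'; rewrite !add0r.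
Qed.

Lemma heat_add_im (z z' : R[i]) s : heat (pi / 2) (z + z') s =
  heat 0 z s * heat (pi / 2) z' s + heat (pi / 2) z s * heat 0 z' s.
Proof.
rewrite /heat /at_inv; case: ifP => _; first by rewrite !mul0r addr0.
case: z z' => a b [a' b'] /=.
have := waveM 0 (pi / 2) a b a' b'; rewrite !add0r => ->.
rewrite -splitr (_ : wave pi _ _ _ = - wave 0 a' b' (c * s)^-1).
  by rewrite mulrN opprK.
by rewrite -wave_pi add0r.
Qed.

Lemma semigroup_add (z z' : R[i]) (x : HC) : 0 < Re z -> 0 < Re z' ->
  semigroup (z + z') x = semigroup z (semigroup z' x).
Proof.
move=> z0 z'0.
have zz'0 : 0 < Re (z + z') by case: z z' z0 z'0 => ? ? [? ?]; exact: addr_gt0.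
rewrite (semigroupE _ z0) (semigroupE _ z'0) (semigroupE _ zz'0).
have c0 := @cont01_heat 0 z z0; have c1 := @cont01_heat (pi / 2) z z0.
have d0 := @cont01_heat 0 z' z'0; have d1 := @cont01_heat (pi / 2) z' z'0.
have re u : phi (heat 0 (z + z')) u = phi (heat 0 z) (phi (heat 0 z') u)
    - phi (heat (pi / 2) z) (phi (heat (pi / 2) z') u).
  rewrite -(phiM u c0 d0) -(phiM u c1 d1) -(phiB u (cont01M c0 d0) (cont01M c1 d1)).
  by congr phi; apply/funext => s; exact: heat_add_re.
have im u : phi (heat (pi / 2) (z + z')) u = phi (heat 0 z) (phi (heat (pi / 2) z') u)
    + phi (heat (pi / 2) z) (phi (heat 0 z') u).
  rewrite -(phiM u c0 d1) -(phiM u c1 d0) -(phiD u (cont01M c0 d1) (cont01M c1 d0)).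
  by congr phi; apply/funext => s; exact: heat_add_im.
case: x => u v; rewrite /complex_op /semigroup_re /semigroup_im /= !re !im.
set A := P u + phi (heat 0 z') u - phi (heat (pi / 2) z') v.
set B := P v + phi (heat 0 z') v + phi (heat (pi / 2) z') u.
have P_sub x y : P (x - y) = P x - P y by exact: linearB.
have P_add x y : P (x + y) = P x + P y by exact: linearD.
have PA : P A = P u.
  rewrite /A P_sub P_add PP (Pphi u d0 (heat0 _ _)).
  by rewrite (Pphi v d1 (heat0 _ _)) addr0 subr0.
have PB : P B = P v.
  rewrite /B !P_add PP (Pphi v d0 (heat0 _ _)).
  by rewrite (Pphi u d1 (heat0 _ _)) !addr0.
have kA p (h : cont01 (heat p z)) : phi (heat p z) A =
    phi (heat p z) (phi (heat 0 z') u) - phi (heat p z) (phi (heat (pi / 2) z') v).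
  by rewrite /A phi_sub phi_add (phiP u h (heat0 _ _)) add0r.
have kB p (h : cont01 (heat p z)) : phi (heat p z) B =
    phi (heat p z) (phi (heat 0 z') v) + phi (heat p z) (phi (heat (pi / 2) z') u).
  by rewrite /B !phi_add (phiP v h (heat0 _ _)) add0r.
rewrite PA PB (kA _ c0) (kA _ c1) (kB _ c0) (kB _ c1).
have alg1 (a b e f g : H) : a + (b - e) - (f + g) = a + (b - f) - (g + e).
  by apply: ip_inj => w; rewrite !(ipDr, ipNr); ring.
have alg2 (a b e f g : H) : a + (b - e) + (f + g) = a + (b + f) + (g - e).
  by apply: ip_inj => w; rewrite !(ipDr, ipNr); ring.
by congr pair; [exact: alg1|exact: alg2].
Qed.

(** The family is uniformly bounded, so vectors [G y'] suffice, which are dense in the kernel of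
    [P]. There the factor [s] turns the Lipschitz bound w (t + |tau|) into (t + |tau|) / c. *)
Lemma phi_heat_cvg (F : set_system R[i]) {FF : Filter F} (p : R) y : P y = 0 ->
  (\forall z \near F, 0 < Re z) -> Re z @[z --> F] --> 0 -> Im z @[z --> F] --> 0 ->
  phi (heat p z) y @[z --> F] --> cos p *: y.
Proof.
move=> Py0 F0 /cvgrPdist_le FRe /cvgrPdist_le FIm; apply/cvgrPdist_le => e e0.
have e3 : 0 < e / 4 by rewrite divr_gt0.
have [y' yy'] := G_range_dense Py0 e3.
(* Makes 2 r / c times the norm of [y'] at most [e / 2]; the summand 1 covers [y' = 0]. *)
pose r := e / 4 / (`|y'| + 1) * c.
have y'1 : 0 < `|y'| + 1 by rewrite ltr_pwDr.
have r0 : 0 < r by rewrite /r !(divr_gt0, mulr_gt0).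
near=> z.
have z0 : 0 < Re z by near: z.
have zr : `|Re z| <= r by rewrite -[Re z]opprK normrN -sub0r; near: z; exact: FRe.
have zi : `|Im z| <= r by rewrite -[Im z]opprK normrN -sub0r; near: z; exact: FIm.
have ch := @cont01_heat p z z0.
pose m s := heat p z s - cos p.
have cm : cont01 m by apply: cont01B => //; exact: cont01_cst.
have cms : cont01 (fun s => m s * s) by apply: cont01M => //; exact: cont01_id.
have -> : cos p *: y - phi (heat p z) y = - (phi m (y - G y') + phi (fun s => m s * s) y').
  rewrite (phiM _ cm cont01_id) phi_id -phi_add subrK.
  by rewrite /m phiB ?phi_cst ?opprB//; exact: cont01_cst.
rewrite normrN (le_trans (ler_normD _ _))//.
have cosp : `|cos p| <= 1 by rewrite ler_norml cos_geN1 cos_le1.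
have h1 : `|phi m (y - G y')| <= 2 * (e / 4).
  rewrite (@le_trans _ _ (2 * `|y - G y'|)) ?ler_wpM2l//.
  apply: phi_norm => // s /andP[s0 _].
  rewrite /m (le_trans (ler_normB _ _))// (_ : 2 = 1 + 1)// lerD//.
  rewrite /heat /at_inv; case: eqVneq => [_|sn0]; first by rewrite normr0.
  rewrite (le_trans (wave_norm _ _ _ _))// -expR0 ler_expR oppr_le0.
  by rewrite mulr_ge0 ?(ltW z0)// invr_ge0 mulr_ge0// ltW.
have h2 : `|phi (fun s => m s * s) y'| <= (Re z + `|Im z|) / c * `|y'|.
  apply: phi_norm => // s /andP[s0 _].
  rewrite /m /heat /at_inv; case: eqVneq => [->|sn0].
    by rewrite mulr0 normr0 divr_ge0 ?addr_ge0// ltW.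
  have {s0}sp : 0 < s by rewrite lt_neqAle eq_sym sn0.
  rewrite normrM (gtr0_norm sp) -ler_pdivlMr//.
  apply: le_trans (wave_lipschitz _ _ (ltW z0) _) _; first by rewrite invr_gt0 mulr_gt0.
  by rewrite invfM mulrC mulrA.
have h3 : (Re z + `|Im z|) / c * `|y'| <= 2 * (e / 4).
  apply: (@le_trans _ _ ((r + r) / c * `|y'|)).
    rewrite ler_wpM2r// ler_wpM2r ?invr_ge0 ?(ltW c_gt0)// lerD//.
    by rewrite (le_trans (ler_norm _)).
  rewrite /r -mulrDl mulfK ?gt_eqF// -mulrDl mulrAC ler_pdivrMr//.
  have := normr_ge0 y'; move: (`|y'|) => Y Y0; nra.
lra.
Unshelve. all: by end_near. Qed.

Lemma semigroup_cvg0 (F : set_system R[i]) {FF : Filter F} (x : HC) :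
  (\forall z \near F, 0 < Re z) -> Re z @[z --> F] --> 0 -> Im z @[z --> F] --> 0 ->
  semigroup z x @[z --> F] --> x.
Proof.
move=> F0 FRe FIm; case: x => u v.
have Q w : P (w - P w) = 0 by rewrite linearB /= PP subrr.
have cvg p w := @phi_heat_cvg F FF p _ (Q w) F0 FRe FIm.
have near_eq (f g : R[i] -> H) (l : H) : (forall z, 0 < Re z -> f z = g z) ->
    g z @[z --> F] --> l -> f z @[z --> F] --> l.
  move=> fg; apply: cvg_trans; apply: near_eq_cvg.
  by apply: filterS F0 => z z0; rewrite fg.
have red p z w : 0 < Re z -> phi (heat p z) w = phi (heat p z) (w - P w).
  by move=> z0; rewrite phi_sub phiP ?subr0 ?heat0//; exact: cont01_heat.
apply/L2C_cvgP; split.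
  apply: (near_eq (fun z => (semigroup z (u, v)).1) (fun z => P u + phi (heat 0 z) (u - P u) - phi (heat (pi / 2) z) (v - P v))).
    by move=> z z0; rewrite semigroupE// /complex_op /= /semigroup_re /semigroup_im (red _ z u)// (red _ z v)//.
  rewrite [X in _ --> X](_ : u = P u + cos 0 *: (u - P u) - cos (pi / 2) *: (v - P v)).
    by apply: cvgB => //; apply: cvgD => //; exact: cvg_cst.
  by rewrite cos0 cos_pihalf scale1r scale0r subr0 addrC subrK.
apply: (near_eq (fun z => (semigroup z (u, v)).2) (fun z => P v + phi (heat 0 z) (v - P v) + phi (heat (pi / 2) z) (u - P u))).
  by move=> z z0; rewrite semigroupE// /complex_op /= /semigroup_re /semigroup_im (red _ z u)// (red _ z v)//.
rewrite [X in _ --> X](_ : v = P v + cos 0 *: (v - P v) + cos (pi / 2) *: (u - P u)).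
  by apply: cvgD => //; apply: cvgD => //; exact: cvg_cst.
by rewrite cos0 cos_pihalf scale1r scale0r addr0 addrC subrK.
Qed.

(* The two components of the derivative [- (c s)^-1 * exp(- z / (c s))]. *)
Definition dheat (p : R) (z : R[i]) : R -> R :=
  at_inv c (fun w : R => w * wave (p + pi) (Re z) (Im z) w).

Lemma cont01_dheat p z : 0 < Re z -> cont01 (dheat p z).
Proof. by move=> z0; exact: cont01_wave'. Qed.

Lemma heat_taylor p (z h : R[i]) s : 0 < Re z -> `|Re h| <= Re z / 2 -> 0 <= s ->
  `|heat p (z + h) s - heat p z s
    - (Re h * dheat p z s - Im h * dheat (p + pi / 2) z s)|
  <= (`|Re h| + `|Im h|) ^+ 2 * (16 / Re z ^+ 2).
Proof.
case: z h => t tau [al be] /= t0 alt s0; rewrite /heat /dheat /at_inv /=.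
have [_|sn0] := eqVneq s 0.
  rewrite !mulr0 !subr0 normr0 mulr_ge0 ?exprn_ge0 ?addr_ge0//.
  by rewrite divr_ge0// exprn_ge0// ltW.
have w0 : 0 < (c * s)^-1 by rewrite invr_gt0 mulr_gt0// lt_neqAle eq_sym sn0.
have := wave_taylor p tau be t0 w0 alt; rewrite !wave_pi; move: (c * s)^-1 => om.
by congr (`| _ | <= _); ring.
Qed.

Lemma Re_add_gt0 z h : 0 < Re z -> `|Re h| <= Re z / 2 -> 0 < Re (z + h).
Proof.
case: z h => t tau [al be] /= t0 alt.
by have := ler_norm (- al); rewrite normrN; lra.
Qed.

Definition remainder (p : R) (z h : R[i]) u : H :=
  phi (heat p (z + h)) u - phi (heat p z) u
  - (Re h *: phi (dheat p z) u - Im h *: phi (dheat (p + pi / 2) z) u).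

Lemma remainder_norm p (z h : R[i]) u : 0 < Re z -> `|Re h| <= Re z / 2 ->
  `|remainder p z h u| <= (`|Re h| + `|Im h|) ^+ 2 * (16 / Re z ^+ 2) * `|u|.
Proof.
move=> z0 hz.
have zh0 := Re_add_gt0 z0 hz.
have c1 := @cont01_heat p _ zh0; have c2 := @cont01_heat p _ z0.
have c3 := @cont01Z _ (Re h) (@cont01_dheat p _ z0).
have c4 := @cont01Z _ (Im h) (@cont01_dheat (p + pi / 2) _ z0).
rewrite /remainder -(phiB u c1 c2).
rewrite -(phiZ (Re h) u (@cont01_dheat p _ z0)).
rewrite -(phiZ (Im h) u (@cont01_dheat (p + pi / 2) _ z0)).
rewrite -(phiB u c3 c4) -(phiB u (cont01B c1 c2) (cont01B c3 c4)).
apply: phi_norm => [|s /andP[s0 _]].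
  by apply: cont01B; exact: cont01B.
exact: heat_taylor.
Qed.

Definition semigroup_deriv z : {linear HC -> HC} :=
  linear_pack (complex_op_linear (phi_linear (dheat 0 z))
    (phi_linear (dheat (pi / 2) z))).

(** The two real remainders recombine into a complex linear one because the phase pi / 2 + pi / 2
    changes the sign of [dheat 0]. These are the Cauchy-Riemann equations. *)
Lemma semigroup_remainder (z h : R[i]) (x : HC) : 0 < Re z -> 0 < Re (z + h) ->
  semigroup (z + h) x - semigroup z x - h *: semigroup_deriv z x =
  complex_op (remainder 0 z h) (remainder (pi / 2) z h) x.
Proof.
move=> z0 zh0; rewrite (semigroupE _ z0) (semigroupE _ zh0).
have dpi u : phi (dheat (pi / 2 + pi / 2) z) u = - phi (dheat 0 z) u.
  rewrite -scaleN1r -(phiZ (-1) u (@cont01_dheat 0 _ z0)); congr phi.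
  apply/funext => s; rewrite /dheat /at_inv; case: ifP => _; rewrite ?mulr0//.
  by rewrite -splitr wave_pi -[pi in wave pi]add0r !mulN1r mulrN.
rewrite /= /complex_op /remainder /semigroup_re /semigroup_im.
case: h zh0 => al be zh0 /=; rewrite L2C_scaleE /= !add0r !dpi.
have alg1 (a b b' e e' f f' g g' : H) :
  a + b - e - (a + b' - e') - (al *: (f - g) - be *: (f' + g')) =
  b - b' - (al *: f - be *: g') - (e - e' - (al *: g - be *: - f')).
  by apply: ip_inj => w; rewrite !(ipDr, ipNr, ipZr, scalerN, scaleNr); ring.
have alg2 (a b b' e e' f f' g g' : H) :
  a + b + e - (a + b' + e') - (al *: (f' + g') + be *: (f - g)) =
  b - b' - (al *: f' - be *: g) + (e - e' - (al *: g' - be *: - f)).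
  by apply: ip_inj => w; rewrite !(ipDr, ipNr, ipZr, scalerN, scaleNr); ring.
by congr pair; [exact: alg1|exact: alg2].
Qed.

Lemma sector_Re_gt0 z : sector (pi / 2) z -> 0 < Re z.
Proof.
move=> [r [th [r0 + ->]]] /=; rewrite ltr_norml => /andP[h1 h2].
by rewrite mulr_gt0// cos_gt0_pihalf// h1.
Qed.

Lemma semigroup_analytic : operator_analytic (sector (pi / 2 : R)) semigroup.
Proof.
move=> z /sector_Re_gt0 z0; exists (semigroup_deriv z).
  have [M0 M00 h0] := cont01_bounded (@cont01_dheat 0 _ z0).
  have [M1 M10 h1] := cont01_bounded (@cont01_dheat (pi / 2) _ z0).
  have M4 : 0 <= (4 * (M0 + M1))%:C :> R[i] by rewrite lecR mulr_ge0// addr_ge0.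
  have bnd (x : HC) : `|semigroup_deriv z x| <= (4 * (M0 + M1))%:C * `|x|.
    apply: complex_op_norm => [|y|y]; first by rewrite addr_ge0.
      apply: phi_norm => [|s s01]; first exact: cont01_dheat.
      by rewrite (le_trans (h0 _ s01))// lerDl.
    apply: phi_norm => [|s s01]; first exact: cont01_dheat.
    by rewrite (le_trans (h1 _ s01))// lerDr.
  exact: (norm_le_linear_continuous M4 bnd).
move=> e e0.
pose K := 16 / Re z ^+ 2.
have K0 : 0 < K by rewrite divr_gt0// exprn_gt0.
have nb (r : R) : 0 < r -> \forall h \near (0 : R[i]^o)^', `|h| <= r%:C.
  by move=> r0; apply: (@dnbhs0_le R[i] R[i]^o); rewrite ltcR.
near=> h => x.
have h0 : h != 0 by near: h; exact: (@nbhs_dnbhs_neq R[i]^o 0).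
have hz : `|h| <= (Re z / 2)%:C by near: h; apply: nb; rewrite divr_gt0.
(* The remainder is at most 4 (2 r)^2 K = 16 K r^2 times the norm of [x]: the 4 comes from
   [complex_op_norm], and 2 r bounds |Re h| + |Im h|. *)
have he : `|h| <= (e / (16 * K))%:C by near: h; apply: nb; rewrite divr_gt0// mulr_gt0.
pose r := Num.sqrt (Re h ^+ 2 + Im h ^+ 2).
have hr : `|h| = r%:C by rewrite normc_def.
have reh : `|Re h| <= r by rewrite -sqrtr_sqr ler_wsqrtr// lerDl sqr_ge0.
have imh : `|Im h| <= r by rewrite -sqrtr_sqr ler_wsqrtr// lerDr sqr_ge0.
rewrite hr lecR in hz; rewrite hr lecR in he.
have rehz := le_trans reh hz.
have zh0 := Re_add_gt0 z0 rehz.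
rewrite (_ : _ - semigroup_deriv z x = h^-1 *: (semigroup (z + h) x - semigroup z x
    - h *: semigroup_deriv z x)); last first.
  by rewrite [RHS]scalerBr scalerA mulVf// scale1r.
rewrite normrZ normfV ler_pdivrMl ?normr_gt0//.
rewrite (semigroup_remainder x z0 zh0) hr.
have r0 : 0 <= r by exact: sqrtr_ge0.
apply: (@le_trans _ _ ((4 * ((2 * r) ^+ 2 * K))%:C * `|x|)).
  have rr p u : `|remainder p z h u| <= (2 * r) ^+ 2 * K * `|u|.
    rewrite (le_trans (remainder_norm p u z0 rehz))// ler_wpM2r// ler_wpM2r ?(ltW K0)//.
    rewrite ler_pXn2r ?nnegrE ?addr_ge0 ?mulr_ge0//.
    by move: reh imh; lra.
  by apply: complex_op_norm => //; rewrite mulr_ge0 ?sqr_ge0// ltW.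
rewrite [leRHS]mulrA; apply: ler_wpM2r => //; rewrite -rmorphM lecR.
have k16 : 0 < 16 * K by rewrite mulr_gt0.
move: he; rewrite (ler_pdivlMr _ _ k16) => he.
by have := ler_wpM2l r0 he; move: (K) (r) => k q; lra.
Unshelve. all: by end_near. Qed.

(** * The generator of the semigroup *)

Lemma expRN_quadratic r : 0 <= r -> 0 <= expR (- r) - 1 + r <= r ^+ 2.
Proof.
move=> r0; apply/andP; split; first by have := expR_ge1Dx (- r); lra.
have r1 : 0 < 1 + r by rewrite ltr_pwDl.
have : expR (- r) <= (1 + r)^-1.
  by rewrite expRN lef_pV2 ?posrE ?expR_gt0// expR_ge1Dx.
have : (1 + r)^-1 <= 1 - r + r ^+ 2.
  rewrite -[leLHS]mul1r ler_pdivrMr// (_ : _ * _ = 1 + r ^+ 3); last by ring.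
  by rewrite lerDl exprn_ge0.
lra.
Qed.

(** The quotient is the calculus at q s = (exp(- t / (c s)) - 1) s / t, bounded by 1 / c uniformly
    in [t]. On vectors [G y'] a further factor [s] makes the error at most t / c^2; density gives
    the rest. *)
Lemma heat_difference_quotient (y : H) : P y = 0 ->
  t^-1 *: (phi (heat 0 t%:C) (G y) - G y) @[t --> (0 : R)^'+] --> - c^-1 *: y.
Proof.
move=> Py0; apply/cvgrPdist_le => e e0.
have ci : 0 < c^-1 by rewrite invr_gt0.
have e4 : 0 < e / 4 * c by rewrite mulr_gt0// divr_gt0.
have [y' yy'] := G_range_dense Py0 e4.
have y'1 : 0 < `|y'| + 1 by rewrite ltr_pwDr.
have d0 : 0 < e / 4 / (`|y'| + 1) * c ^+ 2 by rewrite mulr_gt0 ?exprn_gt0// !divr_gt0.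
near=> t.
have t0 : 0 < t by near: t; exact: nbhs_right_gt.
have td : t <= e / 4 / (`|y'| + 1) * c ^+ 2 by near: t; exact: nbhs_right_le.
have ch := @cont01_heat 0 t%:C t0.
pose q s := t^-1 * ((heat 0 t%:C s - 1) * s).
have c1 : cont01 (fun s => heat 0 t%:C s - 1) by apply: cont01B => //; exact: cont01_cst.
have c2 : cont01 (fun s => (heat 0 t%:C s - 1) * s) by apply: cont01M => //; exact: cont01_id.
have cq : cont01 q by exact: cont01Z.
have cqc : cont01 (fun s => q s + c^-1) by apply: cont01D => //; exact: cont01_cst.
have cqcs : cont01 (fun s => (q s + c^-1) * s) by apply: cont01M => //; exact: cont01_id.
have qE : t^-1 *: (phi (heat 0 t%:C) (G y) - G y) = phi q y.
  rewrite (phiZ _ _ c2) (phiM _ c1 cont01_id) phi_id (phiB _ ch (@cont01_cst 1)).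
  by rewrite phi_cst scale1r.
rewrite qE distrC.
have -> : phi q y - - c^-1 *: y = phi (fun s => q s + c^-1) (y - G y')
    + phi (fun s => (q s + c^-1) * s) y'.
  rewrite (phiM _ cqc cont01_id) phi_id -phi_add subrK.
  by rewrite (phiD _ cq (@cont01_cst c^-1)) phi_cst scaleNr opprK.
have qs s : 0 < s -> q s = t^-1 * ((expR (- (t * (c * s)^-1)) - 1) * s).
  move=> s0; rewrite /q /heat /at_inv gt_eqF// /wave /= mul0r addr0 cos0 mulr1.
  by [].
have b1 s : 0 <= s <= 1 -> `|q s + c^-1| <= 2 * c^-1.
  move=> /andP[s0 _]; rewrite (le_trans (ler_normD _ _))// (gtr0_norm ci).
  rewrite (_ : 2 * c^-1 = c^-1 + c^-1); last by ring.
  rewrite lerD2r; move: s0; rewrite le_eqVlt => /predU1P[<-|s0].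
    by rewrite /q !mulr0 normr0 ltW.
  have w0 : 0 < (c * s)^-1 by rewrite invr_gt0 mulr_gt0.
  have tw0 : 0 <= t * (c * s)^-1 by rewrite ltW// mulr_gt0.
  have h1 : expR (- (t * (c * s)^-1)) <= 1 by rewrite -expR0 ler_expR oppr_le0.
  have /andP[h2 _] := expRN_quadratic tw0.
  rewrite qs// normrM (gtr0_norm (x := t^-1)) ?invr_gt0// normrM (gtr0_norm s0).
  rewrite ler0_norm ?subr_le0// ler_pdivrMl//.
  apply: (@le_trans _ _ (t * (c * s)^-1 * s)).
    by rewrite ler_wpM2r ?(ltW s0)//; lra.
  by rewrite invfM -!mulrA mulVf ?gt_eqF// mulr1.
have b2 s : 0 <= s <= 1 -> `|(q s + c^-1) * s| <= t / c ^+ 2.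
  move=> /andP[s0 _]; move: s0; rewrite le_eqVlt => /predU1P[<-|s0].
    by rewrite !mulr0 normr0 divr_ge0 ?(ltW t0)// exprn_ge0// ltW.
  have tw0 : 0 <= t * (c * s)^-1 by rewrite ltW// mulr_gt0// invr_gt0 mulr_gt0.
  have /andP[h2 h3] := expRN_quadratic tw0.
  have -> : (q s + c^-1) * s = s ^+ 2 / t * (expR (- (t * (c * s)^-1)) - 1 + t * (c * s)^-1).
    by rewrite qs//; field; rewrite !gt_eqF.
  rewrite ger0_norm; last by rewrite mulr_ge0// divr_ge0 ?exprn_ge0 ?ltW.
  have -> : t / c ^+ 2 = s ^+ 2 / t * (t * (c * s)^-1) ^+ 2.
    by field; rewrite !gt_eqF.
  by rewrite ler_wpM2l// divr_ge0 ?exprn_ge0 ?ltW.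
rewrite (le_trans (ler_normD _ _))//.
have n1 := phi_norm (y - G y') cqc b1.
have n2 := phi_norm y' cqcs b2.
have n3 : 2 * c^-1 * `|y - G y'| <= e / 2.
  rewrite -mulrA mulrC -ler_pdivlMr// ler_pdivrMl//.
  by rewrite (le_trans yy')// mulrC; lra.
have n4 : t / c ^+ 2 * `|y'| <= e / 4.
  have c20 : 0 < c ^+ 2 by rewrite exprn_gt0.
  have h : t / c ^+ 2 <= e / 4 / (`|y'| + 1) by rewrite ler_pdivrMr.
  apply: (@le_trans _ _ (e / 4 / (`|y'| + 1) * (`|y'| + 1))).
    by rewrite ler_pM// ?lerDl// divr_ge0// ltW.
  by rewrite divfK// gt_eqF.
lra.
Unshelve. all: by end_near. Qed.

(** For real [t] the imaginary part vanishes and the two components decouple; the summand [P]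
    cancels in the difference. *)
Lemma semigroup_quotient (t : R) (x : HC) : 0 < t ->
  (t%:C)^-1 *: (semigroup t%:C x - x) =
  (t^-1 *: (phi (heat 0 t%:C) (x.1 - P x.1) - (x.1 - P x.1)),
   t^-1 *: (phi (heat 0 t%:C) (x.2 - P x.2) - (x.2 - P x.2))).
Proof.
move=> t0; rewrite semigroupE// /complex_op /semigroup_re /semigroup_im.
have im0 u : phi (heat (pi / 2) t%:C) u = 0.
  rewrite (_ : heat _ _ = fun=> 0) ?phi_cst ?scale0r//.
  apply/funext => s; rewrite /heat /at_inv; case: ifP => // _.
  by rewrite /wave /= mul0r add0r cos_pihalf mulr0.
have ch := @cont01_heat 0 t%:C t0.
rewrite !im0 -fmorphV /= L2C_scaleE /= !scale0r !subr0 !addr0.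
have alg u : P u + phi (heat 0 t%:C) u - u = phi (heat 0 t%:C) (u - P u) - (u - P u).
  rewrite phi_sub (phiP _ ch (heat0 _ _)) subr0; move: (phi _ u) => w.
  by apply: ip_inj => y; rewrite !(ipDr, ipNr); ring.
by rewrite !alg.
Qed.

(** Forward, [u - P u] is in the range of [G] and the previous limit applies. Conversely, [G] is
    bounded and commutes with the calculus: applied to the assumed limit it gives
    [G v = - c^-1 *: (u - P u)], with no prior knowledge that [u] is in the domain. *)
Lemma generator_component (u v : H) : (P v = 0 /\ u - P u = c *: G (- v)) <->
  t^-1 *: (phi (heat 0 t%:C) (u - P u) - (u - P u)) @[t --> (0 : R)^'+] --> v.
Proof.
have PQ w : P (w - P w) = 0 by rewrite linearB /= PP subrr.
have cn0 : c != 0 by rewrite gt_eqF.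
have G_N w : G (- w) = - G w by exact: linearN.
split=> [[Pv uv]|h].
  have Pv' : P (- c *: v) = 0 by rewrite linearZ /= Pv scaler0.
  have := heat_difference_quotient Pv'.
  rewrite scalerA mulrNN mulVf// scale1r.
  suff -> : G (- c *: v) = u - P u by [].
  by rewrite uv G_N linearZ /= scaleNr scalerN.
have lim_norm (L : {linear H -> H}) : (forall w, `|L w| <= `|w|) ->
   L (t^-1 *: (phi (heat 0 t%:C) (u - P u) - (u - P u))) @[t --> (0 : R)^'+] --> L v.
  move=> L1; apply/cvgrPdist_le => e e0; move/cvgrPdist_le : h => /(_ _ e0).
  by apply: filterS => t; rewrite -linearB; exact: le_trans.
have G1 w : `|G w| <= `|w|.
  by rewrite -phi_id -[leRHS]mul1r; apply: phi_norm => [|s /andP[s0 s1]];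
    [exact: cont01_id|rewrite ger0_norm].
have near_eq (f g : R -> H) (l : H) : (forall t, 0 < t -> f t = g t) ->
    f t @[t --> (0 : R)^'+] --> l -> g t @[t --> (0 : R)^'+] --> l.
  move=> fg; apply: cvg_trans; apply: near_eq_cvg.
  by near=> t; rewrite fg//; near: t; exact: nbhs_right_gt.
have Pv : P v = 0.
  have := lim_norm P P_norm.
  move=> /(near_eq _ (fun=> 0)) h0; apply: (cvg_unique (@norm_hausdorff _ _) (h0 _)).
    move=> t t0; rewrite linearZ linearB /= PQ subr0.
    by rewrite (Pphi _ (@cont01_heat 0 t%:C t0) (heat0 _ _)) scaler0.
  exact: cvg_cst.
split => //.
have := lim_norm G G1.
move=> /(near_eq _ (fun t => t^-1 *: (phi (heat 0 t%:C) (G (u - P u)) - G (u - P u)))) h1.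
have e : G v = - c^-1 *: (u - P u).
  apply: (cvg_unique (@norm_hausdorff _ _) (h1 _)).
    move=> t t0; rewrite linearZ linearB /=.
    by rewrite (phi_comm _ (@cont01_heat 0 t%:C t0)).
  exact: heat_difference_quotient.
by rewrite G_N e scaleNr opprK scalerA mulfV// scale1r.
Unshelve. all: by end_near. Qed.

Lemma semigroup_generator : opp_operator (complexify A) = generator semigroup.
Proof.
have N0 w : P (- w) = 0 <-> P w = 0.
  by rewrite linearN; split=> [/eqP|->]; rewrite ?oppr0// oppr_eq0 => /eqP.
apply/seteqP; split=> [] [[u v] [u' v']].
  move=> [[/= h1 /N0 h2] [/= h3 /N0 h4]].
  have /generator_component k1 := conj h2 h1.
  have /generator_component k2 := conj h4 h3.
  rewrite /generator /=; apply/L2C_cvgP.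
  split; [move: k1|move: k2]; apply: cvg_trans; apply: near_eq_cvg;
    by near=> t; rewrite semigroup_quotient//; near: t; exact: nbhs_right_gt.
rewrite /generator /= => /L2C_cvgP[k1 k2].
have /generator_component[h1 h2] :
    t^-1 *: (phi (heat 0 t%:C) (u - P u) - (u - P u)) @[t --> (0 : R)^'+] --> u'.
  move: k1; apply: cvg_trans; apply: near_eq_cvg.
  by near=> t; rewrite semigroup_quotient//; near: t; exact: nbhs_right_gt.
have /generator_component[h3 h4] :
    t^-1 *: (phi (heat 0 t%:C) (v - P v) - (v - P v)) @[t --> (0 : R)^'+] --> v'.
  move: k2; apply: cvg_trans; apply: near_eq_cvg.
  by near=> t; rewrite semigroup_quotient//; near: t; exact: nbhs_right_gt.
by split; split => //=; apply/N0.
Unshelve. all: by end_near. Qed.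

Lemma resolvent_graph_generates :
  generates_contractive_analytic_semigroup (pi / 2) (opp_operator (complexify A)).
Proof.
have id0 (x : HC) : semigroup 0 x = x by rewrite /semigroup ltxx.
exists semigroup; split; last exact: semigroup_generator.
  split=> //.
  - move=> z /sector_Re_gt0 z0.
    apply: (@norm_le_linear_continuous R[i] HC (semigroup z) 1) => // x.
    by rewrite mul1r semigroup_contractive.
  - by move=> z z' /sector_Re_gt0 z0 /sector_Re_gt0 z'0 x; exact: semigroup_add.
  - exact: semigroup_analytic.
  - move=> delta' /andP[_ dpi] x.
    have ReIm0 (L : R[i] -> R) : L 0 = 0 -> (forall z, `|L z|%:C <= `|z|) ->
        L z @[z --> within (sector delta') (nbhs (0 : R[i]^o))] --> (0 : R).
      move=> L0 Ln; apply: cvg_within_filter; apply/cvgrPdist_le => e e0.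
      have ec : 0 < e%:C :> R[i] by rewrite ltcR.
      apply: filterS (@nbhs0_le R[i] R[i]^o _ ec) => z ze.
      by rewrite sub0r normrN -lecR (le_trans (Ln z)).
    apply: semigroup_cvg0.
    + rewrite near_withinE; apply: nearW => z [r [th [r0 thd ->]]].
      apply: sector_Re_gt0; exists r, th; split => //.
      exact: lt_trans thd dpi.
    + apply: ReIm0 => // z; rewrite normc_def lecR -sqrtr_sqr ler_wsqrtr//.
      by rewrite lerDl sqr_ge0.
    + apply: ReIm0 => // z; rewrite normc_def lecR -sqrtr_sqr ler_wsqrtr//.
      by rewrite lerDr sqr_ge0.
by move=> z /sector_Re_gt0 z0 x; exact: semigroup_contractive.
Qed.

End resolvent_operator.

Local Close Scope complex_scope.

(** * Completeness of L2 *)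

Section L2_complete.
Context d (T : measurableType d) (R : realType) (mu : {measure set T -> \bar R}).
Notation H := (L2 mu).
Implicit Types (f g h : T -> R) (u v w : H).

Lemma L2_norm_integral v :
  (\int[mu]_x (L2fun v x ^+ 2)%:E)%E = (`|v| ^+ 2)%:E.
Proof.
rewrite -L2_normE /ip /Rintegral fineK; last exact: integrable_fin_num (ip_intg v v).
by apply: eq_integral => x _; rewrite expr2.
Qed.

Lemma L2_of_fun f : measurable_fun setT f ->
  (\int[mu]_x (f x ^+ 2)%:E < +oo)%E -> exists v, L2fun v = f %[ae mu].
Proof.
move=> mf foo.
have fL : f \in Lfun mu 2%:E.
  rewrite inE; apply/andP; split; rewrite inE//= /finite_norm unlock poweR_lty//.
  rewrite (_ : (\int[mu]_x _)%E = (\int[mu]_x (f x ^+ 2)%:E)%E)//.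
  apply: eq_integral => x _ /=.
  by rewrite powR_mulrn// real_normK ?num_real.
by exists (\pi_H (Lfun_Sub (lee1n 2) fL))%qT; exact: repr_pi_ae.
Qed.

Lemma L2fun_sub u v : L2fun (u - v) = (fun x => L2fun u x - L2fun v x) %[ae mu].
Proof.
have h := L2funZ (-1) v; rewrite scaleN1r in h.
by apply: filterS2 (L2funD u (- v)) h => x h1 h2 _; rewrite h1// h2// mulN1r.
Qed.

Lemma ae_eq_integral_sqr f g : measurable_fun setT f -> measurable_fun setT g ->
  f = g %[ae mu] ->
  (\int[mu]_x (f x ^+ 2)%:E = \int[mu]_x (g x ^+ 2)%:E)%E.
Proof.
move=> mf mg fg; apply: ae_eq_integral => //.
- by apply/measurable_EFinP; exact: measurable_funX.
- by apply/measurable_EFinP; exact: measurable_funX.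
- by apply: filterS fg => x h _; rewrite h.
Qed.

Lemma L2_norm_ae v f : measurable_fun setT f -> L2fun v = f %[ae mu] ->
  (\int[mu]_x (f x ^+ 2)%:E)%E = (`|v| ^+ 2)%:E.
Proof.
move=> mf vf; rewrite -L2_norm_integral; apply: ae_eq_integral_sqr => //.
by apply: filterS vf => x h _; rewrite h.
Qed.

Lemma limn_einf_le (a : nat -> \bar R) c : (forall n, a n <= c)%E -> (limn_einf a <= c)%E.
Proof.
move=> ac; rewrite limn_einf_lim; apply: lime_le; first exact: is_cvg_einfs.
apply: nearW => n; apply: le_trans (ac n); apply: ereal_inf_lbound.
by exists n => //=.
Qed.

Lemma measurable_fun_sub f g : measurable_fun setT f -> measurable_fun setT g ->
  measurable_fun setT (fun x => f x - g x).
Proof. by move=> mf mg; exact: measurable_funB. Qed.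

(** The weight 4^k bounds the k-th increment by sqrt(s) / 2^k, which is summable. *)
Lemma cvg_quadratic_series (a : nat -> R) (s : R) :
  (forall k, 4 ^+ k * (a k.+1 - a k) ^+ 2 <= s) -> cvgn a.
Proof.
move=> as_; have s0 : 0 <= s by apply: le_trans (as_ 0%N); rewrite mulr_ge0 ?sqr_ge0.
have bnd k : `|a k.+1 - a k| <= geometric (Num.sqrt s) 2^-1 k.
  rewrite -(ler_pXn2r (n := 2)) ?nnegrE ?mulr_ge0 ?exprn_ge0 ?sqrtr_ge0 ?invr_ge0//.
  rewrite real_normK ?num_real// exprMn sqr_sqrtr// -exprM mulnC exprM exprVn.
  rewrite (_ : 2 ^+ 2 = 4); last by rewrite -natrX.
  by rewrite exprVn -ler_pdivrMr ?invr_gt0 ?exprn_gt0// invrK mulrC.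
have cs : cvgn (series (fun k => a k.+1 - a k)).
  apply: normed_cvg; apply: series_le_cvg bnd _ => //.
    by move=> k; rewrite mulr_ge0 ?exprn_ge0 ?sqrtr_ge0 ?invr_ge0.
  by apply: is_cvg_geometric_series; rewrite ger0_norm ?invr_ge0// invf_lt1// ltr1n.
have -> : a = fun n => series (fun k => a k.+1 - a k) n + a 0%N.
  by apply/funext => n; rewrite /series /= telescope_sumr// subrK.
by apply: is_cvgD => //; exact: is_cvg_cst.
Qed.

Section cauchy_sequence.
Variable u : nat -> H.
Hypothesis u_cauchy : forall e, 0 < e -> exists N, forall m n,
  (N <= m)%N -> (N <= n)%N -> `|u m - u n| <= e.

Lemma rapid_subsequence : exists M : nat -> nat, [/\ forall k, (k <= M k)%N,
  forall k, (M k <= M k.+1)%N & forall k, `|u (M k.+1) - u (M k)| <= (4 ^+ k.+1)^-1].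
Proof.
have /choice[N NP] : forall k, exists N, forall m n, (N <= m)%N -> (N <= n)%N ->
    `|u m - u n| <= (4 ^+ k.+1)^-1.
  by move=> k; apply: u_cauchy; rewrite invr_gt0 exprn_gt0.
(* These sums are nondecreasing and dominate both [k] and [N k]. *)
pose M k := (\sum_(i < k.+1) (N i).+1)%N.
have MS k : (M k <= M k.+1)%N by rewrite /M [leqRHS]big_ord_recr leq_addr.
have NM k : (N k < M k)%N by rewrite /M big_ord_recr /= leq_addl.
exists M; split => // k; last first.
  apply: NP; [exact: leq_trans (ltnW (NM k)) (MS k)|exact: ltnW].
by elim: k => // k IH; rewrite /M big_ord_recr /= addnS ltnS (leq_trans IH)// leq_addr.
Qed.

(** Riesz-Fischer: the weighted squared increments have total integral at most 1, so their sum [S]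
    is finite almost everywhere, and there [cvg_quadratic_series] gives pointwise convergence. *)
Lemma L2_subsequence_limit : exists M (h : T -> R), [/\ forall k, (k <= M k)%N,
  measurable_fun setT h &
  {ae mu, forall x, L2fun (u (M k)) x @[k --> \oo] --> h x}].
Proof.
have [M [kM MS MD]] := rapid_subsequence.
pose f k := L2fun (u (M k)).
have mf k : measurable_fun setT (f k) by exact: measurable_L2fun.
pose D k x := (4 ^+ k * (f k.+1 x - f k x) ^+ 2)%:E : \bar R.
have mD k : measurable_fun setT (D k).
  apply/measurable_EFinP; apply: measurable_funM => //.
  by apply: measurable_funX; exact: measurable_fun_sub.
have D0 k x : (0 <= D k x)%E by rewrite lee_fin mulr_ge0// sqr_ge0.
pose S x := (\sum_(k <oo) D k x)%E.
have mS : measurable_fun setT S.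
  by apply: ge0_emeasurable_sum => // k x _ _; exact: D0.
have S0 x : (0 <= S x)%E by apply: nneseries_ge0 => k _ _; exact: D0.
have intD k : (\int[mu]_x D k x <= (1 / (2 ^ k.+1)%:R)%:E)%E.
  rewrite /D; under eq_integral do rewrite EFinM.
  rewrite ge0_integralZl_EFin//; last 2 first.
  - by move=> x _; rewrite lee_fin sqr_ge0.
  - by apply/measurable_EFinP; apply: measurable_funX; exact: measurable_fun_sub.
  rewrite (@L2_norm_ae (u (M k.+1) - u (M k))); last 2 first.
  - exact: measurable_fun_sub.
  - exact: L2fun_sub.
  rewrite -EFinM lee_fin.
  apply: (@le_trans _ _ (4 ^+ k * (4 ^+ k.+1)^-1 ^+ 2)).
    by rewrite ler_wpM2l// ler_pXn2r ?nnegrE// invr_ge0.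
  have q0 : 0 < 4 ^+ k :> R by rewrite exprn_gt0.
  rewrite (_ : _ * _ = (16 * 4 ^+ k)^-1); last first.
    by rewrite (exprS _ k); field; rewrite gt_eqF.
  rewrite div1r natrX lef_pV2 ?posrE ?mulr_gt0 ?exprn_gt0// (exprS _ k).
  have : 2 ^+ k <= 4 ^+ k :> R by rewrite lerXn2r ?nnegrE// ler_nat.
  lra.
have intS : mu.-integrable setT S.
  apply/integrableP; split => //.
  under eq_integral do rewrite gee0_abs//.
  rewrite integral_nneseries//.
  apply: (@le_lt_trans _ _ (\sum_(0 <= k <oo) (0 + (1 / (2 ^ k.+1)%:R)%:E))%E).
    apply: lee_nneseries => [k _ _|k _]; first exact: integral_ge0.
    by rewrite add0e; exact: intD.
  apply: le_lt_trans (epsilon_trick (A := fun=> 0%E) xpredT _ ler01) _ => //.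
  by rewrite eseries0// add0e ltry.
pose C := [set x | (S x < +oo)%E].
have mC : measurable C.
  by rewrite -[C]setTI; exact: emeasurable_fun_infty_o.
have fC x : C x -> cvgn (f ^~ x).
  move=> Cx; apply: (@cvg_quadratic_series _ (fine (S x))) => k.
  have Sf : S x \is a fin_num by rewrite ge0_fin_numE.
  rewrite -lee_fin fineK//.
  apply: le_trans (nneseries_lim_ge k.+1 _) => [|n _ _]; last exact: D0.
  rewrite big_nat_recr//= leeDr// sume_ge0// => n _; exact: D0.
(* Restricted to [C], the sequence converges everywhere, so that its limit is measurable. *)
pose h x := limn (fun k => (f k \_ C) x).
have fh x : (f k \_ C) x @[k --> \oo] --> h x.
  rewrite /h; have [Cx|nCx] := pselect (C x).
    suff -> : (fun k => (f k \_ C) x) = f ^~ x by exact: fC.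
    by apply/funext => k; rewrite patchE mem_set.
  suff -> : (fun k => (f k \_ C) x) = fun=> 0 by exact: is_cvg_cst.
  by apply/funext => k; rewrite patchE memNset.
exists M, h; split => //.
  apply: (measurable_fun_cvg (h := fun k => f k \_ C)) => // k.
  by apply/(measurable_restrictT _ mC); exact: measurable_funTS.
apply: filterS (integrable_ae measurableT intS) => x Sx.
have Cx : C x by rewrite /C /= -ge0_fin_numE ?S0// Sx.
suff <- : (fun k => (f k \_ C) x) = f ^~ x by exact: fh.
by apply/funext => k; rewrite patchE mem_set.
Qed.

(** Fatou's lemma along the subsequence bounds the distance from [u n] to [h]. The bound at one
    index [n0] also makes [h - u n0] square integrable, which gives [h] a class in L2. *)
Lemma L2_cauchy_cvg : cvgn u.
Proof.
have [M [h [kM mh fh]]] := L2_subsequence_limit.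
have key e : 0 < e -> exists N, forall n, (N <= n)%N ->
    (\int[mu]_x ((h x - L2fun (u n) x) ^+ 2)%:E <= (e ^+ 2)%:E)%E.
  move=> e0; have [N NP] := u_cauchy e0; exists N => n Nn.
  pose g k x := ((L2fun (u (M (k + N)%N)) x - L2fun (u n) x) ^+ 2)%:E : \bar R.
  have mg k : measurable_fun setT (g k).
    apply/measurable_EFinP; apply: measurable_funX.
    by apply: measurable_fun_sub; exact: measurable_L2fun.
  have g0 k x : setT x -> (0 <= g k x)%E by move=> _; rewrite lee_fin sqr_ge0.
  have := fatou mu measurableT mg g0.
  have gle k : (\int[mu]_x g k x <= (e ^+ 2)%:E)%E.
    rewrite /g (@L2_norm_ae (u (M (k + N)%N) - u n)); last 2 first.
    - by apply: measurable_fun_sub; exact: measurable_L2fun.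
    - exact: L2fun_sub.
    rewrite lee_fin ler_pXn2r ?nnegrE ?(ltW e0)//; apply: NP => //.
    by apply: leq_trans (kM _); exact: leq_addl.
  move=> /le_trans /(_ (limn_einf_le gle)); apply: le_trans.
  rewrite le_eqVlt; apply/orP; left; apply/eqP; apply: ae_eq_integral => //.
  - apply/measurable_EFinP; apply: measurable_funX.
    by apply: measurable_fun_sub => //; exact: measurable_L2fun.
  - rewrite (_ : (fun x => limn_einf _) = fun x => - limn_esup (fun k => - g k x))%E//.
    apply: measurableT_comp => //.
    by apply: measurable_fun_limn_esup => // k; exact: measurableT_comp.
  apply: filterS fh => x hx _.
  suff gx : g k x @[k --> \oo] --> ((h x - L2fun (u n) x) ^+ 2)%:E.
    by rewrite (cvg_limn_einf_sup gx).1.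
  have hs : L2fun (u (M (k + N)%N)) x - L2fun (u n) x @[k --> \oo] --> h x - L2fun (u n) x.
    apply: cvgB; last exact: cvg_cst.
    by rewrite (cvg_shiftn N (fun k => L2fun (u (M k)) x)).
  apply: cvg_EFin; first exact: nearW.
  rewrite expr2; apply: (cvg_congr (v := fun k =>
    (L2fun (u (M (k + N)%N)) x - L2fun (u n) x) *
    (L2fun (u (M (k + N)%N)) x - L2fun (u n) x))) => [k|]; last exact: cvgM.
  by rewrite /= expr2.
have [n0 hn0] := key 1 ltr01.
have mhn n : measurable_fun setT (fun x => h x - L2fun (u n) x).
  by apply: measurable_fun_sub => //; exact: measurable_L2fun.
have [w wE] := L2_of_fun (mhn n0) (le_lt_trans (hn0 n0 (leqnn _)) (ltry _)).
have lE : L2fun (w + u n0) = h %[ae mu].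
  apply: filterS2 (L2funD w (u n0)) wE => x h1 h2 _.
  by rewrite h1// h2// subrK.
apply/cvg_ex; exists (w + u n0); apply/cvgrPdist_le => e e0.
have [N NP] := key e e0; exists N => //= n Nn.
rewrite -(ler_pXn2r (n := 2)) ?nnegrE ?(ltW e0)// -lee_fin.
rewrite -(@L2_norm_ae _ (fun x => h x - L2fun (u n) x))//; first exact: NP.
by apply: filterS2 (L2fun_sub (w + u n0) (u n)) lE => x h1 h2 _; rewrite h1// h2.
Qed.

End cauchy_sequence.
End L2_complete.

(** * Primitives on the unit interval *)

Section unit_interval_integral.
Context {R : realType}.
Notation leb := (@lebesgue_measure R).
Notation I := (`]0, 1[%classic : set R).
Notation I01 := (`[0, 1]%classic : set R).
Implicit Types (f g h u : R -> R) (x y t c e M p q : R).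

Definition L1 f := leb.-integrable I (EFin \o f).
Definition Int f : R := \int[leb]_(x in I) f x.

Let mI : measurable (I : set (measurableTypeR R)). Proof. exact: measurable_itv. Qed.
Local Hint Resolve mI : core.

Let ae_filter : Filter (almost_everywhere leb).
Proof. exact: ae_filter_ringOfSetsType. Qed.

Lemma aeS (P Q : R -> Prop) : (forall x, P x -> Q x) ->
  (\forall x \ae leb, P x) -> \forall x \ae leb, Q x.
Proof. exact: (@filterS _ _ ae_filter). Qed.

Lemma aeS2 (P1 P2 Q : R -> Prop) : (forall x, P1 x -> P2 x -> Q x) ->
  (\forall x \ae leb, P1 x) -> (\forall x \ae leb, P2 x) -> \forall x \ae leb, Q x.
Proof. exact: (@filterS2 _ _ ae_filter). Qed.

Lemma L1_measurable f : L1 f -> measurable_fun I f.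
Proof. by move=> /measurable_int /measurable_EFinP. Qed.

Lemma L1D f g : L1 f -> L1 g -> L1 (fun x => f x + g x).
Proof. by move=> f1 g1; have := integrableD mI f1 g1. Qed.

Lemma L1Z c f : L1 f -> L1 (fun x => c * f x).
Proof. by move=> f1; have := integrableZl mI c f1. Qed.

Lemma L1B f g : L1 f -> L1 g -> L1 (fun x => f x - g x).
Proof. by move=> f1 g1; have := integrableB mI f1 g1. Qed.

Lemma L1_le f g : measurable_fun I f -> (forall x, I x -> `|f x| <= `|g x|) ->
  L1 g -> L1 f.
Proof.
by move=> mf fg; apply: le_integrable => //; exact/measurable_EFinP.
Qed.

Lemma L1_norm f : L1 f -> L1 (fun x => `|f x|).
Proof.
move=> f1; apply: (L1_le _ _ f1) => [|x _]; last by rewrite normr_id.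
by apply: measurableT_comp => //; exact: L1_measurable.
Qed.

Lemma L1_cst c : L1 (fun=> c).
Proof.
apply: measurable_bounded_integrable => //.
- by rewrite /= lebesgue_measure_itv /= lte_fin ltr01 -EFinD ltry.
- by exists `|c|; split; rewrite ?num_real// => M cM x _; exact: ltW.
Qed.

Lemma L1_bounded f M : measurable_fun I f -> (forall x, I x -> `|f x| <= M) -> L1 f.
Proof.
move=> mf fM; apply: (L1_le mf _ (L1_cst M)) => x Ix.
by rewrite (le_trans (fM _ Ix))// ler_norm.
Qed.

Lemma L1_mulr_bounded f g M : L1 f -> measurable_fun I g ->
  (forall x, I x -> `|g x| <= M) -> L1 (fun x => f x * g x).
Proof.
move=> f1 mg gM; apply: (@L1_le _ (fun x => M * f x)) => [|x Ix|]; last exact: L1Z.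
  by apply: measurable_funM => //; exact: L1_measurable.
have M0 : 0 <= M by exact: le_trans (gM _ Ix).
by rewrite !normrM mulrC ler_wpM2r// (le_trans (gM _ Ix))// ler_norm.
Qed.

Lemma IntD f g : L1 f -> L1 g -> Int (fun x => f x + g x) = Int f + Int g.
Proof. by move=> f1 g1; exact: RintegralD. Qed.

Lemma IntB f g : L1 f -> L1 g -> Int (fun x => f x - g x) = Int f - Int g.
Proof. by move=> f1 g1; exact: RintegralB. Qed.

Lemma IntZ c f : L1 f -> Int (fun x => c * f x) = c * Int f.
Proof. by move=> f1; exact: RintegralZl. Qed.

Lemma eq_Int f g : (forall x, I x -> f x = g x) -> Int f = Int g.
Proof. by move=> fg; apply: eq_Rintegral => x; rewrite inE; exact: fg. Qed.

Lemma eq_L1 f g : (forall x, I x -> f x = g x) -> L1 f -> L1 g.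
Proof.
move=> fg; apply: eq_integrable => // x; rewrite inE => /fg /= ->.
by [].
Qed.

Lemma Int_cst c : Int (fun=> c) = c.
Proof.
rewrite /Int Rintegral_cst//= lebesgue_measure_itv /= lte_fin ltr01.
by rewrite oppr0 adde0 mulr1.
Qed.

Lemma le_Int f g : L1 f -> L1 g -> (forall x, I x -> f x <= g x) -> Int f <= Int g.
Proof. by move=> f1 g1 fg; exact: le_Rintegral. Qed.

Lemma le_norm_Int f : L1 f -> `|Int f| <= Int (fun x => `|f x|).
Proof. by move=> f1; exact: le_normr_Rintegral. Qed.

Lemma Int_ae f g : measurable_fun I f -> measurable_fun I g ->
  f = g %[ae leb in I] -> Int f = Int g.
Proof.
move=> mf mg fg; congr fine; apply: ae_eq_integral => //.
- exact/measurable_EFinP.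
- exact/measurable_EFinP.
- by apply: aeS fg => x h Ix /=; rewrite h.
Qed.

Lemma L1_ae f g : measurable_fun I g -> f = g %[ae leb in I] -> L1 f -> L1 g.
Proof.
move=> mg fg f1; have mf := L1_measurable f1.
apply/integrableP; split; first exact/measurable_EFinP.
case/integrableP: f1 => _; congr (_ < _)%E; apply: ae_eq_integral => //.
- by apply: measurableT_comp => //; exact/measurable_EFinP.
- by apply: measurableT_comp => //; exact/measurable_EFinP.
- by apply: aeS fg => x h Ix /=; rewrite h.
Qed.

(** An indicator with values in the reals: every primitive is then an integral over the same set [I]
    and inherits linearity from [Int]. *)
Definition below x t : R := (t <= x)%R%:R.

Lemma measurable_below x (D : set R) : measurable_fun D (below x).
Proof.
rewrite (_ : below x = \1_(`]-oo, x]%classic)); first exact: measurable_indic.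
by apply/funext => t; rewrite indicE /below mem_setE /= in_itv.
Qed.

Lemma below_le1 x t : `|below x t| <= 1.
Proof. by rewrite /below; case: (t <= x); rewrite ?normr1 ?normr0. Qed.

(* The primitive of [f], extended by 0 outside [I], vanishing at 0. *)
Definition V f x : R := Int (fun t => f t * below x t).

Lemma L1_below f x : L1 f -> L1 (fun t => f t * below x t).
Proof.
by move=> f1; apply: (@L1_mulr_bounded _ _ 1 f1 (@measurable_below x I)) => t _; exact: below_le1.
Qed.

Lemma VD f g x : L1 f -> L1 g -> V (fun t => f t + g t) x = V f x + V g x.
Proof.
move=> f1 g1; rewrite /V -IntD; [|exact: L1_below|exact: L1_below].
by apply: eq_Int => t _; rewrite mulrDl.
Qed.

Lemma VB f g x : L1 f -> L1 g -> V (fun t => f t - g t) x = V f x - V g x.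
Proof.
move=> f1 g1; rewrite /V -IntB; [|exact: L1_below|exact: L1_below].
by apply: eq_Int => t _; rewrite mulrBl.
Qed.

Lemma VZ c f x : L1 f -> V (fun t => c * f t) x = c * V f x.
Proof.
move=> f1; rewrite /V -IntZ; last exact: L1_below.
by apply: eq_Int => t _; rewrite mulrA.
Qed.

Lemma V_ae f g : measurable_fun I f -> measurable_fun I g ->
  f = g %[ae leb in I] -> V f = V g.
Proof.
move=> mf mg fg; apply/funext => x; apply: Int_ae.
- by apply: measurable_funM => //; exact: measurable_below.
- by apply: measurable_funM => //; exact: measurable_below.
- by apply: aeS fg => t h It /=; rewrite h.
Qed.

Lemma V_le0 f x : x <= 0 -> V f x = 0.
Proof.
move=> x0; rewrite -[RHS](Int_cst 0); apply: eq_Int => t.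
rewrite /= in_itv /= => /andP[t0 _].
by rewrite /below leNgt (le_lt_trans x0 t0) mulr0.
Qed.

Lemma V_ge1 f x : 1 <= x -> V f x = Int f.
Proof.
move=> x1; apply: eq_Int => t; rewrite /= in_itv /= => /andP[_ t1].
by rewrite /below (le_trans (ltW t1) x1) mulr1.
Qed.

Lemma V_cst c x : 0 <= x <= 1 -> V (fun=> c) x = c * x.
Proof.
move=> /andP[x0 x1].
rewrite /V (IntZ c (f := below x)); last first.
  by apply: eq_L1 (L1_below x (L1_cst 1)) => t _; rewrite mul1r.
congr (_ * _); rewrite /Int.
rewrite (_ : below x = \1_(`]-oo, x]%classic)); last first.
  by apply/funext => t; rewrite indicE /below mem_setE /= in_itv.
rewrite /Rintegral integral_indic//=.
have -> : (`]-oo, x] `&` `]0, 1[)%classic = (if x == 1 then `]0, 1[ else `]0, x])%classic.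
  apply/seteqP; split => t /=; rewrite !in_itv /=.
    case: ifP => [/eqP ->|/negbT x1']; rewrite /= in_itv /=; first by case.
    by move=> [-> /andP[-> _]].
  case: ifP => [/eqP ->|/negbT x1']; rewrite /= in_itv /= => /andP[-> tx].
    by rewrite (ltW tx) tx.
  by rewrite tx (le_lt_trans tx)// lt_neqAle x1' x1.
have [->|x1'] := eqVneq x 1.
  by rewrite lebesgue_measure_itv /= lte_fin ltr01 oppr0 adde0.
rewrite lebesgue_measure_itv /= lte_fin.
case: ltP => /= h; first by rewrite subr0.
by apply/eqP; rewrite eq_le x0 h.
Qed.

Lemma ae_neq x : \forall t \ae leb, t != x.
Proof.
suff : leb.-negligible [set x].
  by apply: negligibleS => t /= /negP; rewrite negbK => /eqP.
by apply/negligibleP => //; exact: lebesgue_measure_set1.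
Qed.

Lemma Int_setT f : Int f = \int[leb]_x (f \_ I) x.
Proof. exact: Rintegral_mkcond. Qed.

Lemma L1_setT f : L1 f -> leb.-integrable setT (EFin \o (f \_ I)).
Proof. by move=> /(integrable_mkcond _ mI).1; rewrite restrict_EFin. Qed.

(** The two indicators overlap at the single point [t = x]. *)
Lemma Int_above f x : L1 f ->
  Int (fun t => f t * (x <= t)%R%:R) = Int f - V f x.
Proof.
move=> f1; rewrite /V -IntB//; last exact: L1_below.
apply: Int_ae.
- apply: measurable_funM; first exact: L1_measurable.
  rewrite (_ : (fun t => _) = \1_(`[x, +oo[%classic)); first exact: measurable_indic.
  by apply/funext => t; rewrite indicE mem_setE /= in_itv /= andbT.
- by apply: L1_measurable; apply: L1B => //; exact: L1_below.
apply: aeS (ae_neq x) => t tx _ /=; rewrite /below.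
by case: ltgtP tx => // _ _; rewrite ?mulr1 ?mulr0 ?subr0 ?subrr.
Qed.

Lemma restrict_mulr f h x : (f \_ I) x * h x = ((fun t => f t * h t) \_ I) x.
Proof. by rewrite !patchE; case: ifP => // _; rewrite mul0r. Qed.

Lemma EFin_Int f : L1 f -> (\int[leb]_x ((f \_ I) x)%:E = (Int f)%:E)%E.
Proof.
move=> f1; rewrite Int_setT /Rintegral fineK//.
by apply: integrable_fin_num => //; exact: L1_setT.
Qed.

Lemma V_diff f x y : L1 f -> x <= y ->
  `|V f y - V f x| <= \int[leb]_(t in `]x, y]) `|(f \_ I) t|.
Proof.
move=> f1 xy; rewrite /V -IntB; [|exact: L1_below|exact: L1_below].
have fL : L1 (fun t => f t * below y t - f t * below x t).
  by apply: L1B; exact: L1_below.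
rewrite (le_trans (le_norm_Int fL))// Int_setT.
rewrite [leRHS]Rintegral_mkcond le_eqVlt; apply/orP; left; apply/eqP.
apply: eq_Rintegral => t _; rewrite !patchE.
have -> : (t \in `]x, y]%classic) = (x < t <= y) by rewrite mem_setE in_itv.
case: ifP => [_|_]; last by rewrite normr0 if_same.
rewrite /below; case: (leP t y) => ty; case: (ltP x t) => xt;
  rewrite ?mulr1 ?mulr0 ?subr0 ?subrr ?normr0//.
by have := lt_le_trans ty xt; rewrite ltNge xy.
Qed.

Lemma V_small f : L1 f -> forall e, 0 < e -> exists2 r, 0 < r &
  forall A : set (measurableTypeR R), measurable A -> (leb A < r%:E)%E ->
    \int[leb]_(t in A) `|(f \_ I) t| < e.
Proof.
move=> f1 e e0.
by have [r [r0 h]] := integral_normr_continuous (L1_setT f1) e0; exists r.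
Qed.

Lemma V_continuous f : L1 f -> continuous (V f).
Proof.
move=> f1 x; apply/cvgrPdist_lt => e e0.
have [r r0 h] := V_small f1 e0.
have step y z : y <= z -> z - y < r -> `|V f z - V f y| < e.
  move=> yz zy; rewrite (le_lt_trans (V_diff f1 yz))//; apply: h => //.
  by rewrite lebesgue_measure_itv /= lte_fin; case: ifP => _; rewrite lte_fin.
apply: filterS (nbhsx_ballx x r r0) => y.
rewrite -ball_normE /= ltr_norml => /andP[h1 h2].
have [xy|yx] := leP x y; last by apply: step; rewrite // ltW.
by rewrite distrC; apply: step => //; lra.
Qed.

(** Disjointness turns the sum of increments into one integral of |f| over the union, which is small
    with the measure of the union. *)
Lemma V_absolutely_continuous f : L1 f -> absolutely_continuous (V f).
Proof.
move=> f1 e e0; have [r r0 h] := V_small f1 e0; exists r => // n s t st disj tot.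
(* Half-open intervals remain disjoint when two given intervals share an endpoint. *)
pose A (i : 'I_n) : set (measurableTypeR R) := `]s i, t i]%classic.
have mA i : measurable (A i) by exact: measurable_itv.
have tA : trivIset [set` index_enum 'I_n] A.
  apply/trivIsetP => i j _ _ ij; rewrite -subset0 => z.
  rewrite /A /= !in_itv /= => -[/andP[z1 z2] /andP[z3 z4]].
  case: (disj _ _ ij) => k.
    by have := le_lt_trans z2 (le_lt_trans k z3); rewrite ltxx.
  by have := le_lt_trans z4 (le_lt_trans k z1); rewrite ltxx.
have intf := L1_setT f1.
have intA (B : set (measurableTypeR R)) : measurable B ->
    leb.-integrable B (fun x => `|(f \_ I) x|%:E).
  move=> mB; apply: integrableS (integrable_norm intf) => //.
pose D := \big[setU/set0]_(i <- index_enum 'I_n) A i.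
have mD : measurable D by exact: bigsetU_measurable.
have DE (k : R -> \bar R) : measurable_fun D k -> (forall x, 0 <= k x)%E ->
    (\int[leb]_(x in D) k x = \sum_i \int[leb]_(x in A i) k x)%E.
  by move=> mk k0; rewrite ge0_integral_bigsetU//; exact: index_enum_uniq.
have Dr : (leb D < r%:E)%E.
  rewrite -[leb D]mul1e -integral_cst// DE//.
  have lA i : leb (A i) = (t i - s i)%:E.
    have := lebesgue_measure_itv `]s i, t i]; rewrite /= lte_fin => ->.
    case: ltP => //= ti; have [_ si _] := st i.
    by have -> : t i = s i; [apply/eqP; rewrite eq_le ti si|rewrite subrr].
  rewrite (eq_bigr (fun i => (t i - s i)%:E)); last first.
    by move=> i _; rewrite integral_cst// mul1e; exact: lA.
  by rewrite sumEFin lte_fin.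
apply: le_lt_trans (h D mD Dr).
rewrite -lee_fin -sumEFin /Rintegral fineK; last exact: integrable_fin_num (intA _ mD).
rewrite DE//; last by apply: measurable_int (intA _ mD).
apply: lee_sum => i _; have [_ si _] := st i.
rewrite -[leRHS]fineK; last exact: integrable_fin_num (intA _ (mA i)).
by rewrite lee_fin; exact: V_diff.
Qed.

Lemma V_bounded f x : L1 f -> `|V f x| <= Int (fun t => `|f t|).
Proof.
move=> f1; rewrite (le_trans (le_norm_Int (L1_below x f1)))//.
apply: le_Int => [||t _]; [exact/L1_norm/L1_below|exact: L1_norm|].
by rewrite normrM ler_piMr// below_le1.
Qed.

Lemma L1_mulV f g : L1 f -> L1 g -> L1 (fun x => f x * V g x).
Proof.
move=> f1 g1; apply: (@L1_mulr_bounded _ _ (Int (fun t => `|g t|)) f1) => [|x _].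
  by apply: measurable_funTS; apply: continuous_measurable_fun; exact: V_continuous.
exact: V_bounded.
Qed.

(* Both sides integrate [f (t) g (x)] over the square, cut along the diagonal. *)
Lemma Int_by_parts f g : L1 f -> L1 g ->
  Int (fun x => V f x * g x) + Int (fun x => f x * V g x) = Int f * Int g.
Proof.
move=> f1 g1.
have f1' := L1_setT f1; have g1' := L1_setT g1.
set fI := f \_ I in f1' *; set gI := g \_ I in g1' *.
have mf : measurable_fun setT fI by move: f1' => /measurable_int /measurable_EFinP.
have mg : measurable_fun setT gI by move: g1' => /measurable_int /measurable_EFinP.
pose F (z : measurableTypeR R * measurableTypeR R) : \bar R :=
  (if z.1 <= z.2 then fI z.1 * gI z.2 else 0)%:E.
have mF : measurable_fun setT F.
  apply/measurable_EFinP; apply: measurable_fun_ifT => //.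
    by apply: measurable_fun_ler; [exact: measurable_fst|exact: measurable_snd].
  by apply: measurable_funM; apply: measurableT_comp.
have FE t x : F (t, x) = (fI t * gI x * (t <= x)%R%:R)%:E.
  by rewrite /F /=; case: (t <= x); rewrite ?mulr1 ?mulr0.
have G1 : (\int[leb]_x `|(gI x)%:E| < +oo)%E by case/integrableP: g1'.
have G0 : (0 <= \int[leb]_x `|(gI x)%:E|)%E by exact: integral_ge0.
pose G := fine (\int[leb]_x `|(gI x)%:E|)%E.
have GE : (\int[leb]_x `|(gI x)%:E|)%E = G%:E by rewrite /G fineK// ge0_fin_numE.
have Gp : 0 <= G by rewrite -lee_fin -GE.
have intF : (leb \x leb)%E.-integrable setT F.
  apply/integrable12ltyP => //.
  apply: (@le_lt_trans _ _ (\int[leb]_t (G%:E * `|(fI t)%:E|))%E).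
    apply: ge0_le_integral => //.
    - by move=> t _; exact: integral_ge0.
    - apply: (measurable_fun_fubini_tonelli_F (m2 := leb) (fun z => `|F z|%E)) => //.
      exact: measurableT_comp.
    - by apply: emeasurable_funM => //; apply: measurableT_comp => //; exact/measurable_EFinP.
    - move=> t _; rewrite -GE muleC -ge0_integralZl_EFin//; last first.
        by apply: measurableT_comp => //; exact/measurable_EFinP.
      apply: ge0_le_integral => //.
      + apply: measurableT_comp => //.
        under eq_fun do rewrite FE.
        apply/measurable_EFinP; apply: measurable_funM; first exact: measurable_funM.
        rewrite (_ : (fun x => _) = \1_(`[t, +oo[%classic)); first exact: measurable_indic.
        by apply/funext => x; rewrite indicE mem_setE /= in_itv /= andbT.
      + by apply: emeasurable_funM => //; apply: measurableT_comp => //; exact/measurable_EFinP.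
      + move=> x _; rewrite FE -EFinM lee_fin !normrM ler_piMr ?mulr_ge0//.
        by case: (t <= x); rewrite ?normr1 ?normr0.
  rewrite ge0_integralZl_EFin//; last first.
    by apply: measurableT_comp => //; exact/measurable_EFinP.
  by case/integrableP: f1' => _ h; rewrite lte_mul_pinfty.
have := Fubini intF.
have inner1 t : (\int[leb]_x F (t, x) = ((fun t => f t * (Int g - V g t)) \_ I t)%:E)%E.
  rewrite -restrict_mulr -(Int_above t g1).
  have g2 : L1 (fun x => g x * (t <= x)%R%:R).
    apply: (@L1_mulr_bounded _ _ 1 g1) => [|x _].
      rewrite (_ : (fun x => _) = \1_(`[t, +oo[%classic)); first exact: measurable_indic.
      by apply/funext => x; rewrite indicE mem_setE /= in_itv /= andbT.
    by case: (t <= x); rewrite ?normr1 ?normr0.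
  rewrite EFinM -(EFin_Int g2) -integralZl//; last exact: L1_setT.
  by apply: eq_integral => x _; rewrite FE -mulrA EFinM; congr (_ * _%:E)%E; exact: (restrict_mulr g (fun x => (t <= x)%R%:R)).
have inner2 x : (\int[leb]_t F (t, x) = ((fun x => g x * V f x) \_ I x)%:E)%E.
  rewrite -restrict_mulr EFinM -(EFin_Int (L1_below x f1)) -integralZl//; last first.
    exact/L1_setT/L1_below.
  by apply: eq_integral => t _; rewrite FE mulrAC mulrC EFinM; congr (_ * _%:E)%E; exact: (restrict_mulr f (below x)).
under eq_integral do rewrite inner1.
under [in RHS]eq_integral do rewrite inner2.
have fg1 := L1_mulV f1 g1; have gf1 := L1_mulV g1 f1.
rewrite EFin_Int; last first.
  apply: eq_L1 (L1B (L1Z (Int g) f1) fg1) => x _; rewrite mulrBr.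
  by rewrite (mulrC (f x) (Int g)).
rewrite EFin_Int// => -[e].
rewrite (_ : Int (fun x => V f x * g x) = Int (fun x => g x * V f x)); last first.
  by apply: eq_Int => x _; rewrite mulrC.
rewrite -e.
rewrite (_ : Int (fun t => f t * (Int g - V g t)) = Int g * Int f - Int (fun t => f t * V g t)).
  by rewrite subrK mulrC.
rewrite -IntZ// -IntB//; last exact: L1Z.
by apply: eq_Int => x _; rewrite mulrBr (mulrC (f x) (Int g)).
Qed.

End unit_interval_integral.

(** * Weak derivatives *)

Section weak_derivatives.
Context {R : realType}.
Notation leb := (@lebesgue_measure R).
Notation I := (`]0, 1[%classic : set R).
Notation I01 := (`[0, 1]%classic : set R).
Implicit Types (f g h u : R -> R) (x y t c e M p q : R).

Let mI : measurable (I : set (measurableTypeR R)). Proof. exact: measurable_itv. Qed.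
Local Hint Resolve mI : core.

Lemma V_half_line f x : V f x = \int[leb]_(t in `]-oo, x]) (f \_ I) t.
Proof.
rewrite /V Int_setT [RHS]Rintegral_mkcond; apply: eq_Rintegral => t _.
rewrite -(restrict_mulr f (below x)) [in RHS]patchE mem_setE in_itv /= /below.
by case: ifP => _; rewrite ?mulr1 ?mulr0.
Qed.

Lemma L1_half_line f (A : set (measurableTypeR R)) : measurable A -> L1 f ->
  leb.-integrable A (EFin \o (f \_ I)).
Proof. by move=> mA f1; apply: integrableS (L1_setT f1). Qed.

Lemma V_derivable f x : L1 f -> {for x, continuous (f \_ I)} ->
  derivable (V f) x 1 /\ derive1 (V f) x = (f \_ I) x.
Proof.
move=> f1 fx; rewrite (funext (V_half_line f)).
apply: (@continuous_FTC1 _ (f \_ I) -oo%O x (x + 1)) => //; first by rewrite ltrDl.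
  exact: L1_half_line.
exact: ltNyr.
Qed.

(** Lebesgue differentiation: almost everywhere the integrand is the derivative of its half-line
    primitive. *)
Lemma V_injective f : L1 f -> (forall x, V f x = 0) -> f = cst 0 %[ae leb in I].
Proof.
move=> f1 Vf0.
have lf : locally_integrable [set: R] (f \_ I).
  exact: integrable_locally.
have := @FTC1Ny R (f \_ I) (fun y => L1_half_line (measurable_itv _) f1) lf.
apply: aeS => x [_ +] Ix.
rewrite patchE mem_set// => <-.
rewrite (_ : (fun _ => _) = cst 0); first by rewrite derive1_cst.
by apply/funext => y /=; rewrite -V_half_line Vf0.
Qed.

Lemma V_affine_remainder f m e x y : L1 f -> 0 <= x -> x <= y -> y <= 1 ->
  (forall t, x <= t <= y -> `|f t - m| <= e) ->
  `|V f y - V f x - m * (y - x)| <= e * (y - x).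
Proof.
move=> f1 x0 xy y1 fm.
have cst1 c := L1_cst c.
have fm1 : L1 (fun t => f t - m) by exact: L1B.
have -> : V f y - V f x - m * (y - x) = V (fun t => f t - m) y - V (fun t => f t - m) x.
  rewrite !VB// !V_cst ?x0 ?(le_trans xy)// ?(le_trans x0 xy)//.
  by rewrite mulrBr; ring.
have -> : e * (y - x) = V (fun=> e) y - V (fun=> e) x.
  by rewrite !V_cst ?x0 ?(le_trans xy)// ?(le_trans x0 xy)// mulrBr.
rewrite /V -!IntB; try exact: L1_below.
have h1 : L1 (fun t => (f t - m) * below y t - (f t - m) * below x t).
  by apply: L1B; exact: L1_below.
rewrite (le_trans (le_norm_Int h1))//; apply: le_Int => [||t _].
- exact: L1_norm.
- by apply: L1B; exact: L1_below.
rewrite -mulrBr -mulrBr normrM /below.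
have [ty|yt] := leP t y; have [tx|xt] := leP t x.
- by rewrite subrr normr0 !mulr0.
- by rewrite subr0 normr1 !mulr1 fm// ty ltW.
- by have := lt_le_trans yt (le_trans tx xy); rewrite ltxx.
- by rewrite subrr normr0 !mulr0.
Qed.

(** [V_derivable] asks for continuity of [f \_ I], which may jump at the endpoints; the one-sided
    quotient is estimated directly. *)
Lemma V_quotient f x : L1 f -> continuous f -> I01 x ->
  (V f y - V f x) / (y - x) @[y --> within I01 x^'] --> f x.
Proof.
move=> f1 cf; rewrite /= in_itv /= => /andP[x0 x1].
apply/cvgrPdist_le => e e0.
move: (cf x) => /cvgrPdist_le /(_ _ e0) /nbhs_ballP[r /= r0 rb].
rewrite near_withinE; exists r => //= y; rewrite /ball /= => xyr yx.
rewrite in_itv /= => /andP[y0 y1].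
have close t : (x <= t <= y) || (y <= t <= x) -> `|f t - f x| <= e.
  move=> txy; rewrite distrC; apply: rb; rewrite /ball /=.
  apply: le_lt_trans xyr; case/orP: txy => /andP[h1 h2].
    by rewrite distrC (distrC x) !ger0_norm ?subr_ge0// ?(le_trans h1)// lerD2r.
  by rewrite !ger0_norm ?subr_ge0// ?(le_trans h1)// lerD2l lerN2.
have yx0 : y - x != 0 by rewrite subr_eq0.
rewrite -[f x in X in `|X|](mulfK yx0) -mulrBl normrM normfV ler_pdivrMr ?normr_gt0//.
have [xy|/ltW xy] := leP x y.
  rewrite distrC (ger0_norm (x := y - x)) ?subr_ge0//.
  by apply: V_affine_remainder => // t h; apply: close; rewrite h.
rewrite (ler0_norm (x := y - x)) ?subr_le0// [- (y - x)]opprB.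
have := @V_affine_remainder f (f x) e y x f1 y0 xy x1.
rewrite (_ : f x * (y - x) - (V f y - V f x) = V f x - V f y - f x * (x - y)); last by ring.
by apply => t h; apply: close; rewrite h orbT.
Qed.

Lemma continuous_L1 f : continuous f -> L1 f.
Proof.
move=> cf; apply: (@integrableS _ _ _ _ (`[0, 1] : set (measurableTypeR R))) => //.
  by apply: subset_itvW => //.
apply: continuous_compact_integrable; first exact: segment_compact.
exact: continuous_subspaceT.
Qed.

(** Zero mean makes the primitive vanish to the right of the support. *)
Lemma test_function_primitive (psi : R -> R) (c d : R) : continuous psi -> 0 < c -> d < 1 ->
  (forall x, psi x != 0 -> c <= x <= d) -> Int psi = 0 ->
  test_function (V psi) /\ derive1 (V psi) = psi.
Proof.
move=> cpsi c0 d1 supp psi0; have psi1 := continuous_L1 cpsi.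
have psiI : psi \_ I = psi.
  apply/funext => x; rewrite patchE mem_setE in_itv /=; case: ifP => // /negP xI.
  apply/esym/eqP/negP => /negP /supp /andP[cx xd]; apply: xI.
  by rewrite (lt_le_trans c0 cx) (le_lt_trans xd d1).
have dV x : derivable (V psi) x 1 /\ derive1 (V psi) x = psi x.
  by have := @V_derivable psi x psi1; rewrite psiI => h; apply: h; exact: cpsi.
have dVE : derive1 (V psi) = psi by apply/funext => x; case: (dV x).
split=> //; split=> [x||]; [by case: (dV x)|by rewrite dVE|].
exists c, d; split=> // x Vx; apply/andP; split; rewrite leNgt; apply/negP => h.
  case/eqP: Vx; rewrite -[RHS](Int_cst 0); apply: eq_Int => t _.
  rewrite /below; case: leP => tx; last by rewrite mulr0.
  apply/eqP; rewrite mulr1; apply/negP => /negP /supp /andP[ct _].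
  by have := lt_le_trans h (le_trans ct tx); rewrite ltxx.
case/eqP: Vx; rewrite -[RHS]psi0; apply: eq_Int => t _.
rewrite /below; case: leP => tx; first by rewrite mulr1.
rewrite mulr0; apply/esym/eqP/negP => /negP /supp /andP[_ td].
by have := lt_le_trans h (le_trans (ltW tx) td); rewrite ltxx.
Qed.

Lemma test_function_V (phi : R -> R) : test_function phi ->
  [/\ L1 (derive1 phi), Int (derive1 phi) = 0 & V (derive1 phi) = phi].
Proof.
move=> [dphi cphi' [c [d [c0 d1 supp]]]]; have phi'1 := continuous_L1 cphi'.
have zero x : ~~ (c <= x <= d) -> phi x = 0.
  by move=> xcd; apply/eqP/negP => /negP /supp; exact/negP.
have zero' x : ~~ (0 < x < 1) -> derive1 phi x = 0.
  move=> xI; have : \forall y \near x, phi y = cst 0 y.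
    move: xI; rewrite negb_and -!leNgt => /orP[x0|x1].
      near=> y; apply: zero; rewrite negb_and -!ltNge; apply/orP; left.
      by near: y; apply: (@lt_nbhsl _ x c); exact: le_lt_trans x0 c0.
    have dx : - x < - d by rewrite ltrN2 (lt_le_trans d1 x1).
    near=> y; apply: zero; rewrite negb_and -!ltNge; apply/orP; right.
    by near: y; apply: filterS (Nlt_nbhsl dx) => y; rewrite ltrN2.
  by move=> e; rewrite derive1E (near_eq_derive _ e) derive_cst.
have phi'I : derive1 phi \_ I = derive1 phi.
  by apply/funext => x; rewrite patchE; case: ifPn => // xI; rewrite zero'//; move: xI; rewrite mem_setE in_itv.
have dV x : is_derive x 1 (V (derive1 phi) - phi) 0.
  have [] := @V_derivable (derive1 phi) x phi'1; rewrite phi'I; first exact: cphi'.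
  move=> dv e; rewrite -(subrr (derive1 phi x)) -{1}e !derive1E.
  by apply: is_deriveB; apply: DeriveDef.
have VE : V (derive1 phi) = phi.
  apply/funext => x; have := is_derive_0_is_cst x 0 dV.
  rewrite /= [X in X = _ -> _](_ : _ = V (derive1 phi) x - phi x)//.
  rewrite [X in _ = X -> _](_ : _ = V (derive1 phi) 0 - phi 0)// (V_le0 _ (lexx 0)) (zero 0); last first.
    by rewrite negb_and -!ltNge c0.
  by move=> /eqP; rewrite subr0 subr_eq0 => /eqP.
split=> //; rewrite -(V_ge1 _ (lexx 1)) VE zero//.
by rewrite negb_and -!ltNge d1 orbT.
Unshelve. all: by end_near. Qed.


Lemma test_parts (phi g : R -> R) : test_function phi -> L1 g ->
  Int (fun x => V g x * derive1 phi x) = - Int (fun x => g x * phi x).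
Proof.
move=> /test_function_V[p1 p0 pE] g1; have := Int_by_parts g1 p1.
by rewrite p0 mulr0 pE => /eqP; rewrite addr_eq0 => /eqP.
Qed.

Lemma L1_continuous_mul (psi g : R -> R) M : continuous psi -> (forall x, `|psi x| <= M) -> L1 g ->
  L1 (fun x => g x * psi x).
Proof.
move=> cpsi psiM g1; apply: (@L1_mulr_bounded _ _ _ M g1) => //.
by apply: measurable_funTS; exact: continuous_measurable_fun.
Qed.

(** * Continuous approximation of indicator functions *)

Definition clamp (s : R) : R := Num.max 0 (Num.min 1 s).

Lemma clamp_ge0 s : 0 <= clamp s. Proof. by rewrite le_max lexx. Qed.

Lemma clamp_le1 s : clamp s <= 1. Proof. by rewrite ge_max ler01 ge_min lexx. Qed.

Lemma clamp_eq1 s : 1 <= s -> clamp s = 1.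
Proof. by move=> s1; rewrite /clamp min_l// max_r. Qed.

Lemma clamp_eq0 s : s <= 0 -> clamp s = 0.
Proof.
by move=> s1; rewrite /clamp max_l// ge_min s1 orbT.
Qed.

Lemma clamp_continuous : continuous clamp.
Proof.
move=> s; apply: continuous_max; first exact: cvg_cst.
by apply: continuous_min; [exact: cvg_cst|exact: cvg_id].
Qed.

(* Continuous functions supported in [[1/n, q - 1/n]] and increasing to the
   indicator function of [(0, q)]. *)
Definition plateau (q : R) (n : nat) (x : R) : R :=
  clamp (n.+1%:R * x - 1) * clamp (n.+1%:R * (q - x) - 1).

Lemma plateau_continuous q n : continuous (plateau q n).
Proof.
move=> x; apply: cvgM.
  apply: (continuous_comp (f := fun x => n.+1%:R * x - 1)); last exact: clamp_continuous.
  by apply: cvgB; [apply: cvgMr; exact: cvg_id|exact: cvg_cst].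
apply: (continuous_comp (f := fun x => n.+1%:R * (q - x) - 1)); last exact: clamp_continuous.
apply: cvgB; last exact: cvg_cst.
by apply: cvgMr; apply: cvgB; [exact: cvg_cst|exact: cvg_id].
Qed.

Lemma plateau_le1 q n x : `|plateau q n x| <= 1.
Proof.
rewrite ger0_norm; last by rewrite mulr_ge0 ?clamp_ge0.
by rewrite mulr_ile1 ?clamp_ge0 ?clamp_le1.
Qed.

Lemma plateau_support q n x : plateau q n x != 0 -> n.+1%:R^-1 <= x <= q - n.+1%:R^-1.
Proof.
have n0 : 0 < n.+1%:R :> R by [].
rewrite mulf_eq0 negb_or => /andP[h1 h2]; apply/andP; split.
  rewrite leNgt; apply/negP => h; case/eqP: h1; apply: clamp_eq0.
  by rewrite subr_le0 mulrC -ler_pdivlMr// mul1r ltW.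
rewrite lerBrDr -lerBrDl leNgt; apply/negP => h; case/eqP: h2; apply: clamp_eq0.
by rewrite subr_le0 mulrC -ler_pdivlMr// mul1r ltW.
Qed.

(** At [x = q] the plateaus are 0 while [below q q] is 1. *)
Lemma plateau_cvg q x : 0 < x -> x != q -> plateau q n x @[n --> \oo] --> below q x.
Proof.
move=> x0 xq.
have pos y : 0 < y -> \forall n \near \oo, clamp (n.+1%:R * y - 1) = 1.
  move=> y0; near=> n; apply: clamp_eq1; rewrite lerBrDr -ler_pdivrMr//.
  rewrite (@le_trans _ _ n%:R) ?ler_nat//.
  by near: n; exact: nbhs_infty_ger.
rewrite /below; have [q0|q0|xE] := ltgtP x q.
- apply: cvg_near_cst; near=> n; rewrite /plateau.
  rewrite (_ : clamp _ = 1) ?mul1r; last by near: n; exact: pos.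
  by near: n; apply: pos; rewrite subr_gt0.
- apply: cvg_near_cst; near=> n; rewrite /plateau [X in _ * X]clamp_eq0 ?mulr0//.
  rewrite subr_le0 (@le_trans _ _ 0)// pmulr_rle0// subr_le0; exact: ltW.
- by rewrite xE eqxx in xq.
Unshelve. all: by end_near. Qed.

Lemma Int_plateau_cvg q u : L1 u -> Int (fun x => u x * plateau q n x) @[n --> \oo] --> V u q.
Proof.
move=> u1; apply: fine_cvg; rewrite /V /Int.
rewrite fineK; last by apply: integrable_fin_num => //; exact: L1_below.
have [] := @dominated_convergence _ _ _ leb I mI (fun n x => (u x * plateau q n x)%:E)
  (fun x => (u x * below q x)%:E) (fun x => (`|u x|)%:E); last by [].
- move=> n; apply: measurable_int (L1_continuous_mul (@plateau_continuous q n) (plateau_le1 q n) u1).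
- by apply: measurable_int (L1_below q u1).
- apply: aeS (ae_neq q) => x xq /=; rewrite in_itv /= => /andP[x0 _].
  by apply: cvg_EFin; [exact: nearW|apply: cvgMr; exact: plateau_cvg].
- exact: L1_norm.
- apply: aeW => x n Ix; rewrite lee_fin normrM ler_piMr//; exact: plateau_le1.
Qed.

End weak_derivatives.

(** * Weak derivatives as primitives: the du Bois-Reymond lemma *)

Section weak_derivative_primitive.
Context {R : realType}.
Notation leb := (@lebesgue_measure R).
Notation I := (`]0, 1[%classic : set R).
Notation I01 := (`[0, 1]%classic : set R).
Implicit Types (f g h u w : R -> R) (x y t c e M p q : R).

Let mI : measurable (I : set (measurableTypeR R)). Proof. exact: measurable_itv. Qed.
Local Hint Resolve mI : core.

Lemma ae_dense (Q : R -> Prop) (s t : R) : (\forall x \ae leb, Q x) -> s < t ->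
  exists2 y, s < y < t & Q y.
Proof.
move=> [A [mA A0 QA]] st; apply: contrapT => h.
have : (leb `]s, t[%classic <= leb A)%E.
  apply: le_measure; rewrite ?inE//=.
  move=> y /=; rewrite in_itv /= => yst; apply: QA => /= Qy; apply: h; exists y => //.
have := lebesgue_measure_itv `]s, t[; rewrite /= lte_fin st => ->.
by rewrite A0 -EFinD lee_fin subr_le0 leNgt st.
Qed.

Lemma ae_dense_itv (Q : R -> Prop) x r : (\forall x \ae leb, I x -> Q x) -> I01 x -> 0 < r ->
  exists y, [/\ I y, y != x, `|x - y| < r & Q y].
Proof.
move=> h; rewrite /= in_itv /= => /andP[x0 x1] r0.
have h' : \forall y \ae leb, y != x /\ (I y -> Q y).
  by apply: aeS2 h (ae_neq x) => y; split.
have st : Num.max 0 (x - r) < Num.min 1 (x + r).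
  by rewrite gt_max !lt_min ltr01 /=; apply/and3P; split; lra.
have [y] := ae_dense h' st.
rewrite gt_max lt_min => /andP[/andP[y0 xr] /andP[y1 yr]] [yx Qy].
have Iy : I y by rewrite /= in_itv /= y0 y1.
exists y; split=> //; last exact: Qy.
by rewrite ltr_norml; apply/andP; split; lra.
Qed.

(** Converts almost everywhere identities into values at points, endpoints included: a set of full
    measure meets every punctured neighbourhood inside [0, 1]. *)
Lemma cvg_ae_eq0 f l x : I01 x -> f y @[y --> within I01 x^'] --> l ->
  f = cst 0 %[ae leb in I] -> l = 0.
Proof.
move=> Ix /cvgrPdist_lt fl f0; apply/eqP/negP => /negP l0.
have l1 : 0 < `|l| by rewrite normr_gt0.
have := fl _ l1; rewrite near_withinE => -[r /= r0 rb].
have [y [Iy yx xyr fy]] := ae_dense_itv f0 Ix r0.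
have Iy' : I01 y by move: Iy; rewrite /= !in_itv /= => /andP[/ltW -> /ltW ->].
by have := rb y xyr yx Iy'; rewrite /= fy /= subr0 ltxx.
Qed.

Lemma within_cvg f x : {within I01, continuous f} -> I01 x ->
  f y @[y --> within I01 x^'] --> f x.
Proof.
move=> cf Ix; have := cf x; rewrite /continuous_at.
rewrite /= => /cvgrPdist_lt h; apply/cvgrPdist_lt => e /h.
rewrite /nbhs /= /nbhs_subspace; rewrite mem_set//= => H.
move: H; rewrite !near_withinE; case=> r r0 rb; exists r => // y xy yx; exact: rb.
Qed.

Lemma ae_eq_continuous f g x : {within I01, continuous f} -> {within I01, continuous g} ->
  f = g %[ae leb in I] -> I01 x -> f x = g x.
Proof.
move=> cf cg fg Ix; apply/eqP; rewrite -subr_eq0; apply/eqP.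
apply: (@cvg_ae_eq0 (fun y => f y - g y) _ _ Ix).
  by apply: cvgB; exact: within_cvg.
by apply: aeS fg => y h Iy; rewrite h// subrr.
Qed.

(** Du Bois-Reymond. The primitive of a zero-mean combination of two plateaus is a test function; in
    the limit it gives [V w q = Int w * q], so [w] minus its mean has zero primitive. The
    combination is cross-multiplied since [plateau 1 n] can vanish identically for small [n]. *)
Lemma constant_ae w : L1 w ->
  (forall phi : R -> R, test_function phi -> Int (fun x => w x * derive1 phi x) = 0) ->
  w = cst (Int w) %[ae leb in I].
Proof.
move=> w1 h.
have one1 := @L1_cst R 1.
have key q n : q <= 1 ->
    Int (fun x => w x * plateau q n x) * Int (fun x => 1 * plateau 1 n x) =
    Int (fun x => w x * plateau 1 n x) * Int (fun x => 1 * plateau q n x).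
  move=> q1.
  have Lw p := L1_continuous_mul (@plateau_continuous _ p n) (plateau_le1 p n) w1.
  have Lo p := L1_continuous_mul (@plateau_continuous _ p n) (plateau_le1 p n) one1.
  set A := Int (fun x => 1 * plateau 1 n x); set B := Int (fun x => 1 * plateau q n x).
  have n0 : 0 < n.+1%:R^-1 :> R by [].
  have [|||x||] := @test_function_primitive R (fun x => A * (1 * plateau q n x) - B * (1 * plateau 1 n x))
      n.+1%:R^-1 (1 - n.+1%:R^-1).
  - move=> x; apply: cvgB; apply: cvgMr; apply: cvgMr; exact: plateau_continuous.
  - by [].
  - by rewrite ltrBlDr ltrDl.
  - have [p1|/negP] := boolP (plateau 1 n x == 0); last first.
      by move=> /negP /plateau_support.
    rewrite (eqP p1) !mulr0 subr0 mulf_eq0 negb_or => /andP[_]; rewrite mul1r => /plateau_support /andP[-> h2] /=.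
    by rewrite (le_trans h2)// lerD2r.
  - rewrite (IntB (L1Z A (Lo q)) (L1Z B (Lo 1))) (IntZ A (Lo q)) (IntZ B (Lo 1)).
    by rewrite -/A -/B mulrC subrr.
  move=> tf dE; have := h _ tf; rewrite dE.
  rewrite (_ : Int _ = A * Int (fun x => w x * plateau q n x) - B * Int (fun x => w x * plateau 1 n x)).
    by move=> /eqP; rewrite subr_eq0 => /eqP; rewrite mulrC => ->; rewrite mulrC.
  rewrite -!IntZ// -IntB; [|exact: L1Z|exact: L1Z].
  by apply: eq_Int => x _; rewrite !mul1r; ring.
have Vw q : 0 <= q <= 1 -> V w q = Int w * q.
  move=> /andP[q0 q1].
  have c p r : Int (fun x => w x * plateau p n x) * Int (fun x => 1 * plateau r n x) @[n --> \oo]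
      --> V w p * V (fun=> 1) r by apply: cvgM; apply: Int_plateau_cvg.
  have c1 := c q 1; rewrite (funext (fun n => key q n q1)) in c1.
  have := @cvg_unique _ (@norm_hausdorff _ R) _ _ _ _ c1 (c 1 q).
  rewrite (@V_cst _ 1 1) ?ler01 ?lexx// (@V_cst _ 1 q) ?q0// !mul1r mulr1.
  by rewrite (V_ge1 w (lexx 1)); apply.
have : (fun x => w x - Int w) = cst 0 %[ae leb in I].
  apply: V_injective; first by apply: L1B => //; exact: L1_cst.
  move=> x; rewrite VB//; last exact: L1_cst.
  have [x0|x0] := leP x 0; first by rewrite !V_le0// subrr.
  have [x1|x1] := leP x 1; first by rewrite Vw ?V_cst ?(ltW x0)// subrr.
  by rewrite !V_ge1 ?(ltW x1)// Int_cst subrr.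
by apply: aeS => x h' Ix; apply/eqP; rewrite -subr_eq0; apply/eqP; exact: h'.
Qed.

Lemma measurable_V g (D : set R) : L1 g -> measurable_fun D (V g).
Proof.
by move=> g1; apply: measurable_funTS; apply: continuous_measurable_fun; exact: V_continuous.
Qed.

Lemma L1_V g : L1 g -> L1 (V g).
Proof. by move=> g1; apply: continuous_L1; exact: V_continuous. Qed.

(** [constant_ae] applies to [u - V g], which has zero weak derivative. From here on weak
    derivatives are handled through [V]. *)
Lemma weak_derivativeP u g : weak_derivative u g <->
  [/\ L1 u, L1 g & exists k, u = (fun x => V g x + k) %[ae leb in I]].
Proof.
split=> [[u1 g1 h]|[u1 g1 [k uE]]].
  split=> //; have Vg1 := L1_V g1; exists (Int (fun x => u x - V g x)).
  have : (fun x => u x - V g x) = cst (Int (fun x => u x - V g x)) %[ae leb in I].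
    apply: constant_ae => [|phi tphi]; first exact: L1B.
    have [p1 p0 pE] := test_function_V tphi.
    have [_ cp _] := tphi.
    have [M [mp pM]] : exists M, measurable_fun I (derive1 phi) /\ forall x, I x -> `|derive1 phi x| <= M.
      have : compact (derive1 phi @` I01).
        apply: continuous_compact; last exact: segment_compact.
        exact: continuous_subspaceT.
      move=> /compact_bounded [M [_ hM]]; exists (M + 1); split.
        by apply: measurable_funTS; exact: continuous_measurable_fun.
      move=> x; rewrite /= in_itv /= => /andP[/ltW x0 /ltW x1].
      by apply: hM; rewrite ?ltrDl//; exists x => //=; rewrite in_itv /= x0.
    rewrite (_ : Int _ = Int (fun x => u x * derive1 phi x) - Int (fun x => V g x * derive1 phi x)).
      by rewrite (test_parts tphi g1) /Int h// subrr.
    rewrite -IntB; [|exact: (L1_mulr_bounded u1 mp pM)|exact: (L1_mulr_bounded Vg1 mp pM)].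
    by apply: eq_Int => x _; rewrite mulrBl.
  by apply: aeS => x /[apply] /= <-; rewrite subrKC.
split=> // phi tphi; rewrite -/(Int (fun x => g x * phi x)) -(test_parts tphi g1).
have [p1 p0 pE] := test_function_V tphi.
have [_ cp _] := tphi.
have mp : measurable_fun I (derive1 phi).
  by apply: measurable_funTS; exact: continuous_measurable_fun.
have Vp1 : L1 (fun x => V g x * derive1 phi x).
  by apply: eq_L1 (L1_mulV p1 g1) => x _; rewrite mulrC.
transitivity (Int (fun x => V g x * derive1 phi x + k * derive1 phi x)).
  apply: Int_ae.
  - by apply: measurable_funM => //; exact: L1_measurable.
  - by apply: L1_measurable; apply: L1D => //; exact: L1Z.
  - by apply: aeS uE => x h Ix /=; rewrite h// mulrDl.
by rewrite IntD ?IntZ ?p0 ?mulr0 ?addr0//; exact: L1Z.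
Qed.

End weak_derivative_primitive.

(** * Uniqueness of weak derivatives and the second order case *)

Section weak_derivative_theory.
Context {R : realType}.
Notation leb := (@lebesgue_measure R).
Notation I := (`]0, 1[%classic : set R).
Notation I01 := (`[0, 1]%classic : set R).
Implicit Types (f g h u w : R -> R) (x y t c e M p q : R).

Let mI : measurable (I : set (measurableTypeR R)). Proof. exact: measurable_itv. Qed.
Local Hint Resolve mI : core.

Lemma ae_sym f g : f = g %[ae leb in I] -> g = f %[ae leb in I].
Proof. by apply: aeS => x h /h ->. Qed.

Lemma ae_trans f g h : f = g %[ae leb in I] -> g = h %[ae leb in I] -> f = h %[ae leb in I].
Proof. by apply: aeS2 => x h1 h2 Ix; rewrite h1// h2. Qed.

Lemma eq_ae f g : (forall x, I x -> f x = g x) -> f = g %[ae leb in I].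
Proof. by move=> fg; apply: aeW => x; exact: fg. Qed.

Lemma V_zero_on f : L1 f -> (forall x, I01 x -> V f x = 0) -> forall x, V f x = 0.
Proof.
move=> f1 h x; have [x0|x0] := leP x 0; first exact: V_le0.
have [x1|x1] := leP x 1; first by apply: h; rewrite /= in_itv /= ltW.
by rewrite V_ge1 ?(ltW x1)// -(V_ge1 f (lexx 1)) h//= in_itv /= ler01 lexx.
Qed.

Lemma V_within_continuous f : L1 f -> {within I01, continuous (V f)}.
Proof. by move=> f1; apply: continuous_subspaceT; exact: V_continuous. Qed.

Lemma continuous_cst_within c : {within I01, continuous (fun=> c : R)}.
Proof. by apply: continuous_subspaceT => x; exact: cvg_cst. Qed.

Lemma within_continuousD f g : {within I01, continuous f} -> {within I01, continuous g} ->
  {within I01, continuous (fun x => f x + g x)}.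
Proof. by move=> cf cg x; apply: cvgD; [exact: cf|exact: cg]. Qed.

(** Differentiates an almost everywhere identity: by continuity it holds on all of [0, 1], its value
    at 0 is [k = l], and [V_injective] concludes. *)
Lemma V_ae_cst f k l : L1 f -> (fun x => V f x + k) = cst l %[ae leb in I] ->
  k = l /\ f = cst 0 %[ae leb in I].
Proof.
move=> f1 h.
have e x : I01 x -> V f x + k = l.
  move=> Ix; apply: (@ae_eq_continuous _ (fun x => V f x + k) (cst l)) => //.
    by apply: within_continuousD; [exact: V_within_continuous|exact: continuous_cst_within].
  exact: continuous_cst_within.
have kl : k = l.
  have := e 0; rewrite V_le0// add0r; apply.
  by rewrite /= in_itv /= lexx ler01.
split=> //; apply: V_injective => //; apply: V_zero_on => // x /e.
by rewrite -kl => /eqP; rewrite -subr_eq0 addrK => /eqP.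
Qed.

Lemma weak_derivative_unique u g h : weak_derivative u g -> weak_derivative u h ->
  g = h %[ae leb in I].
Proof.
move=> /weak_derivativeP[u1 g1 [k uE]] /weak_derivativeP[_ h1 [l uE']].
have : (fun x => g x - h x) = cst 0 %[ae leb in I].
  apply: (V_ae_cst (k := k) (l := l) _ _).2; first exact: L1B.
  apply: aeS2 uE uE' => x e1 e2 Ix; rewrite VB// addrAC -e1// e2//.
  by rewrite addrAC subrr add0r.
by apply: aeS => x e /e /= /eqP; rewrite subr_eq0 => /eqP.
Qed.

Lemma weak_derivative_ae u u' g g' : measurable_fun I u' -> measurable_fun I g' ->
  u = u' %[ae leb in I] -> g = g' %[ae leb in I] ->
  weak_derivative u g -> weak_derivative u' g'.
Proof.
move=> mu' mg' uu' gg' /weak_derivativeP[u1 g1 [k uE]].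
apply/weak_derivativeP; split; [exact: L1_ae uu' u1|exact: L1_ae gg' g1|].
exists k; rewrite -(V_ae (L1_measurable g1) mg' gg').
by apply: ae_trans uE; exact: ae_sym.
Qed.

Lemma weak_derivative_V g k : L1 g -> weak_derivative (fun x => V g x + k) g.
Proof.
move=> g1; apply/weak_derivativeP; split=> //; last by exists k; exact: eq_ae.
by apply: L1D; [exact: L1_V|exact: L1_cst].
Qed.

Lemma weak_derivative2P u g : weak_derivative2 u g <->
  [/\ L1 u, L1 g & exists c1 c0, u = (fun x => V (V g) x + c1 * x + c0) %[ae leb in I]].
Proof.
have VVc (h : R -> R) c x : L1 h -> I x -> V (fun t => V h t + c) x = V (V h) x + c * x.
  move=> h1; rewrite /= in_itv /= => /andP[/ltW x0 /ltW x1].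
  by rewrite VD ?V_cst ?x0//; [exact: L1_V|exact: L1_cst].
split=> [[v /weak_derivativeP[u1 v1 [c0 uE]] /weak_derivativeP[_ g1 [c1 vE]]]|].
  split=> //; exists c1, c0.
  have Vg1 : L1 (fun x => V g x + c1) by apply: L1D; [exact: L1_V|exact: L1_cst].
  apply: ae_trans uE _; apply: eq_ae => x Ix.
  by rewrite (V_ae (L1_measurable v1) (L1_measurable Vg1) vE) VVc.
move=> [u1 g1 [c1 [c0 uE]]]; exists (fun x => V g x + c1); last exact: weak_derivative_V.
have Vg1 : L1 (fun x => V g x + c1) by apply: L1D; [exact: L1_V|exact: L1_cst].
apply/weak_derivativeP; split=> //; exists c0.
by apply: ae_trans uE _; apply: eq_ae => x Ix; rewrite VVc.
Qed.

Lemma weak_derivative2_unique u g h : weak_derivative2 u g -> weak_derivative2 u h ->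
  g = h %[ae leb in I].
Proof.
move=> [v uv vg] [v' uv' vh]; apply: weak_derivative_unique vg _.
have [v1 v1' vv'] : [/\ L1 v, L1 v' & v' = v %[ae leb in I]].
  split; [by case: uv|by case: uv'|exact: weak_derivative_unique uv' uv].
have h1 : L1 h by case: vh.
by apply: weak_derivative_ae vh => //; [exact: L1_measurable|exact: L1_measurable|exact: eq_ae].
Qed.

End weak_derivative_theory.

(** * Functions on the interval and their classes in L2 *)

Section L2_unit_interval.
Context {R : realType}.
Notation leb := (@lebesgue_measure R).
Notation I := (`]0, 1[%classic : set R).
Notation I01 := (`[0, 1]%classic : set R).
Local Notation H := (@L2_01 R).
Implicit Types (f g h : R -> R) (u v w : H).

Let mI : measurable (I : set (measurableTypeR R)). Proof. exact: measurable_itv. Qed.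
Local Hint Resolve mI : core.

Lemma ae_leb01 (Q : R -> Prop) : (\forall x \ae @leb01 R, Q x) <->
  (\forall x \ae leb, I x -> Q x).
Proof.
split=> -[A [mA A0 QA]].
  exists (A `&` I); split; first exact: measurableI.
    by [].
  move=> x /= /not_implyP[Ix Qx]; split=> //; exact: QA.
(* The null set is enlarged by the complement of [I], to which [leb01] gives no mass. *)
exists (A `|` ~` I); split.
- by apply: measurableU => //; exact: measurableC.
- rewrite /leb01 /= /mrestr setIUl setICl setU0; apply/eqP; rewrite eq_le measure_ge0 andbT.
  by rewrite -A0; apply: le_measure; rewrite ?inE//; exact: measurableI.
- move=> x /= Qx; have [Ix|] := pselect (I x); [left; apply: QA => /= h|by right].
  exact: Qx (h Ix).
Qed.

Lemma integral_leb01 (k : R -> \bar R) : measurable_fun setT k ->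
  (\int[@leb01 R]_x k x = \int[leb]_(x in I) k x)%E.
Proof.
move=> mk; have -> : (\int[leb]_(x in I) k x = \int[@leb01 R]_(x in I) k x)%E.
  by apply: eq_measure_integral => A mA AI; rewrite /leb01 /= /mrestr setIidl.
rewrite [RHS]integral_mkcond; apply: ae_eq_integral => //.
  by apply/(measurable_restrictT _ mI); apply: measurable_funTS.
by apply/ae_leb01; apply: aeW => x Ix _; rewrite patchE mem_set.
Qed.

Lemma measurable_fun01 u (D : set R) : measurable_fun D (fun01 u).
Proof. by apply: measurable_funTS; have := @measurable_L2fun _ _ R (@leb01 R) u; apply. Qed.

Lemma ip_Int u v : ip u v = Int (fun x => fun01 u x * fun01 v x).
Proof.
rewrite /ip /Int /Rintegral integral_leb01//; apply/measurable_EFinP.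
by apply: measurable_funM; exact: measurable_fun01.
Qed.

Lemma in_L2_fun01 u : in_L2 (fun01 u).
Proof.
split; first exact: measurable_fun01.
rewrite -integral_leb01; last first.
  by apply/measurable_EFinP; apply: measurable_funX; exact: measurable_fun01.
by rewrite (L2_norm_integral u) ltry.
Qed.

(** Since |f| <= f^2 + 1 and the interval has finite measure. *)
Lemma in_L2_L1 f : in_L2 f -> L1 f.
Proof.
move=> [mf f2].
have s1 : L1 (fun x => f x ^+ 2).
  apply/integrableP; split; first by apply/measurable_EFinP; exact: measurable_funX.
  move: f2; congr (_ < _)%E; apply: eq_integral => x _ /=.
  by rewrite ger0_norm// sqr_ge0.
apply: (L1_le mf _ (L1D s1 (L1_cst 1))) => x _.
rewrite [leRHS]ger0_norm; last by rewrite addr_ge0 ?sqr_ge0.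
by have := sqr_ge0 (`|f x| - 1); rewrite sqrrB real_normK ?num_real//; have := normr_ge0 (f x); lra.
Qed.

Lemma L1_fun01 u : L1 (fun01 u).
Proof. exact/in_L2_L1/in_L2_fun01. Qed.

Lemma fun01_of f : in_L2 f -> exists v, fun01 v = f %[ae leb in I].
Proof.
move=> [mf f2].
have mfI : measurable_fun setT (f \_ I) by apply/(measurable_restrictT _ mI).
have [|v vE] := @L2_of_fun _ _ _ (@leb01 R) (f \_ I) mfI.
  rewrite integral_leb01; last by apply/measurable_EFinP; exact: measurable_funX.
  by move: f2; congr (_ < _)%E; apply: eq_integral => x xI; rewrite patchE xI.
exists v; have := (ae_leb01 _).1 vE; apply: aeS => x h Ix.
by rewrite /fun01 h// patchE mem_set.
Qed.

Lemma fun01_inj u v : fun01 u = fun01 v %[ae leb in I] -> u = v.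
Proof.
move=> h; apply: ip_inj => w; rewrite !ip_Int; apply: Int_ae.
- by apply: measurable_funM; exact: measurable_fun01.
- by apply: measurable_funM; exact: measurable_fun01.
- by apply: aeS h => x /[apply] ->.
Qed.

Lemma fun01D u v : fun01 (u + v) = (fun x => fun01 u x + fun01 v x) %[ae leb in I].
Proof. by have /ae_leb01 := L2funD u v; apply: aeS => x /[apply]; apply. Qed.

Lemma fun01Z (c : R) u : fun01 (c *: u) = (fun x => c * fun01 u x) %[ae leb in I].
Proof. by have /ae_leb01 := L2funZ c u; apply: aeS => x /[apply]; apply. Qed.

Lemma fun01B u v : fun01 (u - v) = (fun x => fun01 u x - fun01 v x) %[ae leb in I].
Proof. by have /ae_leb01 := L2fun_sub u v; apply: aeS => x /[apply]; apply. Qed.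

Lemma fun01_0 : fun01 (0 : H) = cst 0 %[ae leb in I].
Proof.
have := fun01Z 0 (0 : H); rewrite scale0r.
by apply: aeS => x /[apply] ->; rewrite mul0r.
Qed.

Lemma in_L2_bounded f M : measurable_fun I f -> (forall x, I x -> `|f x| <= M) -> in_L2 f.
Proof.
move=> mf fM; split=> //.
have : L1 (fun x => f x ^+ 2).
  apply: (@L1_bounded _ _ (M ^+ 2)) => [|x Ix]; first exact: measurable_funX.
  by rewrite normrX lerXn2r ?nnegrE ?fM// (le_trans _ (fM _ Ix)).
case/integrableP => _; congr (_ < _)%E.
by apply: eq_integral => x _ /=; rewrite ger0_norm// sqr_ge0.
Qed.

Lemma in_L2_V f : L1 f -> in_L2 (V f).
Proof.
move=> f1; apply: (@in_L2_bounded _ (Int (fun t => `|f t|))) => [|x _].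
  exact: measurable_V.
exact: V_bounded.
Qed.

Lemma in_L2_ae f g : measurable_fun I g -> f = g %[ae leb in I] -> in_L2 f -> in_L2 g.
Proof.
move=> mg fg [mf f2]; split=> //; move: f2; congr (_ < _)%E; apply: ae_eq_integral => //.
- by apply/measurable_EFinP; exact: measurable_funX.
- by apply/measurable_EFinP; exact: measurable_funX.
- by apply: aeS fg => x /[apply] ->.
Qed.

End L2_unit_interval.

(** * The pseudo-inverse of the operator *)

Section inverse_operator.
Context {R : realType}.
Notation leb := (@lebesgue_measure R).
Notation I := (`]0, 1[%classic : set R).
Notation I01 := (`[0, 1]%classic : set R).
Local Notation H := (@L2_01 R).
Implicit Types (f g h p : R -> R) (u v w : H).

Let mI : measurable (I : set (measurableTypeR R)). Proof. exact: measurable_itv. Qed.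
Local Hint Resolve mI : core.

(** The class of [f], with 0 as default when there is none. *)
Definition toL2 f : H := xget 0 [set v : H | fun01 v = f %[ae leb in I]].

Lemma toL2E f : in_L2 f -> fun01 (toL2 f) = f %[ae leb in I].
Proof. by move=> /fun01_of h; exact: (xgetPex 0 h). Qed.

Lemma Int_fun01 u f (k : R -> R) : measurable_fun I f -> measurable_fun I k ->
  fun01 u = f %[ae leb in I] -> Int (fun x => fun01 u x * k x) = Int (fun x => f x * k x).
Proof.
move=> mf mk uf; apply: Int_ae.
- by apply: measurable_funM => //; exact: measurable_fun01.
- exact: measurable_funM.
- by apply: aeS uf => x /[apply] ->.
Qed.

Lemma L1M u v : L1 (fun x => fun01 u x * fun01 v x).
Proof.
have s w : L1 (fun x => fun01 w x ^+ 2).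
  have [mf f2] := in_L2_fun01 w.
  apply/integrableP; split; first by apply/measurable_EFinP; exact: measurable_funX.
  move: f2; congr (_ < _)%E; apply: eq_integral => x _ /=.
  by rewrite ger0_norm// sqr_ge0.
apply: (L1_le _ _ (L1D (s u) (s v))) => [|x _].
  by apply: measurable_funM; exact: measurable_fun01.
move: (fun01 u x) (fun01 v x) => r t; rewrite [leRHS]ger0_norm ?addr_ge0 ?sqr_ge0// normrM.
have := sqr_ge0 (`|r| - `|t|); rewrite sqrrB !real_normK ?num_real// => h.
have := mulr_ge0 (normr_ge0 r) (normr_ge0 t); lra.
Qed.

Lemma fun01D_eq u v f g : fun01 u = f %[ae leb in I] -> fun01 v = g %[ae leb in I] ->
  fun01 (u + v) = (fun x => f x + g x) %[ae leb in I].
Proof.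
move=> uf vg; apply: ae_trans (fun01D u v) _.
by apply: aeS2 uf vg => x h1 h2 Ix; rewrite h1// h2.
Qed.

Lemma fun01Z_eq (c : R) u f : fun01 u = f %[ae leb in I] ->
  fun01 (c *: u) = (fun x => c * f x) %[ae leb in I].
Proof.
by move=> uf; apply: ae_trans (fun01Z c u) _; apply: aeS uf => x /[apply] ->.
Qed.

(** * Orthogonal projection on the affine functions *)

Definition one01 : H := toL2 (fun=> 1).

(** Subtracting the mean makes it orthogonal to [one01]; the mean is left unevaluated. *)
Definition lin01 : H := toL2 (fun x => x - Int id).

Lemma L1_id : L1 (fun x : R => x).
Proof. by apply: continuous_L1 => x; exact: cvg_id. Qed.

Lemma one01E : fun01 one01 = cst 1 %[ae leb in I].
Proof. by apply: toL2E; apply: (@in_L2_bounded _ _ `|1|). Qed.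

Lemma lin01E : fun01 lin01 = (fun x => x - Int id) %[ae leb in I].
Proof.
apply: toL2E; apply: (@in_L2_bounded _ _ (1 + `|Int id|)) => [|x].
  by apply: L1_measurable; apply: L1B; [exact: L1_id|exact: L1_cst].
rewrite /= in_itv /= => /andP[x0 x1]; rewrite (le_trans (ler_normB _ _))// lerD2r.
by rewrite ger0_norm ?ltW.
Qed.

Lemma ip_one01 u : ip u one01 = Int (fun01 u).
Proof.
rewrite ipC ip_Int (@Int_fun01 _ (cst 1)) => [|||]; [|by []|exact: measurable_fun01|exact: one01E].
by apply: eq_Int => x _; rewrite mul1r.
Qed.

Lemma ip_lin01 u : ip u lin01 = Int (fun x => fun01 u x * x) - Int id * Int (fun01 u).
Proof.
have ml : measurable_fun I (fun x : R => x - Int id).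
  by apply: L1_measurable; apply: L1B; [exact: L1_id|exact: L1_cst].
rewrite ipC ip_Int (@Int_fun01 _ (fun x => x - Int id)) => [|||]; [| |exact: measurable_fun01|exact: lin01E]; last first.
  exact: ml.
have u1 := L1_fun01 u.
have ux : L1 (fun x => fun01 u x * x).
  apply: (@L1_mulr_bounded _ _ _ 1 u1) => [|x].
    exact: L1_measurable L1_id.
  by rewrite /= in_itv /= => /andP[x0 x1]; rewrite ger0_norm ?ltW.
rewrite -IntZ// -IntB//; last exact: L1Z.
by apply: eq_Int => x _; ring.
Qed.

Lemma ip_one01_one01 : ip one01 one01 = 1.
Proof.
rewrite ip_one01 -[RHS](Int_cst 1); apply: Int_ae; [exact: measurable_fun01|by []|].
exact: one01E.
Qed.

Lemma ip_lin01_one01 : ip lin01 one01 = 0.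
Proof.
rewrite ip_one01 (@Int_ae _ _ (fun x => x - Int id)).
- by rewrite IntB ?Int_cst ?subrr//; [exact: L1_id|exact: L1_cst].
- exact: measurable_fun01.
- by apply: L1_measurable; apply: L1B; [exact: L1_id|exact: L1_cst].
- exact: lin01E.
Qed.

Lemma V1 x : I01 x -> V (fun=> 1) x = x.
Proof. by rewrite /= in_itv /= => h; rewrite V_cst// mul1r. Qed.

(** Otherwise the primitive of 1 would be constant almost everywhere, and [V_ae_cst] would give 1 =
    0. *)
Lemma ip_lin01_neq0 : ip lin01 lin01 != 0.
Proof.
apply/eqP => /ip_eq0 l0; have := lin01E; rewrite l0 => h.
have : (fun x => V (fun=> 1) x + - Int id) = cst 0 %[ae leb in I].
  apply: aeS2 h fun01_0 => x h1 h2 Ix; rewrite V1; first by rewrite -h1// h2.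
  by move: Ix; rewrite /= !in_itv /= => /andP[/ltW -> /ltW ->].
move=> /(V_ae_cst (L1_cst 1))[_ /ae_dense_itv] /(_ 0 1)[||y [_ _ _ /eqP]].
- by rewrite /= in_itv /= lexx ler01.
- by [].
- by rewrite oner_eq0.
Qed.

Definition affine_proj u : H :=
  ip u one01 *: one01 + ((ip lin01 lin01)^-1 * ip u lin01) *: lin01.

Lemma affine_proj_lin (c : R) u v :
  affine_proj (c *: u + v) = c *: affine_proj u + affine_proj v.
Proof.
apply: ip_inj => w.
rewrite /affine_proj !(ipDl, ipZl, ipDr, ipZr).
by move: (ip _ _) (ip _ _) (ip _ _) (ip _ _) (_^-1) => *; ring.
Qed.

Lemma affine_proj_linear : linear affine_proj.
Proof. by move=> c u v; exact: affine_proj_lin. Qed.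

Lemma affine_proj_sym u v : ip (affine_proj u) v = ip u (affine_proj v).
Proof.
rewrite /affine_proj !(ipDl, ipZl, ipDr, ipZr) (ipC one01 v) (ipC lin01 v).
by move: (ip _ _) (ip _ _) (ip _ _) (ip _ _) (_^-1) => *; ring.
Qed.

Lemma affine_proj_fix (c1 c0 : R) u : fun01 u = (fun x => c1 * x + c0) %[ae leb in I] ->
  affine_proj u = u.
Proof.
move=> uE; have -> : u = (c0 + c1 * Int id) *: one01 + c1 *: lin01.
  apply: fun01_inj.
  apply: ae_trans uE (ae_sym _).
  apply: ae_trans (fun01D_eq (fun01Z_eq _ one01E) (fun01Z_eq _ lin01E)) _.
  by apply: eq_ae => x _ /=; ring.
rewrite /affine_proj !(ipDl, ipZl) ip_one01_one01 ip_lin01_one01 (ipC one01 lin01) ip_lin01_one01.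
by rewrite !mulr0 !mulr1 !addr0 add0r mulrCA mulVf ?mulr1// ip_lin01_neq0.
Qed.

Lemma affine_projE u : exists c1 c0,
  fun01 (affine_proj u) = (fun x => c1 * x + c0) %[ae leb in I].
Proof.
exists ((ip lin01 lin01)^-1 * ip u lin01),
  (ip u one01 - (ip lin01 lin01)^-1 * ip u lin01 * Int id).
apply: ae_trans (fun01D_eq (fun01Z_eq _ one01E) (fun01Z_eq _ lin01E)) _.
by apply: eq_ae => x _ /=; ring.
Qed.

Lemma affine_projK u : affine_proj (affine_proj u) = affine_proj u.
Proof. by have [c1 [c0]] := affine_projE u; exact: affine_proj_fix. Qed.

Lemma Int_V f : L1 f -> Int (V f) = Int f - Int (fun x => f x * x).
Proof.
move=> f1; have := Int_by_parts f1 (L1_cst 1).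
rewrite Int_cst mulr1 (@eq_Int _ (fun x => V f x * 1) (V f)) => [|x _]; last by rewrite mulr1.
rewrite (@eq_Int _ (fun x => f x * V (fun=> 1) x) (fun x => f x * x)) => [<-|x]; first by rewrite addrK.
by rewrite /= in_itv /= => /andP[/ltW x0 /ltW x1]; rewrite V1//= in_itv /= x0.
Qed.

(** Through [Int_V], the moments of orders 0 and 1 become the values at 1 of the first and second
    primitives. *)
Lemma affine_proj_eq0 u : affine_proj u = 0 <->
  Int (fun01 u) = 0 /\ Int (V (fun01 u)) = 0.
Proof.
have Pe : affine_proj u = 0 <-> ip u one01 = 0 /\ ip u lin01 = 0.
  split=> [Pu|[h1 h2]]; last by rewrite /affine_proj h1 h2 mulr0 !scale0r addr0.
  have e k c1 c0 : fun01 k = (fun x => c1 * x + c0) %[ae leb in I] -> ip u k = 0.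
    by move=> /affine_proj_fix <-; rewrite -affine_proj_sym Pu ipC ip0.
  split; first by apply: (e _ 0 1); apply: ae_trans one01E _; apply: eq_ae => x _; rewrite mul0r add0r.
  by apply: (e _ 1 (- Int id)); apply: ae_trans lin01E _; apply: eq_ae => x _; rewrite mul1r.
rewrite Pe ip_one01 ip_lin01 Int_V; last exact: L1_fun01.
split=> -[-> h]; split=> //; move: h; rewrite !(mulr0, subr0, sub0r); first by move=> ->; rewrite oppr0.
by move=> /eqP; rewrite oppr_eq0 => /eqP.
Qed.

(** * The Green operator: symmetry, positivity, bound and kernel *)

Variables (a : R -> R) (x0 : R).
Hypothesis ax0 : a x0 = 0.
Hypothesis a_gt0 : forall x, I01 x -> x != x0 -> 0 < a x.
Hypothesis aV1 : L1 (fun x => (a x)^-1).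

Lemma aV_ge0 x : I x -> 0 <= (a x)^-1.
Proof.
rewrite /= in_itv /= => /andP[/ltW h0 /ltW h1]; rewrite invr_ge0.
(* At [x0] the inverse of [a x0 = 0] is 0. *)
have [->|xx0] := eqVneq x x0; first by rewrite ax0.
by apply/ltW/a_gt0 => //=; rewrite in_itv /= h0.
Qed.

(* The second derivative of the solution of [(a u'')'' = f]. *)
Definition bending f : R -> R := fun x => (a x)^-1 * V (V f) x.

Lemma L1_bending f : L1 f -> L1 (bending f).
Proof. by move=> f1; apply: L1_mulV => //; exact: L1_V. Qed.

Definition deflection f : R -> R := V (V (bending f)).

Lemma deflection_ae f g : L1 f -> L1 g -> f = g %[ae leb in I] -> deflection f = deflection g.
Proof.
move=> f1 g1 fg; rewrite /deflection /bending.
by rewrite (V_ae (L1_measurable f1) (L1_measurable g1) fg).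
Qed.

Lemma V_lin c f g : L1 f -> L1 g -> V (fun x => c * f x + g x) = (fun x => c * V f x + V g x).
Proof. by move=> f1 g1; apply/funext => x; rewrite VD ?VZ//; exact: L1Z. Qed.

Lemma deflection_lin c f g : L1 f -> L1 g ->
  deflection (fun x => c * f x + g x) = (fun x => c * deflection f x + deflection g x).
Proof.
move=> f1 g1; rewrite /deflection.
have -> : bending (fun x => c * f x + g x) = (fun x => c * bending f x + bending g x).
  apply/funext => x; rewrite /bending V_lin// V_lin; [|exact: L1_V|exact: L1_V].
  by rewrite mulrDr mulrCA.
by rewrite V_lin ?V_lin//; try apply: L1_V; exact: L1_bending.
Qed.

Lemma in_L2_deflection f : L1 f -> in_L2 (deflection f).
Proof. by move=> f1; apply/in_L2_V/L1_V/L1_bending. Qed.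

Definition deflection_op u : H := toL2 (deflection (fun01 u)).

Lemma deflection_opE u : fun01 (deflection_op u) = deflection (fun01 u) %[ae leb in I].
Proof. by apply/toL2E/in_L2_deflection/L1_fun01. Qed.

Lemma fun01_lin (c : R) u v :
  fun01 (c *: u + v) = (fun x => c * fun01 u x + fun01 v x) %[ae leb in I].
Proof.
have h1 := fun01D (c *: u) v; have h2 := fun01Z c u.
by apply: aeS2 h1 h2 => x {}h1 {}h2 Ix; rewrite h1// h2.
Qed.

Lemma deflection_op_lin (c : R) u v :
  deflection_op (c *: u + v) = c *: deflection_op u + deflection_op v.
Proof.
apply: fun01_inj; apply: ae_trans (deflection_opE _) (ae_sym _).
apply: ae_trans (fun01D_eq (fun01Z_eq c (deflection_opE u)) (deflection_opE v)) _.
have u1 := L1_fun01 u; have v1 := L1_fun01 v.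
have cuv : L1 (fun x => c * fun01 u x + fun01 v x) by apply: L1D => //; exact: L1Z.
rewrite (deflection_ae (L1_fun01 _) cuv (fun01_lin c u v)) deflection_lin//.
exact: eq_ae.
Qed.

Lemma deflection_op_linear : linear deflection_op.
Proof. by move=> c u v; exact: deflection_op_lin. Qed.

(** Each of the two integrations by parts has a boundary term with a factor [Int k] or
    [Int (V k)]. *)
Lemma Int_V2_sym p k : L1 p -> L1 k -> Int k = 0 -> Int (V k) = 0 ->
  Int (fun x => V (V p) x * k x) = Int (fun x => p x * V (V k) x).
Proof.
move=> p1 k1 k0 k0'.
have := Int_by_parts (L1_V p1) k1; rewrite k0 mulr0 => h1.
have := Int_by_parts p1 (L1_V k1); rewrite k0' mulr0 => h2.
by move: h1 h2; set A := Int _; set B := Int _; set C := Int _; lra.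
Qed.

Definition recenter u : H := u - affine_proj u.

Lemma recenter_lin (c : R) u v : recenter (c *: u + v) = c *: recenter u + recenter v.
Proof.
by rewrite /recenter affine_proj_lin scalerBr opprD addrACA.
Qed.

Lemma recenter_linear : linear recenter.
Proof. by move=> c u v; exact: recenter_lin. Qed.

Lemma recenter_sym u v : ip (recenter u) v = ip u (recenter v).
Proof. by rewrite /recenter ipBl ipBr affine_proj_sym. Qed.

Lemma affine_proj_recenter u : affine_proj (recenter u) = 0.
Proof.
apply: ip_inj => w; rewrite -affine_proj_sym /recenter ipBr.
by rewrite -(affine_proj_sym (affine_proj w)) affine_projK affine_proj_sym subrr ip0.
Qed.

Lemma recenter_affine_proj u : recenter (affine_proj u) = 0.
Proof. by rewrite /recenter affine_projK subrr. Qed.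

(** Moved onto the second argument of [ip], the outer recentring gives it the zero moments that
    [Int_V2_sym] requires; the inner one makes the operator symmetric. *)
Definition compliance u : H := recenter (deflection_op (recenter u)).

Lemma compliance_linear : linear compliance.
Proof.
by move=> c u v; rewrite /compliance recenter_linear deflection_op_linear recenter_linear.
Qed.

Lemma L1_bending_mul f g : L1 f -> L1 g -> L1 (fun x => bending f x * V (V g) x).
Proof. by move=> f1 g1; apply: L1_mulV; [exact: L1_bending|exact: L1_V]. Qed.

(** Symmetric in [u] and [v] and weighted by [a^-1], this formula yields symmetry, positivity, the
    bound and the kernel. *)
Lemma ip_compliance u v : ip (compliance u) v =
  Int (fun x => bending (fun01 (recenter u)) x * V (V (fun01 (recenter v))) x).
Proof.
rewrite /compliance recenter_sym ip_Int.
have [h1 h2] := (affine_proj_eq0 (recenter v)).1 (affine_proj_recenter v).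
have u1 := L1_fun01 (recenter u).
rewrite (@Int_fun01 _ (deflection (fun01 (recenter u)))); last exact: deflection_opE.
- by apply: Int_V2_sym => //; [exact: L1_bending|exact: L1_fun01].
- exact: L1_measurable (L1_V (L1_V (L1_bending u1))).
- exact: measurable_fun01.
Qed.

Lemma compliance_sym u v : ip (compliance u) v = ip u (compliance v).
Proof.
rewrite ip_compliance ipC ip_compliance; apply: eq_Int => x _.
exact: mulrAC.
Qed.

Lemma bending_mul_ge0 f (x : R) : I x -> 0 <= bending f x * V (V f) x.
Proof.
move=> Ix; rewrite /bending -mulrA -expr2.
by apply: mulr_ge0; [exact: aV_ge0|exact: sqr_ge0].
Qed.

Lemma compliance_ge0 u : 0 <= ip (compliance u) u.
Proof.
rewrite ip_compliance; apply: Rintegral_ge0 => x Ix.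
exact: bending_mul_ge0.
Qed.

(** Cauchy-Schwarz against 1 on an interval of length 1: integrate (|u| - m)^2 >= 0, where [m] is
    the mean of |u|. *)
Lemma ip_fun01_sqr u : Int (fun x => `|fun01 u x|) ^+ 2 <= ip u u.
Proof.
have u1 := L1_norm (L1_fun01 u); set m := Int _.
have uu : L1 (fun x => fun01 u x * fun01 u x) by exact: L1M.
have h1 : L1 (fun x => fun01 u x * fun01 u x - (2 * m) * `|fun01 u x|).
  by apply: L1B => //; exact: L1Z.
have : 0 <= Int (fun x => fun01 u x * fun01 u x - (2 * m) * `|fun01 u x| + m ^+ 2).
  apply: Rintegral_ge0 => x _.
  rewrite (_ : _ + _ = (`|fun01 u x| - m) ^+ 2) ?sqr_ge0// sqrrB real_normK ?num_real//.
  by ring.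
rewrite IntD//; last exact: L1_cst.
rewrite IntB//; last exact: L1Z.
rewrite IntZ// Int_cst -ip_Int -/m => h; rewrite -subr_ge0; apply: le_trans h _.
by rewrite le_eqVlt; apply/orP; left; apply/eqP; ring.
Qed.

Lemma recenter_le u : ip (recenter u) (recenter u) <= ip u u.
Proof.
have e : ip (affine_proj u) u = ip (affine_proj u) (affine_proj u).
  by rewrite [RHS]affine_proj_sym affine_projK -affine_proj_sym.
have := ip_ge0 (affine_proj u); rewrite -e /recenter !(ipBl, ipBr) -e (ipC u (affine_proj u)); lra.
Qed.

(** The maximum with 1 makes the bound positive at once. *)
Definition compliance_bound : R := Num.max 1 (Int (fun x => (a x)^-1)).

Lemma compliance_bound_gt0 : 0 < compliance_bound.
Proof. by rewrite lt_max ltr01. Qed.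

(** The double primitive is bounded pointwise by the L1 norm of the recentred function, hence by its
    L2 norm; what remains is the integral of [a^-1]. *)
Lemma compliance_le u : ip (compliance u) u <= compliance_bound * ip u u.
Proof.
have h : ip (compliance u) u <= ip (recenter u) (recenter u) * Int (fun x => (a x)^-1).
  rewrite ip_compliance -IntZ//; have u1 := L1_fun01 (recenter u).
  apply: le_Int => [||x Ix]; [exact: L1_bending_mul|exact: L1Z|].
  rewrite /bending -mulrA mulrC ler_wpM2r ?aV_ge0// -expr2.
  apply: le_trans (ip_fun01_sqr _); rewrite -[leLHS]real_normK ?num_real//.
  have M0 : 0 <= Int (fun x => `|fun01 (recenter u) x|) by apply: le_trans (normr_ge0 _) (V_bounded 0 u1).
  rewrite ler_pXn2r ?nnegrE// (le_trans (V_bounded x (L1_V u1)))//.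
  rewrite -[leRHS]Int_cst; apply: le_Int => [||y _]; [exact/L1_norm/L1_V|exact: L1_cst|].
  exact: V_bounded.
have c1 : Int (fun x => (a x)^-1) <= compliance_bound by rewrite le_max lexx orbT.
apply: (le_trans h); rewrite mulrC; apply: (@le_trans _ _ (compliance_bound * ip (recenter u) (recenter u))).
  by rewrite ler_wpM2r ?ip_ge0.
by rewrite ler_wpM2l ?recenter_le// ltW ?compliance_bound_gt0.
Qed.

Lemma compliance_affine_proj u : compliance (affine_proj u) = 0.
Proof.
have d0 : deflection_op 0 = 0.
  by have := deflection_op_lin (-1) 0 0; rewrite scaler0 addr0 scaleN1r addNr.
have c0 : recenter 0 = 0 by have := recenter_lin (-1) 0 0; rewrite scaler0 addr0 scaleN1r addNr.
by rewrite /compliance recenter_affine_proj d0 c0.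
Qed.

(** A zero quadratic form makes its nonnegative integrand vanish almost everywhere. The weight is
    positive off [x0], so the double primitive of the recentred function is 0, and [V_ae_cst]
    removes the two primitives. *)
Lemma compliance_ker u : compliance u = 0 -> affine_proj u = u.
Proof.
move=> Ku; have u1 := L1_fun01 (recenter u).
have : ip (compliance u) u = 0 by rewrite Ku ipC ip0.
rewrite ip_compliance => h0.
have bL := L1_bending_mul u1 u1.
have z : (fun x => bending (fun01 (recenter u)) x * V (V (fun01 (recenter u))) x) = cst 0 %[ae leb in I].
  have : (\int[leb]_(x in I) `|(bending (fun01 (recenter u)) x * V (V (fun01 (recenter u))) x)%:E| = 0)%E.
    transitivity (Int (fun x => bending (fun01 (recenter u)) x * V (V (fun01 (recenter u))) x))%:E; last first.
      by rewrite h0.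
    rewrite /Int /Rintegral fineK; last exact: integrable_fin_num bL.
    apply: eq_integral => x /set_mem Ix /=; rewrite ger0_norm//.
    exact: bending_mul_ge0.
  move=> /(ae_eq_integral_abs leb mI (measurable_int _ bL)).
  by apply: aeS => x h Ix; have := h Ix => -[].
have : (fun x => V (V (fun01 (recenter u))) x + 0) = cst 0 %[ae leb in I].
  apply: aeS2 z (ae_neq x0) => x h xx0 Ix; have := h Ix.
  rewrite /bending -mulrA => /eqP; rewrite mulf_eq0 invr_eq0 gt_eqF/=; last first.
    by apply: a_gt0 => //; move: Ix; rewrite /= !in_itv /= => /andP[/ltW -> /ltW ->].
  by rewrite mulf_eq0 orbb addr0 => /eqP.
move=> /(V_ae_cst (L1_V u1))[_ h].
have : (fun x => V (fun01 (recenter u)) x + 0) = cst 0 %[ae leb in I].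
  by apply: aeS h => x /[apply] ->; rewrite addr0.
move=> /(V_ae_cst u1)[_ h'].
have : recenter u = 0 by apply: fun01_inj; apply: ae_trans h' (ae_sym fun01_0).
by rewrite /recenter => /eqP; rewrite subr_eq0 => /eqP <-.
Qed.

End inverse_operator.

(** * The graph of the operator *)

Section characterization.
Context {R : realType}.
Notation leb := (@lebesgue_measure R).
Notation I := (`]0, 1[%classic : set R).
Notation I01 := (`[0, 1]%classic : set R).
Local Notation H := (@L2_01 R).
Implicit Types (f g h p : R -> R) (u v w y : H).

Let mI : measurable (I : set (measurableTypeR R)). Proof. exact: measurable_itv. Qed.
Local Hint Resolve mI : core.

Lemma within_punctured x0 (q l : R) (F : R -> R) : q != x0 ->
  F z @[z --> within (I01 `\ x0) q^'] --> l -> F z @[z --> within I01 q^'] --> l.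
Proof.
move=> qx0 /cvgrPdist_lt h; apply/cvgrPdist_lt => e /h.
rewrite !near_withinE => -[r /= r0 rb].
have d0 : 0 < `|q - x0| by rewrite normr_gt0 subr_eq0.
exists (Num.min r `|q - x0|); first by rewrite /= lt_min r0.
move=> z; rewrite /ball /= lt_min => /andP[zr zx0] zq Iz; apply: rb => //; split=> // zE.
by move: zx0; rewrite zE ltxx.
Qed.

Lemma within_dnbhs (D : set R) (q : R) f : {within D, continuous f} -> D q ->
  f z @[z --> within D q^'] --> f q.
Proof.
move=> /subspace_continuousP /[apply] /cvgrPdist_lt h; apply/cvgrPdist_lt => e /h.
by rewrite !near_withinE => -[r r0 rb]; exists r => // z zr zq; exact: rb.
Qed.

Variables (a : R -> R) (x0 : R).
Hypothesis ax0 : a x0 = 0.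
Hypothesis a_gt0 : forall x, I01 x -> x != x0 -> 0 < a x.
Hypothesis aV1 : L1 (fun x => (a x)^-1).
Hypothesis ca : {within I01, continuous a}.

(** Either side says that [u - d], with [d] the deflection of [y], is fixed by [affine_proj]. *)
Lemma graph_compliance u y : affine_proj y = 0 ->
  (u - affine_proj u = compliance a y <->
   exists c1 c0, fun01 u = (fun x => deflection a (fun01 y) x + (c1 * x + c0)) %[ae leb in I]).
Proof.
move=> Py; have cy : recenter y = y by rewrite /recenter Py subr0.
have dE := deflection_opE aV1 y.
set d := deflection_op a y in dE.
have PB v w : affine_proj (v - w) = affine_proj v - affine_proj w.
  by have := affine_proj_lin (-1) w v; rewrite !scaleN1r addrC [in RHS]addrC.
have -> : compliance a y = d - affine_proj d by rewrite /compliance cy.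
split=> [e|[c1 [c0 uE]]].
  have [c1 [c0 h]] := affine_projE (u - d); exists c1, c0.
  have uE : u = d + affine_proj (u - d).
    by rewrite PB addrA addrAC -e subrK.
  by have := fun01D_eq dE h; rewrite -uE.
have : affine_proj (u - d) = u - d.
  apply: (@affine_proj_fix _ c1 c0); apply: ae_trans (fun01B _ _) _.
  by apply: aeS2 uE dE => x h1 h2 Ix; rewrite h1// h2//; ring.
rewrite PB => /eqP; rewrite subr_eq => /eqP ->.
by rewrite opprD opprB addrA subrKC.
Qed.

Lemma ae_a_neq0 : {ae leb, forall x, I x -> a x != 0}.
Proof.
apply: aeS (ae_neq x0) => x xx0 Ix; rewrite gt_eqF// a_gt0//.
by move: Ix; rewrite /= !in_itv /= => /andP[/ltW -> /ltW ->].
Qed.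

Lemma measurable_a : measurable_fun I a.
Proof.
apply: (@measurable_funS _ _ _ _ (`[0, 1] : set (measurableTypeR R))) => //.
  by apply: subset_itvW.
exact: subspace_continuous_measurable_fun.
Qed.

Lemma I01_0 : I01 0. Proof. by rewrite /= in_itv /= lexx ler01. Qed.

Lemma I01_1 : I01 1. Proof. by rewrite /= in_itv /= lexx ler01. Qed.

(** * Boundary values of [W], the smooth representative of a u'' *)

Section boundary_values.
Variables (u u2 : R -> R) (f : R -> R) (k1 k0 : R).
Hypothesis f1 : L1 f.
Hypothesis uu2 : weak_derivative2 u u2.
Let W x := V (V f) x + k1 * x + k0.
Let W' x := V f x + k1.
Hypothesis au2 : a \* u2 = W %[ae leb in I].

Let cW : {within I01, continuous W}.
Proof.
apply: continuous_subspaceT => x; apply: cvgD; last exact: cvg_cst.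
apply: cvgD; first exact/V_continuous/L1_V.
by apply: cvgMr; exact: cvg_id.
Qed.

Let cW' : continuous W'.
Proof. by move=> x; apply: cvgD; [exact: V_continuous|exact: cvg_cst]. Qed.

Let WV x : I01 x -> W x = V W' x + k0.
Proof.
rewrite /= in_itv /= => h; rewrite /W /W' VD ?V_cst//; [exact: L1_V|exact: L1_cst].
Qed.

Let W'1 : L1 W'. Proof. by apply: L1D; [exact: L1_V|exact: L1_cst]. Qed.

(** Weak derivatives and continuous representatives are unique, so the [X] and [X1] of the boundary
    condition agree with [W] and [W'] on all of [0, 1]. *)
Lemma degenerate_bc_values q : I01 q -> degenerate_bc a u q -> W q = 0 /\ W' q = 0.
Proof.
move=> Iq [X [X1 [[v2 uv2 aX] XX1 [cX cX1] Xq X1q]]].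
have mX : measurable_fun I X by case: XX1 => /L1_measurable.
have XW : X = W %[ae leb in I].
  have vu := weak_derivative2_unique uv2 uu2.
  apply: ae_trans (ae_sym aX) (ae_trans _ au2).
  by apply: aeS vu => x vu Ix; rewrite [LHS](_ : _ = a x * v2 x)// vu.
have XX q' : I01 q' -> X q' = W q' by move=> Iq'; exact: (ae_eq_continuous cX cW XW).
split; first by rewrite -XX.
rewrite -X1q; apply/esym; apply: (ae_eq_continuous cX1 _ _ Iq); first exact: continuous_subspaceT.
apply: weak_derivative_unique XX1 _.
apply: weak_derivative_ae mX (L1_measurable W'1) _ (eq_ae (fun _ _ => erefl)) (weak_derivative_V k0 W'1).
apply: eq_ae => x Ix; have Ix' : I01 x.
  by move: Ix; rewrite /= !in_itv /= => /andP[/ltW -> /ltW ->].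
by rewrite XX// WV.
Qed.

(** As [v2] and its derivative vanish at [q] and [a] has a limit there, [a * v2] is o(z - q). It
    equals [W] only almost everywhere, hence the comparison of limits by [cvg_ae_eq0]. *)
Lemma natural_bc_values q : I01 q -> q != x0 -> natural_bc x0 u q -> W q = 0 /\ W' q = 0.
Proof.
move=> Iq qx0 [v2 [v3 [uv2 [_ dv2] v2q v3q]]].
have aV2 : a \* v2 = W %[ae leb in I].
  have vu := weak_derivative2_unique uv2 uu2; apply: ae_trans _ au2.
  by apply: aeS vu => x vu Ix; rewrite [LHS](_ : _ = a x * v2 x)// vu.
have aq : a z @[z --> within I01 q^'] --> a q by exact: within_dnbhs.
have dq : a z * ((v2 z - v2 q) / (z - q)) @[z --> within I01 q^'] --> 0.
  have l3 : (v2 z - v2 q) / (z - q) @[z --> within I01 q^'] --> v3 q.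
    by apply: (within_punctured qx0); apply: dv2; split=> //; exact/eqP.
  by have := cvgM aq l3; rewrite v3q mulr0; apply.
have idq : z - q @[z --> within I01 q^'] --> 0.
  have h : {within I01, continuous (fun z => z - q)}.
    by apply: continuous_subspaceT => z; apply: cvgB; [exact: cvg_id|exact: cvg_cst].
  by have := within_dnbhs h Iq; rewrite subrr.
have Wq : W q = 0.
  (* This expression tends to [W q] by continuity, and is 0 almost everywhere because [v2 q = 0]. *)
  have lim : W z - (z - q) * (a z * ((v2 z - v2 q) / (z - q))) @[z --> within I01 q^'] --> W q.
    by have := cvgB (within_dnbhs cW Iq) (cvgM idq dq); rewrite mul0r subr0; apply.
  apply: (cvg_ae_eq0 Iq lim); apply: aeS2 aV2 (ae_neq q) => z h zq Iz.
  have {}h : a z * v2 z = W z by exact: h.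
  by rewrite /= -h v2q subr0; field; rewrite subr_eq0.
split=> //.
have lim : (W z - W q) / (z - q) - a z * ((v2 z - v2 q) / (z - q)) @[z --> within I01 q^'] --> W' q.
  have l1 : (W z - W q) / (z - q) @[z --> within I01 q^'] --> W' q.
    have := V_quotient W'1 cW' Iq; apply: cvg_trans; apply: near_eq_cvg.
    rewrite near_withinE; near=> z => Iz; rewrite !WV//.
    by congr (_ / _); rewrite opprD addrACA subrr addr0.
  by have := cvgB l1 dq; rewrite subr0; apply.
apply: (cvg_ae_eq0 Iq lim); apply: aeS2 aV2 (ae_neq q) => z h zq Iz.
have {}h : a z * v2 z = W z by exact: h.
by rewrite /= -h v2q Wq !subr0; field; rewrite subr_eq0.
Unshelve. all: by end_near. Qed.

End boundary_values.

End characterization.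

(** * The graph of [A1] in terms of the compliance operator *)

Section characterization_A1.
Context {R : realType}.
Notation leb := (@lebesgue_measure R).
Notation I := (`]0, 1[%classic : set R).
Notation I01 := (`[0, 1]%classic : set R).
Local Notation H := (@L2_01 R).
Implicit Types (f g h p : R -> R) (u v w y : H).

Let mI : measurable (I : set (measurableTypeR R)). Proof. exact: measurable_itv. Qed.
Local Hint Resolve mI : core.

Variables (a : R -> R) (x0 : R).
Hypothesis ax0 : a x0 = 0.
Hypothesis a_gt0 : forall x, I01 x -> x != x0 -> 0 < a x.
Hypothesis aV1 : L1 (fun x => (a x)^-1).
Hypothesis ca : {within I01, continuous a}.
Hypothesis a_C1 : exists a', C1_on (I01 `\ x0) a a'.

(** Wherever [x0] lies, [W] and [W'] vanish at both endpoints. The conditions at 0 remove the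
    integration constants [k1] and [k0]; those at 1 become [affine_proj y = 0]. *)
Lemma A1_compliance u y : A1 a x0 (u, y) ->
  affine_proj y = 0 /\
  exists c1 c0, fun01 u = (fun x => deflection a (fun01 y) x + (c1 * x + c0)) %[ae leb in I].
Proof.
move=> [[_ bc] [u2 uu2 /weak_derivative2P[_ y1 [k1 [k0 aW]]]]] /=.
rewrite /= in bc uu2 y1 aW.
have nb q : I01 q -> q != x0 -> natural_bc x0 (fun01 u) q ->
    V (V (fun01 y)) q + k1 * q + k0 = 0 /\ V (fun01 y) q + k1 = 0.
  by move=> Iq q0 b; have := natural_bc_values ca y1 uu2 aW Iq q0 b.
have db q : I01 q -> degenerate_bc a (fun01 u) q ->
    V (V (fun01 y)) q + k1 * q + k0 = 0 /\ V (fun01 y) q + k1 = 0.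
  by move=> Iq b; have := degenerate_bc_values y1 uu2 aW Iq b.
have [[e0 e0'] [e1 e1']] :
    (V (V (fun01 y)) 0 + k1 * 0 + k0 = 0 /\ V (fun01 y) 0 + k1 = 0) /\
    (V (V (fun01 y)) 1 + k1 * 1 + k0 = 0 /\ V (fun01 y) 1 + k1 = 0).
  have i0 := @I01_0 R; have i1 := @I01_1 R.
  move: bc; case: eqP => [x00 [n1 d0]|/eqP x00].
    by split; [exact: db|apply: nb => //; rewrite x00 oner_neq0].
  case: eqP => [x01 [n0 d1]|/eqP x01 [n0 n1]].
    by split; [apply: nb => //; rewrite x01 eq_sym oner_neq0|exact: db].
  by split; apply: nb => //; rewrite eq_sym.
move: e0'; rewrite V_le0// add0r => k10.
move: e0; rewrite V_le0// k10 mul0r !add0r => k00.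
move: e1 e1'; rewrite k10 k00 mul0r !addr0 !V_ge1// => e1 e1'.
split; first exact/affine_proj_eq0.
have [u1 u21 [c1 [c0 uE]]] := (weak_derivative2P _ _).1 uu2.
exists c1, c0; apply: ae_trans uE _; apply: eq_ae => x _; rewrite addrA /deflection.
rewrite (_ : V u2 = V (bending a (fun01 y)))//.
apply: V_ae; [exact: L1_measurable|exact: L1_measurable (L1_bending aV1 y1)|].
apply: aeS2 aW (ae_a_neq0 a_gt0) => z h az Iz; have {}az := az Iz.
have {}h : a z * u2 z = V (V (fun01 y)) z + k1 * z + k0 by exact: h.
by move: h; rewrite k10 k00 mul0r !addr0 /bending => <-; rewrite mulKf.
Qed.

(** * Regularity and boundary conditions of the constructed solution *)

Section solution.
Variables (u y : H) (c1 c0 : R).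
Hypothesis Py : affine_proj y = 0.
Hypothesis uE : fun01 u = (fun x => deflection a (fun01 y) x + (c1 * x + c0)) %[ae leb in I].
Let Y := fun01 y.
Let u2 := bending a Y.
Let u1 x := V u2 x + c1.
Let W := V (V Y).

Let y1 : L1 Y. Proof. exact: L1_fun01. Qed.

Let u21 : L1 u2. Proof. exact: L1_bending. Qed.

Let mu2 : measurable_fun I u2. Proof. exact: L1_measurable. Qed.

Let cst1 (c : R) : L1 (fun=> c). Proof. exact: L1_cst. Qed.

Let u11 : L1 u1. Proof. by apply: L1D => //; exact: L1_V. Qed.

Let wd_u : weak_derivative (fun01 u) u1.
Proof.
apply: weak_derivative_ae (weak_derivative_V c0 u11).
- exact: measurable_fun01.
- exact: L1_measurable.
- apply: ae_trans (ae_sym uE); apply: eq_ae => x.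
  rewrite /= in_itv /= => /andP[/ltW h0 /ltW h1].
  rewrite /u1 VD//; last exact: L1_V.
  by rewrite V_cst ?h0// /deflection addrA.
- exact: eq_ae.
Qed.

Let wd_u1 : weak_derivative u1 u2. Proof. exact: weak_derivative_V. Qed.

Let wd2_u : weak_derivative2 (fun01 u) u2. Proof. by exists u1. Qed.

Let au2 : a \* u2 = W %[ae leb in I].
Proof.
apply: aeS (ae_a_neq0 a_gt0) => z az Iz.
by rewrite [LHS](_ : _ = a z * u2 z)// /u2 /bending mulVKf// az.
Qed.

Let m_au2 : measurable_fun I (a \* u2).
Proof. by apply: measurable_funM => //; exact: measurable_a. Qed.

Let wd_au2 : weak_derivative (a \* u2) (V Y).
Proof.
have VY1 := L1_V y1.
apply: weak_derivative_ae (weak_derivative_V 0 VY1) => //.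
- exact: L1_measurable.
- by apply: ae_trans (ae_sym au2); apply: eq_ae => x _; rewrite addr0.
- exact: eq_ae.
Qed.

Let wd_VY : weak_derivative (V Y) Y.
Proof.
apply: weak_derivative_ae (weak_derivative_V 0 y1).
- exact: measurable_V.
- exact: measurable_fun01.
- by apply: eq_ae => x _; rewrite addr0.
- exact: eq_ae.
Qed.

(** Because a u2^2 = u2 W, a product of an integrable and a bounded function. *)
Let in_L2_sqrt : in_L2 (fun x => Num.sqrt (a x) * u2 x).
Proof.
have ma := measurable_a ca.
split.
  apply: measurable_funM => //; apply: measurableT_comp => //.
  by apply: continuous_measurable_fun; exact: sqrt_continuous.
have h : L1 (fun x => u2 x * W x) by exact: L1_bending_mul.
case/integrableP: h => _; congr (_ < _)%E; apply: eq_integral => x /set_mem Ix /=.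
rewrite ger0_norm; last exact: (@bending_mul_ge0 _ _ _ ax0 a_gt0 Y x Ix).
congr (_%:E); have a0 := aV_ge0 ax0 a_gt0 Ix; rewrite invr_ge0 in a0.
rewrite exprMn sqr_sqrtr// /u2 /bending -/W.
(* At a zero of [a] both sides vanish, the inverse of 0 being 0. *)
have [->|an0] := eqVneq (a x) 0; first by rewrite invr0 !mul0r.
by field.
Qed.

Let H2_au2 : H2 (a \* u2).
Proof.
have VY2 : in_L2 (V Y) by exact: in_L2_V.
split; [split|].
- exact: in_L2_ae m_au2 (ae_sym au2) (in_L2_V (L1_V y1)).
- by exists (V Y).
- exists (V Y) => //; split=> //; exists Y => //; exact: in_L2_fun01.
Qed.

Let Z_u : Z a (fun01 u).
Proof.
split; last by exists u2.
split.
- split; first exact: in_L2_fun01.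
  exists u1 => //; apply: (@in_L2_bounded _ _ (Int (fun t => `|u2 t|) + `|c1|)).
    exact: L1_measurable.
  by move=> x _; rewrite (le_trans (ler_normD _ _))// lerD2r V_bounded.
- exists u1 => // e e0; have [d d0 h] := V_absolutely_continuous u21 e0.
  exists d => // n s t st disj lt.
  have incr i : u1 (t i) - u1 (s i) = V u2 (t i) - V u2 (s i).
    by rewrite /u1 opprD addrACA subrr addr0.
  rewrite (eq_bigr (fun i => `|V u2 (t i) - V u2 (s i)|)); first exact: h st disj lt.
  by move=> i _; rewrite incr.
- by exists u2.
Qed.

Let bc_data : [/\ W 0 = 0, V Y 0 = 0, W 1 = 0 & V Y 1 = 0].
Proof.
have [Y0 VY0] := (affine_proj_eq0 y).1 Py.
by split; [exact: V_le0|exact: V_le0|rewrite /W V_ge1|rewrite V_ge1].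
Qed.

Let degenerate q : W q = 0 -> V Y q = 0 -> degenerate_bc a (fun01 u) q.
Proof.
move=> Wq VYq; exists W, (V Y); split=> //.
- by exists u2.
- apply: weak_derivative_ae wd_au2 => //; [exact: measurable_V (L1_V y1)|exact: measurable_V|exact: eq_ae].
- by split; apply: V_within_continuous => //; exact: L1_V.
Qed.

Let natural q : W q = 0 -> V Y q = 0 -> natural_bc x0 (fun01 u) q.
Proof.
move=> Wq VYq; have [a' [ca' da]] := a_C1.
have aD x : (I01 `\ x0) x -> a x != 0.
  by move=> [Ix /eqP xx0]; rewrite gt_eqF// a_gt0.
have VYc := V_continuous y1; have Wc := V_continuous (L1_V y1).
have caD x : (I01 `\ x0) x -> a z @[z --> within (I01 `\ x0) (nbhs x)] --> a x.
  move=> [Ix _]; have := (subspace_continuousP _ _).1 ca x Ix.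
  by apply: cvg_trans; apply: cvg_app; apply: within_subset => // z [].
(* Quotient rule for [W / a], valid off [x0]. *)
exists u2, (fun x => ((V Y x) * a x - W x * a' x) / (a x * a x)); split=> //.
- split.
    apply/subspace_continuousP => x Dx.
    have wc f : continuous f -> f z @[z --> within (I01 `\ x0) (nbhs x)] --> f x.
      by move=> cf; apply: cvg_within_filter; exact: cf.
    have a'c := (subspace_continuousP _ _).1 ca' x Dx.
    apply: cvgM; first by apply: cvgB; apply: cvgM; [exact: wc|exact: caD|exact: wc|exact: a'c].
    apply: cvgV; first by rewrite mulf_neq0// aD.
    by apply: cvgM; exact: caD.
  move=> x Dx; have [Ix xx0] := Dx.
  have ac : a z @[z --> within (I01 `\ x0) x^'] --> a x.
    have := caD x Dx => /cvgrPdist_lt h; apply/cvgrPdist_lt => e /h.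
    by rewrite !near_withinE => -[r r0 rb]; exists r => // z zr zq; exact: rb.
  have dW : (W z - W x) / (z - x) @[z --> within (I01 `\ x0) x^'] --> V Y x.
    have := V_quotient (L1_V y1) VYc Ix; apply: cvg_trans; apply: cvg_app.
    by apply: within_subset => // z [].
  have ax_neq0 := aD x Dx.
  have aa0 : a x * a x != 0 by rewrite mulf_neq0.
  have aac : (a z * a x)^-1 @[z --> within (I01 `\ x0) x^'] --> (a x * a x)^-1.
    by apply: cvgV => //; apply: cvgM => //; exact: cvg_cst.
  have lim : ((W z - W x) / (z - x) * a x - W x * ((a z - a x) / (z - x))) * (a z * a x)^-1
      @[z --> within (I01 `\ x0) x^'] --> (V Y x * a x - W x * a' x) / (a x * a x).
    apply: cvgM => //; apply: cvgB; apply: cvgM; [exact: dW|exact: cvg_cst|exact: cvg_cst|].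
    exact: da.
  apply: cvg_trans lim; apply: near_eq_cvg.
  rewrite near_withinE; near=> z => Dz; have az := aD z Dz.
  have zx : z != x by near: z; exact: nbhs_dnbhs_neq.
  rewrite /u2 /bending -/W; field.
  by rewrite subr_eq0 zx az ax_neq0.
- by rewrite /u2 /bending -/W Wq mulr0.
- by rewrite VYq Wq !mul0r subrr mul0r.
Unshelve. all: by end_near. Qed.

Lemma solution_A1 : A1 a x0 (u, y).
Proof.
have [W0 VY0 W1 VY1] := bc_data.
split=> /=; last by exists u2 => //; exists (V Y).
split; first exact: Z_u.
case: ifP => _; first by split; [exact: natural|exact: degenerate].
case: ifP => _; first by split; [exact: natural|exact: degenerate].
by split; exact: natural.
Qed.

End solution.

Lemma A1_iff u y : A1 a x0 (u, y) <-> affine_proj y = 0 /\ u - affine_proj u = compliance a y.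
Proof.
split=> [/A1_compliance[Py h]|[Py e]]; first by split=> //; exact/graph_compliance.
by have [c1 [c0 h]] := (graph_compliance aV1 u Py).1 e; exact: solution_A1 Py h.
Qed.

End characterization_A1.

Theorem theorem2p1 (R : realType) (a : R -> R) (x0 : R)
    (hx0 : 0 <= x0 <= 1) (ha : weakly_degenerate a x0) :
  [/\ linear_operator (A1 a x0), dense (domain (A1 a x0)),
      selfadjoint (A1 a x0), nonnegative_operator (A1 a x0) &
      generates_contractive_analytic_semigroup (pi / 2)
        (opp_operator (complexify (A1 a x0)))].
Proof.
have [ax0 a_gt0 ca a_C1 aV1] := ha.
pose c := compliance_bound a; have c0 : 0 < c := compliance_bound_gt0 a.
have linK := compliance_linear aV1.
(* Dividing by the bound brings the operator between 0 and 1, as the functional calculus demands. *)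
have linG : linear (fun u : @L2_01 R => c^-1 *: compliance a u).
  by move=> k u v; rewrite linK scalerDr !scalerA mulrC.
pose G : {linear @L2_01 R -> @L2_01 R} :=
  HB.pack (fun u : @L2_01 R => c^-1 *: compliance a u)
    (GRing.isLinear.Build R (@L2_01 R) (@L2_01 R) *:%R _ linG).
pose P : {linear @L2_01 R -> @L2_01 R} :=
  HB.pack (@affine_proj R)
    (GRing.isLinear.Build R (@L2_01 R) (@L2_01 R) *:%R _ (@affine_proj_linear R)).
have G_sym u v : ip (G u) v = ip u (G v).
  by rewrite /G /= ipZl ipZr (compliance_sym aV1).
have G_ge0 u : 0 <= ip (G u) u.
  rewrite /G /= ipZl; apply: mulr_ge0; last exact: (compliance_ge0 ax0 a_gt0 aV1).
  by rewrite invr_ge0 ltW.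
have G_le1 u : ip (G u) u <= ip u u.
  rewrite /G /= ipZl mulrC ler_pdivrMr// mulrC.
  exact: (compliance_le ax0 a_gt0 aV1).
have GP u : G (P u) = 0.
  by rewrite /G /P /= (compliance_affine_proj aV1) scaler0.
have G_ker u : G u = 0 -> P u = u.
  rewrite /G /P /= => /eqP; rewrite scaler_eq0 invr_eq0 gt_eqF//= => /eqP.
  exact: (compliance_ker ax0 a_gt0 aV1).
have P_sym u v : ip (P u) v = ip u (P v) by exact: affine_proj_sym.
have PP u : P (P u) = P u by exact: affine_projK.
(* The factor [c] in the graph undoes the normalisation of [G]. *)
have -> : A1 a x0 = resolvent_graph G P c.
  apply/funext => -[u y]; apply/propext.
  rewrite (A1_iff ax0 a_gt0 aV1 ca a_C1) /resolvent_graph /G /P /= scalerA mulfV ?gt_eqF// scale1r.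
  by split=> -[].
have complete := @L2_cauchy_cvg _ _ R (@leb01 R).
have dA := resolvent_graph_dense c0 G_sym G_ge0 G_le1 P_sym PP GP G_ker complete.
split=> //.
- exact: resolvent_graph_linear.
- by split=> //; exact: resolvent_graph_selfadjoint.
- exact: resolvent_graph_nonneg.
- exact: (resolvent_graph_generates c0 G_sym G_ge0 G_le1 P_sym PP GP G_ker complete).
Qed.
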